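(* Let $k\in\mathbb{N}_0$. For each $f_k\in L_1^2((0,1)\times\mathbb{R};\mathbb{C})$ and $g_k\in H^{\frac12}(\mathbb{R};\mathbb{C})$ the boundary-value problem $$(\mathcal{D}_{1-k}\mathcal{D}_k+\partial_z^2)u_k=f_k,\quad 0<r<1,\qquad\qquad u_k=g_k,\quad r=1,$$ admits a unique weak solution $u_k\in H^1_{(k)}((0,1)\times\mathbb{R};\mathbb{C})$, and this weak solution depends continuously upon $f_k$ and $g_k$.
   Context: For $j\in\mathbb{Z}$, $\mathcal{D}_j:=\frac{\partial}{\partial r}+\frac jr$ and $\mathcal{D}_j^n:=\mathcal{D}_{j-(n-1)}\cdots\mathcal{D}_{j-1}\mathcal{D}_j$. $C^\infty_{(k)}([0,\infty)\times\mathbb{R};\mathbb{C})$ is the set of $f:[0,\infty)\times\mathbb{R}\to\mathbb{C}$ such that for all $0\le i\le n\le p$, $p\in\mathbb{N}_0$, the function $\mathcal{D}_{-k+i}^{\,n-i}\mathcal{D}_k^{\,i}\partial_z^{p-n}f$ is continuous on $[0,\infty)\times\mathbb{R}$ (after continuous extension to $r=0$) and $(k+n-2i)\mathcal{D}_{-k+i}^{\,n-i}\mathcal{D}_k^{\,i}\partial_z^{p-n}f|_{r=0}=0$. $\mathscr D_{(k)}([0,1]\times\mathbb{R};\mathbb{C})$ consists of the restrictions to $[0,1]\times\mathbb{R}$ of the compactly supported elements of $C^\infty_{(k)}([0,\infty)\times\mathbb{R};\mathbb{C})$, and $\mathscr D_{(k)}([0,1)\times\mathbb{R};\mathbb{C})$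 of those with compact support in $[0,1)\times\mathbb{R}$. $L_1^2((0,1)\times\mathbb{R};\mathbb{C})$ has norm $\|f\|_{L_1^2}^2=2\pi\int_{\mathbb{R}}\int_0^1|f(r,z)|^2\,r\,\mathrm dr\,\mathrm dz$ and the corresponding inner product $\langle\cdot,\cdot\rangle_{L_1^2}$. $H^1_{(k)}((0,1)\times\mathbb{R};\mathbb{C})$ is the completion of $\mathscr D_{(k)}([0,1]\times\mathbb{R};\mathbb{C})$ with respect to $$\|f\|_{H^1_{(k)}}^2=\|f\|_{L_1^2}^2+\|\partial_zf\|_{L_1^2}^2+\tfrac12\|\mathcal{D}_kf\|_{L_1^2}^2+\tfrac12\|\mathcal{D}_{-k}f\|_{L_1^2}^2$$ up to equivalence of norms, and $H^1_{(k)0}((0,1)\times\mathbb{R};\mathbb{C})$ is the closure in it of $\mathscr D_{(k)}([0,1)\times\mathbb{R};\mathbb{C})$. Restriction to $r=1$ extends to a continuous trace map $H^1_{(k)}((0,1)\times\mathbb{R};\mathbb{C})\to H^{\frac12}(\mathbb{R};\mathbb{C})$. A weak solution is a function $u_k\in H^1_{(k)}((0,1)\times\mathbb{R};\mathbb{C})$ which satisfies $u_k|_{r=1}=g_k$ in $H^{\frac12}(\mathbb{R};\mathbb{C})$ and $$\tfrac12\langle\mathcal{D}_ku_k,\mathcal{D}_k\phi_k\rangle_{L_1^2}+\tfrac12\langle\mathcal{D}_{-k}u_k,\mathcal{D}_{-k}\phi_k\rangle_{L_1^2}+\langle\partial_zu_k,\partial_z\phi_k\rangle_{L_1^2}+\langle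 f_k,\phi_k\rangle_{L_1^2}=0$$ for all $\phi_k\in H^1_{(k)0}((0,1)\times\mathbb{R};\mathbb{C})$. *)

(* Defs.v *)
From mathcomp Require Import all_boot all_order all_algebra.
From mathcomp Require Export complex.
From mathcomp Require Import all_classical all_reals all_analysis.

Set Implicit Arguments.
Unset Strict Implicit.
Unset Printing Implicit Defensive.

Import Order.TTheory GRing.Theory Num.Theory.
Import numFieldNormedType.Exports.

Local Open Scope classical_set_scope.
Local Open Scope ring_scope.
Local Open Scope complex_scope.

(* A point of the (r, z)-plane is x : R * R with r = x.1 and z = x.2.
   Functions are total; only their values on the relevant part of the half
   plane r >= 0 are ever used. *)

Definition half_plane (R : realType) : set (R * R) := [set x | 0 <= x.1].
Definition strip (R : realType) : set (R * R) := [set x | 0 < x.1 < 1].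
Definition closed_strip (R : realType) : set (R * R) := [set x | 0 <= x.1 <= 1].
Definition half_closed_strip (R : realType) : set (R * R) :=
  [set x | 0 <= x.1 < 1].
Arguments half_plane R : clear implicits.
Arguments strip R : clear implicits.
Arguments closed_strip R : clear implicits.
Arguments half_closed_strip R : clear implicits.

(* Complex-valued calculus in real variables, componentwise. *)

Definition cwithin_continuous (R : realType) (A : set (R * R))
    (f : R * R -> R[i]) : Prop :=
  {within A, continuous (fun x => complex.Re (f x))} /\
  {within A, continuous (fun x => complex.Im (f x))}.

Definition cderivable (R : realType) (h : R -> R[i]) (t : R) : Prop :=
  derivable (fun s => complex.Re (h s)) t 1 /\
  derivable (fun s => complex.Im (h s)) t 1.

Definition cderive (R : realType) (h : R -> R[i]) (t : R) : R[i] :=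
  derive1 (fun s => complex.Re (h s)) t +i*
  derive1 (fun s => complex.Im (h s)) t.

Definition dr (R : realType) (f : R * R -> R[i]) : R * R -> R[i] :=
  fun x => cderive (fun r => f (r, x.2)) x.1.

Definition dz (R : realType) (f : R * R -> R[i]) : R * R -> R[i] :=
  fun x => cderive (fun z => f (x.1, z)) x.2.

Definition dr_exists (R : realType) (f : R * R -> R[i]) : Prop :=
  forall x, 0 < x.1 -> cderivable (fun r => f (r, x.2)) x.1.

Definition dz_exists (R : realType) (f : R * R -> R[i]) : Prop :=
  forall x, 0 < x.1 -> cderivable (fun z => f (x.1, z)) x.2.

Definition calD (R : realType) (j : int) (f : R * R -> R[i]) : R * R -> R[i] :=
  fun x => dr f x + (j%:~R / x.1)%:C * f x.

(* calDn n j = D_{j-(n-1)} ... D_{j-1} D_j, with D_j applied first. *)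
Fixpoint calDn (R : realType) (n : nat) (j : int) (f : R * R -> R[i]) :
    R * R -> R[i] :=
  if n is n'.+1 then calD (j - n'%:Z) (calDn n' j f) else f.

Definition mixedD (R : realType) (k l i m : nat) (f : R * R -> R[i]) :
    R * R -> R[i] :=
  calDn l (i%:Z - k%:Z) (calDn i k%:Z (iter m (@dz R) f)).

(* C^oo_(k)([0,oo) x R; C).  The first clause says that all the derivatives
   D_{-k+i}^l D_k^i dz^m f exist for r > 0; E is the continuous extension of
   such a derivative to r = 0. *)
Definition Cinfty (R : realType) (k : nat) (f : R * R -> R[i]) : Prop :=
  [/\ (forall m, dz_exists (iter m (@dz R) f)) /\
        (forall l i m, dr_exists (mixedD k l i m f)),
      cwithin_continuous (half_plane R) f &
      forall i n p : nat, (i <= n <= p)%N ->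
        exists E : R * R -> R[i],
          [/\ cwithin_continuous (half_plane R) E,
              forall x, 0 < x.1 -> E x = mixedD k (n - i) i (p - n) f x &
              forall z : R,
                (k%:Z + n%:Z - 2 * i%:Z)%:~R * E (0, z) = 0]].

Definition compactly_supported_in (R : realType) (A : set (R * R))
    (f : R * R -> R[i]) : Prop :=
  exists K : set (R * R),
    [/\ compact K, K `<=` A & forall x, half_plane R x -> ~ K x -> f x = 0].

(* D_(k)([0,1] x R; C) *)
Definition test (R : realType) (k : nat) (phi : R * R -> R[i]) : Prop :=
  exists F : R * R -> R[i],
    [/\ Cinfty k F, compactly_supported_in (half_plane R) F &
        forall x, closed_strip R x -> phi x = F x].

(* D_(k)([0,1) x R; C) *)
Definition test0 (R : realType) (k : nat) (phi : R * R -> R[i]) : Prop :=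
  exists F : R * R -> R[i],
    [/\ Cinfty k F, compactly_supported_in (half_closed_strip R) F &
        forall x, closed_strip R x -> phi x = F x].

Definition leb (R : realType) : {measure set (measurableTypeR R) -> \bar R} :=
  @lebesgue_measure R.

Definition leb2 (R : realType) :
    {measure set (measurableTypeR R * measurableTypeR R)%type -> \bar R} :=
  (@lebesgue_measure R \x @lebesgue_measure R)%E.

Definition sqnormc (R : realType) (w : R[i]) : R := (Normc.normc w) ^+ 2.

Definition cmeasurable d (T : measurableType d) (R : realType) (A : set T)
    (f : T -> R[i]) : Prop :=
  measurable_fun A (fun x => complex.Re (f x)) /\
  measurable_fun A (fun x => complex.Im (f x)).

(* Squared norms are extended-real, so that no finiteness is presupposed. *)

Definition L2sq (R : realType) (f : R * R -> R[i]) : \bar R :=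
  ((2 * pi)%:E * \int[leb2 R]_(x in strip R) (sqnormc (f x) * x.1)%:E)%E.

Definition L2norm (R : realType) (f : R * R -> R[i]) : \bar R := sqrte (L2sq f).

Definition in_L2 (R : realType) (f : R * R -> R[i]) : Prop :=
  @cmeasurable _ (measurableTypeR R * measurableTypeR R)%type R (strip R) f /\
  (L2norm f < +oo)%E.

Definition L2ip (R : realType) (f h : R * R -> R[i]) : R[i] :=
  (2 * pi * \int[leb2 R]_(x in strip R) (complex.Re (f x * (h x)^*) * x.1)) +i*
  (2 * pi * \int[leb2 R]_(x in strip R) (complex.Im (f x * (h x)^*) * x.1)).

(* H^(1/2)(R; C), with the Gagliardo-Slobodeckij norm. On the diagonal the
   second integrand is 0 by the convention 0^-1 = 0; the diagonal is null. *)
Definition H12sq (R : realType) (g : R -> R[i]) : \bar R :=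
  (\int[leb R]_x (sqnormc (g x))%:E +
   \int[leb2 R]_x (sqnormc (g x.1 - g x.2) / (x.1 - x.2) ^+ 2)%:E)%E.

Definition H12norm (R : realType) (g : R -> R[i]) : \bar R := sqrte (H12sq g).

Definition in_H12 (R : realType) (g : R -> R[i]) : Prop :=
  @cmeasurable _ (measurableTypeR R) R setT g /\ (H12norm g < +oo)%E.

(* The completion of D_(k)([0,1] x R; C) in the H^1_(k) norm is realized
   concretely.  That norm makes phi |-> (phi, dz phi, D_k phi, D_{-k} phi) an
   isometry into (L^2_1)^4 (suitably weighted), which is complete, so the
   completion is the closure of its image.  An element is thus represented by
   a function u together with the L^2 limits that serve as dz u, D_k u and
   D_{-k} u; representatives at H^1_(k) distance 0 are identified. *)
Record jet (R : realType) := Jet {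
  jfun :> R * R -> R[i];
  jz : R * R -> R[i];
  jp : R * R -> R[i];
  jm : R * R -> R[i] }.

Definition jet_of (R : realType) (k : nat) (phi : R * R -> R[i]) : jet R :=
  Jet phi (dz phi) (calD k%:Z phi) (calD (- k%:Z) phi).

Definition jetB (R : realType) (u v : jet R) : jet R :=
  Jet (jfun u \- jfun v) (jz u \- jz v) (jp u \- jp v) (jm u \- jm v).

Definition H1norm (R : realType) (u : jet R) : \bar R :=
  sqrte (L2sq u + L2sq (jz u) + (2^-1)%:E * L2sq (jp u)
         + (2^-1)%:E * L2sq (jm u))%E.

Definition H1cvg (R : realType) (k : nat) (phi : nat -> R * R -> R[i])
    (u : jet R) : Prop :=
  (fun n => H1norm (jetB (jet_of k (phi n)) u)) @ \oo --> 0%E.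

Definition in_H1 (R : realType) (k : nat) (u : jet R) : Prop :=
  [/\ in_L2 u, in_L2 (jz u), in_L2 (jp u), in_L2 (jm u) &
      exists2 phi : nat -> R * R -> R[i],
        (forall n, test k (phi n)) & H1cvg k phi u].

Definition in_H10 (R : realType) (k : nat) (u : jet R) : Prop :=
  in_H1 k u /\
  exists2 phi : nat -> R * R -> R[i],
    (forall n, test0 k (phi n)) & H1cvg k phi u.

(* The graph of the trace map u |-> u|_{r=1}: the continuous extension of the
   restriction map phi |-> phi(1, .), defined on the dense set of test
   functions, has as its graph the closure of the graph of that map. *)
Definition trace (R : realType) (k : nat) (u : jet R) (g : R -> R[i]) : Prop :=
  exists phi : nat -> R * R -> R[i],
    [/\ forall n, test k (phi n), H1cvg k phi u &
        (fun n => H12norm ((fun z => phi n (1, z)) \- g)) @ \oo --> 0%E].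

Definition weak_solution (R : realType) (k : nat) (f : R * R -> R[i])
    (g : R -> R[i]) (u : jet R) : Prop :=
  [/\ in_H1 k u, trace k u g &
      forall phi : jet R, in_H10 k phi ->
        (2^-1)%:C * L2ip (jp u) (jp phi) + (2^-1)%:C * L2ip (jm u) (jm phi)
        + L2ip (jz u) (jz phi) + L2ip f phi = 0].

(* Main.v *)
(* The operators have real coefficients, so a weak solution with complex data amounts
   to weak solutions with the real and the imaginary parts of the data.

   For a real test function vanishing at r = 1, integrating d/dr (r^2 f^2) gives the
   Poincare inequality |f|^2 <= |D_k f|^2 / 2 + |D_{-k} f|^2 / 2 in L^2_1, so the energy
   form is coercive on H^1_(k)0.  Boundary data are lifted without Fourier analysis: near
   r = 1 the lift of g at (r, z) is the mean of g over the interval between z and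
   z + r - 1.  Its derivatives are combinations of the difference quotient of g, whose
   L^2 norm is at most the Gagliardo seminorm, and of a remainder which is controlled by
   that quotient through a Hardy inequality.  Compactly supported smooth functions are
   dense in H^(1/2), so every g has a lift in H^1_(k).

   A solution is the lift plus the minimizer of the energy over H^1_(k)0.  Testing the
   equation with an approximating test function minus the lift of its trace bounds the
   H^1_(k) norm of any weak solution by those of f and g; applied to differences of
   solutions, this bound gives uniqueness and continuous dependence. *)
Require Import Defs.
From mathcomp Require Import all_boot all_order all_algebra.
From mathcomp Require Import all_classical all_reals all_analysis.
From mathcomp Require Import measurable_realfun ring lra.

Set Implicit Arguments.
Unset Strict Implicit.
Unset Printing Implicit Defensive.
Import Order.TTheory GRing.Theory Num.Theory.
Import numFieldNormedType.Exports.

Local Open Scope classical_set_scope.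
Local Open Scope ring_scope.

(** * Near-minimizers of convex functionals *)

(** What joins the lift to $H^1_{(k)0}$ is that a test function vanishing at r = 1 belongs to that
    closure, although its support may reach r = 1 ([trace0_H10R]). Subtracting the lift of the trace
    therefore always yields an admissible test jet, and the kernel of the trace map never has to be
    described. Near the axis the conditions defining $C^\infty_{(k)}$ are rigid, away from it they
    amount to smoothness. So every cutoff is constant near r = 0, and every lift vanishes there. The
    1/r terms are otherwise controlled through $D_k + D_{-k} = 2\,d/dr$, in which they cancel.
    Limits are produced by completeness of weighted $L^2$, applied to near-minimizers that the
    parallelogram identity makes Cauchy. The same abstract lemma gives the energy minimizer and the
    density in $H^{1/2}$, where mollifications are only known to stay bounded in norm and to
    converge almost everywhere. Hence its sets may shrink with the index. *)

Section nearmin.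
Context {R : realType}.

(** The infima of [J] over the shrinking sets [C n] increase to a finite limit [s]. Late
    near-minimizers have values at most [s + e / 4], while their midpoint still lies in an earlier
    set and has value at least [s - e / 4]; this bounds the gap by [e]. For quadratic [J] the gap is
    a multiple of the squared distance, so [v] is then Cauchy. *)
Lemma near_minimizers (V : Type) (mid : V -> V -> V) (C : nat -> V -> Prop)
    (J : V -> R) (m M : R) :
  (forall n v, C n v -> m <= J v) ->
  (forall n, exists2 v, C n v & J v <= M) ->
  (forall i j v, (i <= j)%N -> C j v -> C i v) ->
  (forall n u v, C n u -> C n v -> C n (mid u v)) ->
  exists v : nat -> V,
    [/\ forall n, C n (v n),
        forall e : R, 0 < e -> exists N, forall n x, (N <= n)%N -> C n x ->
          J (v n) <= J x + e &
        forall e : R, 0 < e -> exists N, forall i j, (N <= i)%N -> (N <= j)%N ->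
          J (v i) + J (v j) - 2 * J (mid (v i) (v j)) <= e].
Proof.
move=> lbJ neC decC midC.
pose S n := [set J v | v in C n].
have SI n : has_inf (S n).
  split; first by have [v Cv _] := neC n; exists (J v), v.
  by exists m => _ [v Cv <-]; exact: lbJ Cv.
pose d n := inf (S n).
have d_le n x : C n x -> d n <= J x.
  by move=> Cx; apply: ge_inf; [exact: (SI n).2|exists x].
have d_ub n : d n <= M.
  by have [v Cv JM] := neC n; exact: le_trans (d_le _ _ Cv) JM.
have d_nd i j : (i <= j)%N -> d i <= d j.
  move=> ij; apply: lb_le_inf; first exact: (SI j).1.
  by move=> _ [v Cv <-]; apply: d_le; exact: decC ij Cv.
have exv n : exists v, C n v /\ J v <= d n + n.+1%:R^-1.
  have e0 : 0 < n.+1%:R^-1 :> R by rewrite invr_gt0.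
  have [_ [v Cv <-] /ltW Jv] := inf_adherent e0 (SI n).
  by exists v; split.
have [v /all_and2[Cv Jv]] := choice exv.
have e_small (e : R) : 0 < e -> exists N, forall n, (N <= n)%N -> n.+1%:R^-1 <= e :> R.
  move=> e0; exists (Num.truncn e^-1) => n Nn.
  rewrite -[leRHS]invrK lef_pV2 ?posrE ?invr_gt0//.
  apply/ltW/(lt_le_trans (truncnS_gt _)).
  by rewrite ler_nat ltnS.
exists v; split=> //.
  move=> e /e_small[N HN]; exists N => n x Nn Cx.
  by apply: (le_trans (Jv n)); rewrite lerD ?d_le ?HN.
move=> e e0.
have e40 : 0 < e / 4 by rewrite divr_gt0.
have [N1 HN1] := e_small _ e40.
have supd : has_sup (range d).
  by split; [exists (d 0%N), 0%N|exists M => _ [n _ <-]].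
have [_ [N2 _ <-] dN2] := sup_adherent e40 supd.
exists (maxn N1 N2) => i j; rewrite !geq_max => /andP[i1 i2] /andP[j1 j2].
have dsup n : d n <= sup (range d) by apply: ub_le_sup; [exact: supd.2|exists n].
have Cm n : (n <= i)%N -> (n <= j)%N -> d n <= J (mid (v i) (v j)).
  by move=> ni nj; apply/d_le/midC; [exact: decC ni _|exact: decC nj _].
have := Cm _ i2 j2; have Jle n : (N1 <= n)%N -> J (v n) <= sup (range d) + e / 4.
  by move=> N1n; apply: le_trans (Jv n) _; rewrite lerD// HN1.
have Ji := Jle _ i1; have Jj := Jle _ j1.
move: (sup _) dN2 Ji Jj => s ds ? ? ?; lra.
Qed.

End nearmin.

(** * Integration over the strip and weighted square-integrable functions *)

Section measure_tools.
Context {R : realType}.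
Local Notation MR := (measurableTypeR R).
Local Notation mu := (@lebesgue_measure R).

(** The product sigma-algebra is generated by rectangles, and an open set is the countable union of
    the squares with rational centre and radius that it contains. *)
Lemma open_measurable2 (U : set (R * R)) : open U ->
  measurable (U : set (MR * MR)).
Proof.
move=> oU.
pose B (q : rat * rat * rat) : set (MR * MR) :=
  (ball (ratr q.1.1 : R) (ratr q.2 : R) : set R) `*`
  (ball (ratr q.1.2 : R) (ratr q.2 : R) : set R).
rewrite (_ : U = \bigcup_(q in [set q | B q `<=` U]) B q); last first.
  apply/seteqP; split=> [[x y] Uxy|[x y] [q /= qU /qU//]].
  have [e /= e0 eU] : exists2 e : R, 0 < e & ball (x, y) e `<=` U.
    by move/nbhs_ballP : (oU _ Uxy) => [e e0 ?]; exists e.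
  have e20 : 0 < e / 2 by rewrite divr_gt0.
  have [c _ /andP[c0 ce]] : exists2 c : rat, True & 0 < (ratr c : R) < e / 2.
    have [c] := rat_in_itvoo e20; rewrite in_itv/= => cc; by exists c.
  have ratn (t : R) : exists q, `|t - ratr q| < ratr c.
    have : t - ratr c < t + ratr c by lra.
    move=> /rat_in_itvoo[q]; rewrite in_itv/= => /andP[q1 q2].
    by exists q; rewrite ltr_norml; lra.
  have [a ta] := ratn x; have [b tb] := ratn y.
  exists (a, b, c) => /=.
    move=> [s t] [] /=; rewrite /B /ball/= => sa tb'; apply: eU; split => /=; rewrite /ball/=.
      rewrite (_ : x - s = (x - ratr a) + (ratr a - s)); last by ring.
      apply: le_lt_trans (ler_normD _ _) _; lra.
    rewrite (_ : y - t = (y - ratr b) + (ratr b - t)); last by ring.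
    apply: le_lt_trans (ler_normD _ _) _; lra.
  by split; rewrite /= /ball/= distrC.
rewrite bigcup_mkcond; apply: countable_bigcupT_measurable; first exact: countableP.
move=> q; case: ifPn => // _.
by apply: measurableX; exact: measurable_ball.
Qed.

Lemma open_continuous_measurable_fun2 (U : set (R * R)) (f : R * R -> R) :
  open U -> {in U, continuous f} -> measurable_fun (U : set (MR * MR)) f.
Proof.
move=> oU cf mU; apply: (measurability _ (RGenOpens.measurableE R)) => //.
move=> _ [_ [a [b ->] <-]].
apply: open_measurable2; rewrite openE => x [Ux fx]; apply: filterI.
  exact: open_nbhs_nbhs.
by apply: (cf x (mem_set Ux)); apply: open_nbhs_nbhs; split => //; exact: interval_open.
Qed.

(** The image of Lebesgue measure under a translation gives every half-open interval its length, so
    it is Lebesgue measure by uniqueness. *)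
Lemma lebesgue_shift (a : R) (f : R -> \bar R) :
  measurable_fun setT (f : MR -> \bar R) -> (forall x, (0 <= f x)%E) ->
  (\int[mu]_x f (x + a)%R = \int[mu]_x f x)%E.
Proof.
move=> mf f0; pose phi : MR -> MR := fun x => x + a.
have mphi : measurable_fun setT phi by exact: measurable_funD.
rewrite -[LHS](ge0_integral_pushforward mphi mu (D := setT) (f := f))//.
apply: eq_measure_integral => A mA _.
apply/esym/lebesgue_measure_unique => // _ [[b c] _ <-].
rewrite /= /pushforward (_ : phi @^-1` _ = `](b - a), (c - a)]%classic); last first.
  by apply/seteqP; split=> x /=; rewrite !in_itv/= /phi ltrBlDr lerBrDr.
by rewrite !lebesgue_measure_itv/= !lte_fin ltrD2r -!EFinB opprB addrA subrK.
Qed.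

Lemma open_strip : open (strip R).
Proof.
rewrite (_ : strip R = fst @^-1` `]0, 1[%classic).
  by apply: open_comp => // x _; exact: cvg_fst.
by apply/seteqP; split=> x; rewrite /strip/= in_itv.
Qed.

Lemma measurable_strip : measurable (strip R : set (MR * MR)).
Proof. by apply: open_measurable2; exact: open_strip. Qed.

Lemma strip_restrictE (f : R * R -> \bar R) r z :
  (f \_ (strip R)) (r, z) = ((fun r => f (r, z)) \_ `]0, 1[) r.
Proof.
rewrite !patchE; suff -> : ((r, z) \in strip R) = (r \in `]0, 1[%classic) by [].
by apply/idP/idP => /set_mem h; apply/mem_set; move: h; rewrite /strip/= in_itv.
Qed.

Lemma fubini_G_strip (f : R * R -> \bar R) :
  fubini_G mu (f \_ (strip R)) =
  (fun z => \int[mu]_(r in `]0%R, 1%R[) f (r, z))%E.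
Proof.
apply/funext => z; rewrite /fubini_G [RHS]integral_mkcond.
by apply: eq_integral => r _; exact: strip_restrictE.
Qed.

Lemma measurable_strip_restrict (f : R * R -> \bar R) :
  measurable_fun (strip R : set (MR * MR)) f ->
  measurable_fun [set: MR * MR] (f \_ (strip R)).
Proof.
by move=> mf; apply/(measurable_restrictT _ _).1 => //; exact: measurable_strip.
Qed.

Lemma integral_strip (f : R * R -> \bar R) :
  measurable_fun (strip R : set (MR * MR)) f ->
  (forall x, strip R x -> (0 <= f x)%E) ->
  (\int[leb2 R]_(x in strip R) f x =
   \int[mu]_z \int[mu]_(r in `]0%R, 1%R[) f (r, z))%E.
Proof.
move=> mf f0; rewrite integral_mkcond -fubini_G_strip.
apply: fubini_tonelli2; first exact: measurable_strip_restrict.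
by move=> x; exact: erestrict_ge0.
Qed.

(** Tonelli with z as the outer variable. It serves the Poincare and Hardy inequalities, which hold
    on each slice only after integration in r. *)
Lemma le_integral_strip (f g : R * R -> \bar R) :
  measurable_fun (strip R : set (MR * MR)) f ->
  measurable_fun (strip R : set (MR * MR)) g ->
  (forall x, strip R x -> (0 <= f x)%E) ->
  (forall x, strip R x -> (0 <= g x)%E) ->
  (forall z, \int[mu]_(r in `]0%R, 1%R[) f (r, z) <=
     \int[mu]_(r in `]0%R, 1%R[) g (r, z))%E ->
  (\int[leb2 R]_(x in strip R) f x <= \int[leb2 R]_(x in strip R) g x)%E.
Proof.
move=> mf mg f0 g0 fg; rewrite !integral_strip//.
have m h : measurable_fun (strip R : set (MR * MR)) h ->
    (forall x, strip R x -> (0 <= h x)%E) ->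
    measurable_fun setT (fun z : MR => \int[mu]_(r in `]0%R, 1%R[) h (r, z))%E.
  move=> mh h0; rewrite -fubini_G_strip.
  apply: measurable_fun_fubini_tonelli_G; first exact: measurable_strip_restrict.
  by move=> x; exact: erestrict_ge0.
have i0 h z : (forall x, strip R x -> (0 <= h x)%E) ->
    (0 <= \int[mu]_(r in `]0%R, 1%R[) h (r, z))%E.
  by move=> h0; apply: integral_ge0 => r /=; rewrite in_itv/= => r01; exact: h0.
by apply: ge0_le_integral => //; [move=> z _; exact: i0|exact: m|exact: m].
Qed.

End measure_tools.

Lemma fatou_le d (T : measurableType d) (R : realType) (mu : {measure set T -> \bar R})
    (D : set T) (F_ : nat -> T -> R) (F : T -> R) (M : \bar R) : measurable D ->
  (forall n, measurable_fun D (F_ n)) -> (forall n x, D x -> 0 <= F_ n x) ->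
  (forall x, D x -> F_ n x @[n --> \oo] --> F x) ->
  (\forall n \near \oo, \int[mu]_(x in D) (F_ n x)%:E <= M)%E ->
  (\int[mu]_(x in D) (F x)%:E <= M)%E.
Proof.
move=> mD mF F0 cF FM.
have := @fatou _ _ _ mu D mD (fun n x => (F_ n x)%:E).
have mm n : measurable_fun D (fun x => (F_ n x)%:E) by apply/measurable_EFinP.
have pp n x : D x -> (0 <= (F_ n x)%:E)%E by move=> Dx; rewrite lee_fin F0.
move=> /(_ mm pp).
rewrite (eq_integral (fun x => (F x)%:E)); last first.
  move=> x /set_mem Dx; apply: (cvg_limn_einf_sup _).1.
  by apply: cvg_EFin; [exact: nearW|exact: cF].
move=> /le_trans; apply; rewrite limn_einf_lim.
apply: lime_le; first exact: is_cvg_einfs.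
near=> n; apply: (@le_trans _ _ (\int[mu]_(x in D) (F_ n x)%:E)%E); last by near: n.
by apply: ereal_inf_lbound; exists n => //=.
Unshelve. all: by end_near. Qed.

Section weighted_L2.
Context d (T : measurableType d) (R : realType) (mu : {measure set T -> \bar R}).
Variables (D : set T) (mD : measurable D) (w : T -> R).
Implicit Types f g h : T -> R.
Hypotheses (mw : measurable_fun D w) (w_gt0 : forall x, D x -> 0 < w x).

Definition wL2 (f : T -> R) :=
  measurable_fun D f /\ (\int[mu]_(x in D) (f x ^+ 2 * w x)%:E < +oo)%E.

Definition wip (f g : T -> R) : R := \int[mu]_(x in D) (f x * g x * w x).

Definition wsq (f : T -> R) : R := wip f f.

Lemma wL2_measurable_sqr f : measurable_fun D f ->
  measurable_fun D (fun x => (f x ^+ 2 * w x)%:E).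
Proof.
by move=> mf; apply/measurable_EFinP/measurable_funM => //; exact: measurable_funX.
Qed.

Lemma wL2_integrable_sqr f : wL2 f ->
  mu.-integrable D (fun x => (f x ^+ 2 * w x)%:E).
Proof.
move=> [mf foo]; apply/integrableP; split; first exact: wL2_measurable_sqr.
rewrite (eq_integral (fun x => (f x ^+ 2 * w x)%:E))// => x /set_mem Dx.
by rewrite gee0_abs// lee_fin mulr_ge0 ?sqr_ge0// ltW// w_gt0.
Qed.

Lemma wL2_integrable f g : wL2 f -> wL2 g ->
  mu.-integrable D (EFin \o (fun x => f x * g x * w x)).
Proof.
move=> Lf Lg; have [mf _] := Lf; have [mg _] := Lg.
apply: (@le_integrable _ _ _ mu D mD _
   (fun x => (f x ^+ 2 * w x)%:E + (g x ^+ 2 * w x)%:E)%E).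
- by apply/measurable_EFinP/measurable_funM => //; exact: measurable_funM.
- move=> x Dx; rewrite /= lee_fin.
  have wx := w_gt0 Dx.
  rewrite -mulrDl [leRHS]ger0_norm; last first.
    by rewrite mulr_ge0 ?addr_ge0 ?sqr_ge0// ltW.
  rewrite !normrM (gtr0_norm wx) ler_pM2r//.
  rewrite -[f x ^+ 2]real_normK ?num_real// -[g x ^+ 2]real_normK ?num_real//.
  by have := sqr_ge0 (`|f x| - `|g x|); have := normr_ge0 (f x); have := normr_ge0 (g x); nra.
- by apply: integrableD => //; exact: wL2_integrable_sqr.
Qed.

Lemma wL2_integrable_lt (f : T -> R) : measurable_fun D f ->
  mu.-integrable D (fun x => (f x ^+ 2 * w x)%:E) -> wL2 f.
Proof.
move=> mf /integrableP[_ foo]; split => //; apply: le_lt_trans foo.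
apply: ge0_le_integral => //.
- by move=> x Dx; rewrite lee_fin mulr_ge0 ?sqr_ge0// ltW// w_gt0.
- exact: wL2_measurable_sqr.
- by apply: measurableT_comp => //; exact: wL2_measurable_sqr.
- by move=> x Dx; exact: lee_abs.
Qed.

Lemma wL2_le f g : measurable_fun D f -> (forall x, D x -> `|f x| <= `|g x|) ->
  wL2 g -> wL2 f.
Proof.
move=> mf fg [mg goo]; split => //; apply: le_lt_trans goo.
apply: ge0_le_integral => //.
- by move=> x Dx; rewrite lee_fin mulr_ge0 ?sqr_ge0// ltW// w_gt0.
- exact: wL2_measurable_sqr.
- exact: wL2_measurable_sqr.
- move=> x Dx; rewrite lee_fin ler_pM2r ?w_gt0//.
  rewrite -[f x ^+ 2]real_normK ?num_real// -[g x ^+ 2]real_normK ?num_real//.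
  by rewrite ler_sqr ?nnegrE ?fg.
Qed.

Lemma wL2Z a f : wL2 f -> wL2 (fun x => a * f x).
Proof.
move=> Lf; have [mf _] := Lf; apply: wL2_integrable_lt.
  by apply: measurable_funM.
apply: eq_integrable (integrableZl mD (a ^+ 2) (wL2_integrable_sqr Lf)) => // x _.
by rewrite -EFinM exprMn mulrA.
Qed.

Lemma wL2D f g : wL2 f -> wL2 g -> wL2 (fun x => f x + g x).
Proof.
move=> Lf Lg; have [mf _] := Lf; have [mg _] := Lg.
apply: wL2_integrable_lt; first exact: measurable_funD.
have If := wL2_integrable_sqr Lf; have Ig := wL2_integrable_sqr Lg.
have Ifg := integrableZl mD 2 (wL2_integrable Lf Lg).
apply: eq_integrable (integrableD mD (integrableD mD If Ig) Ifg) => // x _.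
by rewrite /= -EFinM -!EFinD; congr EFin; ring.
Qed.

Lemma wL2B f g : wL2 f -> wL2 g -> wL2 (fun x => f x - g x).
Proof.
move=> Lf Lg; have := wL2D Lf (wL2Z (-1) Lg).
by under eq_fun do rewrite mulN1r.
Qed.

Lemma eq_wL2 f g : (forall x, D x -> f x = g x) -> wL2 f -> wL2 g.
Proof.
move=> fg [mf foo]; split.
  by apply: eq_measurable_fun mf => x /set_mem/fg.
by rewrite (eq_integral (fun x => (f x ^+ 2 * w x)%:E))// => x /set_mem/fg ->.
Qed.

Lemma wL2_0 : wL2 (fun=> 0).
Proof.
split; first exact: measurable_cst.
rewrite integral0_eq ?ltry// => x _.
by rewrite expr0n/= mul0r.
Qed.

Lemma eq_wip f f' g g' : (forall x, D x -> f x = f' x) ->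
  (forall x, D x -> g x = g' x) -> wip f g = wip f' g'.
Proof.
by move=> ff gg; apply: eq_Rintegral => x /set_mem Dx; rewrite ff// gg.
Qed.

Lemma wipC f g : wip f g = wip g f.
Proof. by apply: eq_Rintegral => x _; rewrite (mulrC (f x)). Qed.

Lemma wipDl f g h : wL2 f -> wL2 g -> wL2 h ->
  wip (fun x => f x + g x) h = wip f h + wip g h.
Proof.
move=> Lf Lg Lh; rewrite /wip -RintegralD//; try exact: wL2_integrable.
by apply: eq_Rintegral => x _; rewrite !mulrDl.
Qed.

Lemma wipZl a f h : wL2 f -> wL2 h -> wip (fun x => a * f x) h = a * wip f h.
Proof.
move=> Lf Lh; rewrite /wip -RintegralZl//; try exact: wL2_integrable.
by apply: eq_Rintegral => x _; rewrite !mulrA.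
Qed.

Lemma wipBl f g h : wL2 f -> wL2 g -> wL2 h ->
  wip (fun x => f x - g x) h = wip f h - wip g h.
Proof.
move=> Lf Lg Lh; rewrite -(mulN1r (wip g h)) -wipZl// -wipDl//; last exact: wL2Z.
by apply: eq_wip => // x _; rewrite mulN1r.
Qed.

Lemma wipDr f g h : wL2 f -> wL2 g -> wL2 h ->
  wip h (fun x => f x + g x) = wip h f + wip h g.
Proof. by move=> *; rewrite !(wipC h) wipDl. Qed.

Lemma wipZr a f h : wL2 f -> wL2 h -> wip h (fun x => a * f x) = a * wip h f.
Proof. by move=> *; rewrite !(wipC h) wipZl. Qed.

Lemma wipBr f g h : wL2 f -> wL2 g -> wL2 h ->
  wip h (fun x => f x - g x) = wip h f - wip h g.
Proof. by move=> *; rewrite !(wipC h) wipBl. Qed.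

Lemma wsq_ge0 f : 0 <= wsq f.
Proof.
by apply: Rintegral_ge0 => x Dx; rewrite -expr2 mulr_ge0 ?sqr_ge0// ltW// w_gt0.
Qed.

Lemma wsqZ a f : wL2 f -> wsq (fun x => a * f x) = a ^+ 2 * wsq f.
Proof. by move=> Lf; rewrite /wsq wipZl ?wipZr ?mulrA//; exact: wL2Z. Qed.

Lemma wsqD f g : wL2 f -> wL2 g ->
  wsq (fun x => f x + g x) = wsq f + wsq g + 2 * wip f g.
Proof.
move=> Lf Lg; rewrite /wsq wipDl//; last exact: wL2D.
by rewrite !wipDr// (wipC g f); ring.
Qed.

Lemma wsqB f g : wL2 f -> wL2 g ->
  wsq (fun x => f x - g x) = wsq f + wsq g - 2 * wip f g.
Proof.
move=> Lf Lg; rewrite /wsq wipBl//; last exact: wL2B.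
by rewrite !wipBr// (wipC g f); ring.
Qed.

Lemma wsqE f : wL2 f ->
  (wsq f)%:E = (\int[mu]_(x in D) (f x ^+ 2 * w x)%:E)%E.
Proof.
move=> Lf; rewrite /wsq /wip /Rintegral fineK; last first.
  by apply: integrable_fin_num => //; exact: wL2_integrable.
by apply: eq_integral => x _; rewrite expr2.
Qed.

(** Expand [wsq] of [t f + g] and of [t f - g], both nonnegative, and divide by [t]. With its free
    parameter this takes the place of the Cauchy-Schwarz inequality and avoids square roots. *)
Lemma wip_young (t : R) f g : 0 < t -> wL2 f -> wL2 g ->
  `|2 * wip f g| <= t * wsq f + t^-1 * wsq g.
Proof.
move=> t0 Lf Lg.
have t1 : t^-1 * t = 1 by rewrite mulVf// gt_eqF.
have L1 := wL2Z t Lf.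
have h2 := wsq_ge0 (fun x => t * f x + g x).
have h1 := wsq_ge0 (fun x => t * f x - g x).
rewrite wsqB// wsqZ// wipZl// in h1; rewrite wsqD// wsqZ// wipZl// in h2.
have ti : 0 < t^-1 by rewrite invr_gt0.
move: h1 h2; rewrite -(pmulr_rge0 _ ti) => h1; rewrite -(pmulr_rge0 _ ti) => h2.
have e1 : t^-1 * (t ^+ 2 * wsq f + wsq g - 2 * (t * wip f g)) =
   t * wsq f + t^-1 * wsq g - 2 * wip f g.
  transitivity ((t^-1 * t) * t * wsq f + t^-1 * wsq g - 2 * ((t^-1 * t) * wip f g)).
    by ring.
  by rewrite t1; ring.
have e2 : t^-1 * (t ^+ 2 * wsq f + wsq g + 2 * (t * wip f g)) =
   t * wsq f + t^-1 * wsq g + 2 * wip f g.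
  transitivity ((t^-1 * t) * t * wsq f + t^-1 * wsq g + 2 * ((t^-1 * t) * wip f g)).
    by ring.
  by rewrite t1; ring.
move: h1 h2; rewrite e1 e2 => h1 h2.
rewrite ler_norml; lra.
Qed.

Lemma wsq_fatou (f_ : nat -> T -> R) f M : measurable_fun D f ->
  (forall n, wL2 (f_ n)) ->
  (forall x, D x -> f_ n x @[n --> \oo] --> f x) ->
  (\forall n \near \oo, wsq (f_ n) <= M) ->
  wL2 f /\ wsq f <= M.
Proof.
move=> mf Lf_ cf fM.
suff h : (\int[mu]_(x in D) (f x ^+ 2 * w x)%:E <= M%:E)%E.
  have Lf : wL2 f by split => //; exact: le_lt_trans h (ltry _).
  by split => //; rewrite -lee_fin wsqE.
apply: (fatou_le (F_ := fun n x => f_ n x ^+ 2 * w x)) => //.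
- by move=> n; apply: measurable_funM => //; apply: measurable_funX; exact: (Lf_ n).1.
- by move=> n x Dx; rewrite mulr_ge0 ?sqr_ge0// ltW// w_gt0.
- by move=> x Dx; apply: cvgMl; apply: cvgM; exact: cf.
- by apply: filterS fM => n; rewrite -lee_fin wsqE.
Qed.

(* The increments of a rapidly converging subsequence, weighted by [4 ^ n], have
   a finite sum almost everywhere; hence they are bounded by a geometric sequence
   and the subsequence converges almost everywhere. *)
Lemma wL2_complete (f_ : nat -> T -> R) : (forall n, wL2 (f_ n)) ->
  (forall e : R, 0 < e -> exists N, forall i j, (N <= i)%N -> (N <= j)%N ->
     wsq (fun x => f_ i x - f_ j x) <= e) ->
  exists2 f, wL2 f & forall e : R, 0 < e -> exists N, forall n, (N <= n)%N ->
     wsq (fun x => f_ n x - f x) <= e.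
Proof.
move=> Lf_ Cf_.
have e0 n : 0 < (16 ^+ n)^-1 :> R by rewrite invr_gt0 exprn_gt0.
have [N_ N_P] := choice (fun n => Cf_ _ (e0 n)).
(* The sum makes [M_] nondecreasing and at least each [N_ n]; the summand [n] makes it tend to
   infinity. *)
pose M_ n := (n + \sum_(i < n.+1) N_ i)%N.
have N_M n : (N_ n <= M_ n)%N by rewrite /M_ big_ord_recr/= addnA leq_addl.
have M_nd n : (M_ n <= M_ n.+1)%N by rewrite /M_ [in leqRHS]big_ord_recr/= leq_add// leq_addr.
pose g n := f_ (M_ n).
have Lg n : wL2 (g n) by exact: Lf_.
have dg n : wsq (fun x => g n.+1 x - g n x) <= (16 ^+ n)^-1.
  by apply: N_P; rewrite ?N_M// (leq_trans _ (M_nd n)).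
pose S x := (\sum_(0 <= n <oo) (4 ^+ n * ((g n.+1 x - g n x) ^+ 2 * w x))%:E)%E.
have Ldg n : wL2 (fun x => g n.+1 x - g n x) by exact: wL2B.
have mt n : measurable_fun D
    (fun x => (4 ^+ n * ((g n.+1 x - g n x) ^+ 2 * w x))%:E).
  apply/measurable_EFinP/measurable_funM => //; apply/measurable_EFinP.
  exact: wL2_measurable_sqr (Ldg n).1.
have t0 n x : D x -> (0 <= (4 ^+ n * ((g n.+1 x - g n x) ^+ 2 * w x))%:E)%E.
  by move=> Dx; rewrite lee_fin mulr_ge0 ?exprn_ge0// mulr_ge0 ?sqr_ge0// ltW// w_gt0.
have mS : measurable_fun D S by exact: (ge0_emeasurable_sum (P := xpredT) (fun k x Dx _ => t0 k x Dx) (fun k _ => mt k)).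
have S0 x : D x -> (0 <= S x)%E by move=> Dx; apply: nneseries_ge0 => n _ _; exact: t0.
have iS : mu.-integrable D S.
  apply/integrableP; split => //.
  rewrite (eq_integral S) => [|x /set_mem Dx]; last by rewrite gee0_abs// S0.
  rewrite /S integral_nneseries//.
  apply: (@le_lt_trans _ _ (\sum_(0 <= n <oo) ((4 ^+ n)^-1)%:E)%E).
    apply: lee_nneseries => [n _ _|n _]; first by apply: integral_ge0 => x; exact: t0.
    under eq_integral do rewrite EFinM.
    rewrite ge0_integralZl//; last 2 first.
    - by apply/wL2_measurable_sqr; exact: (Ldg n).1.
    - by move=> x Dx; rewrite lee_fin mulr_ge0 ?sqr_ge0// ltW// w_gt0.
    rewrite -wsqE// -EFinM lee_fin.
    apply: (@le_trans _ _ (4 ^+ n * (16 ^+ n)^-1)); first by rewrite ler_pM2l ?exprn_gt0.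
    rewrite (_ : 16 = 4 * 4 :> R) ?exprMn ?invfM; last by ring.
    by rewrite mulrA mulfV ?mul1r// expf_neq0.
  (* The increments are at most [16 ^- n] in squared norm, so the weight [4 ^ n] leaves [4 ^- n].
     This is at most [2 ^- n], written here in the shape of a geometric series with a known
     bound. *)
  apply: (@le_lt_trans _ _ (\sum_(0 <= n <oo) (2 / (2 ^ n.+1)%:R)%:E)%E).
    apply: lee_nneseries => [n _ _|n _]; first by rewrite lee_fin invr_ge0 exprn_ge0.
    rewrite lee_fin natrX exprS invfM mulrA divff// mul1r.
    by rewrite lef_pV2 ?posrE ?exprn_gt0// lerXn2r ?nnegrE//; lra.
  by apply: le_lt_trans (epsilon_trick0 _ _) (ltry _); rewrite ler0n.
have [Z [mZ Z0 DZ]] := integrable_ae mD iS.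
pose A := D `&` [set x | S x \is a fin_num].
have mA : measurable A by exact: emeasurable_fin_num.
(* Cutting off where the series [S] is infinite makes the subsequence converge at every point of
   [D], so that its limit is measurable. The norms do not change, because the removed set is
   null. *)
pose gA n x := g n x * \1_A x.
have cvgA x : D x -> cvgn (gA ^~ x).
  move=> Dx; have [Sfin|Sfin] := boolP (S x \is a fin_num); last first.
    rewrite (_ : gA ^~ x = cst 0); first exact: is_cvg_cst.
    by apply/funext => n; rewrite /gA indicE memNset ?mulr0// => -[_ /=]; exact/negP.
  have wx := w_gt0 Dx; pose C := fine (S x) / w x.
  have C0 : 0 <= C by rewrite divr_ge0 ?fine_ge0 ?S0// ltW.
  have dC n : `|g n.+1 x - g n x| <= geometric (Num.sqrt C) 2^-1 n.
    rewrite /= -ler_sqr ?nnegrE ?mulr_ge0 ?sqrtr_ge0 ?exprn_ge0//.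
    rewrite real_normK ?num_real// exprMn sqr_sqrtr// -exprM mulnC exprM.
    rewrite !exprVn (_ : 2 ^+ 2 = 4); last by rewrite expr2; lra.
    rewrite ler_pdivlMr ?exprn_gt0// mulrC.
    rewrite /C ler_pdivlMr// -mulrA -lee_fin fineK//.
    have := @nneseries_lim_ge R (fun n => (4 ^+ n * ((g n.+1 x - g n x) ^+ 2 * w x))%:E) xpredT 0 n.+1.
    move=> /(_ (fun n _ _ => t0 n x Dx)); apply: le_trans.
    by rewrite big_nat_recr//= leeDr// sume_ge0// => i _; exact: t0.
  have -> : gA ^~ x = cst (g 0%N x) + series (telescope (g ^~ x)).
    by apply/funext => n; rewrite [RHS](esym (eq_sum_telescope (g ^~ x) n)) /gA indicE mem_set ?mulr1.
  apply: is_cvgD; first exact: is_cvg_cst.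
  apply: normed_cvg; apply: (@series_le_cvg _ _ (geometric (Num.sqrt C) 2^-1)) => //.
  - by move=> n; exact: normr_ge0.
  - by move=> n; rewrite /= mulr_ge0 ?sqrtr_ge0 ?exprn_ge0.
  - by apply: is_cvg_geometric_series; rewrite ger0_norm; lra.
pose f x := limn (gA ^~ x).
have mgA n : measurable_fun D (gA n).
  by apply: measurable_funM; [exact: (Lg n).1|exact: measurable_indic].
have LgA n : wL2 (gA n).
  apply: wL2_le (Lg n) => // x _; rewrite /gA normrM indicE.
  by case: (_ \in _); rewrite ?normr1 ?normr0 ?mulr1 ?mulr0.
have Ef m n : wsq (fun x => f_ m x - gA n x) = wsq (fun x => f_ m x - g n x).
  have L1 := wL2B (Lf_ m) (LgA n); have L2 := wL2B (Lf_ m) (Lg n).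
  apply: EFin_inj; rewrite !wsqE//; apply: ae_eq_integral => //.
  - by apply: wL2_measurable_sqr; exact: L1.1.
  - by apply: wL2_measurable_sqr; exact: L2.1.
  - exists Z; split => // x /=; apply: contra_notP => nZ Dx.
    rewrite /gA indicE mem_set ?mulr1//; split => //=.
    by apply: contrapT => Sx; apply: nZ; apply: DZ => /= /(_ Dx).
have mf : measurable_fun D f.
  by apply: (measurable_fun_cvg mgA) => x Dx; exact: cvgA.
have Lf0 e : 0 < e -> exists N, forall n, (N <= n)%N ->
    wL2 (fun x => f_ n x - f x) /\ wsq (fun x => f_ n x - f x) <= e.
  move=> /Cf_ [N NP]; exists N => n Nn.
  apply: (@wsq_fatou (fun k x => f_ n x - gA k x)).
  - by apply: measurable_funB => //; exact: (Lf_ n).1.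
  - by move=> k; exact: wL2B.
  - by move=> x Dx; apply: cvgB; [exact: cvg_cst|exact: cvgA].
  - exists N => // k /= Nk; rewrite Ef; apply: NP => //.
    by rewrite (leq_trans Nk)// leq_addr.
exists f.
  have [N /(_ _ (leqnn _))[LN _]] := Lf0 1 ltr01.
  by apply: eq_wL2 (wL2B (Lf_ N) LN) => x _; rewrite opprB addrC subrK.
by move=> e /Lf0[N NP]; exists N => n /NP[].
Qed.

End weighted_L2.

(** * Smooth functions of one variable *)

Section smooth.
Context {R : realType}.
Implicit Types f g : R -> R.

Fixpoint nderivable (n : nat) f : Prop :=
  if n is n'.+1 then (forall x : R, derivable f x 1) /\ nderivable n' (derive1 f)
  else True.

Definition smooth f := forall n, nderivable n f.

Lemma is_derive_ext f g (x l l' : R) : is_derive x 1 f l ->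
  (forall y, f y = g y) -> l = l' -> is_derive x 1 g l'.
Proof. by move=> fl fg <-; have <- : f = g by exact/funext. Qed.

Lemma is_derive_const (c x : R) : is_derive x 1 (fun=> c) 0.
Proof. exact: is_derive_cst. Qed.

Lemma is_derive_near f g (x l : R) : is_derive x 1 f l ->
  (\forall y \near x, f y = g y) -> is_derive x 1 g l.
Proof. by move=> fl fg; exact: near_eq_is_derive fg fl. Qed.

(** The only criterion needed to differentiate [flat] at the origin and to differentiate under
    integral signs: a uniform quadratic remainder survives integration, so no dominated convergence
    is involved. *)
Lemma is_derive_quadratic f (x l C : R) :
  (forall h, `|h| < 1 -> `|f (h + x) - f x - h * l| <= C * h ^+ 2) ->
  is_derive x 1 f l.
Proof.
move=> fC.
have fl : h^-1 *: ((f \o shift x) (h *: 1) - f x) @[h --> 0^'] --> l.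
  apply/cvgrPdist_le => e e0; near=> h.
  have h0 : h != 0 by near: h; exact: nbhs_dnbhs_neq.
  have h1 : `|h| < Num.min 1 (e / (`|C| + 1)).
    near: h; apply: dnbhs0_lt; rewrite lt_min ltr01/=.
    by rewrite divr_gt0// ltr_pwDr.
  move: h1; rewrite lt_min => /andP[h1 h2].
  rewrite /= /GRing.scale/= mulr1 distrC.
  have -> : h^-1 * (f (h + x) - f x) - l = h^-1 * (f (h + x) - f x - h * l).
    by rewrite [RHS]mulrBr mulrA mulVf// mul1r.
  rewrite normrM normfV mulrC ler_pdivrMr ?normr_gt0//.
  apply: le_trans (fC _ h1) _.
  rewrite -[h ^+ 2]real_normK ?num_real// expr2 mulrA ler_pM2r ?normr_gt0//.
  apply: le_trans (_ : (`|C| + 1) * `|h| <= e).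
    by rewrite ler_wpM2r// (le_trans (ler_norm _))// lerDl.
  by rewrite mulrC -ler_pdivlMr ?ltW// ltr_pwDr.
apply: DeriveDef; first by apply/cvg_ex; exists l.
exact: cvg_lim.
Unshelve. all: by end_near. Qed.

Lemma is_derive_derive1 f (x l : R) : is_derive x 1 f l -> (derive1 f) x = l.
Proof. by move=> h; rewrite derive1E; exact: derive_val. Qed.

Lemma nderivableS_is_derive n f df : (forall x : R, is_derive x 1 f (df x)) ->
  nderivable n df -> nderivable n.+1 f.
Proof.
move=> fdf ndf; split=> [x|]; first by have [] := fdf x.
by rewrite (_ : (derive1 f) = df)//; apply/funext => x; apply: is_derive_derive1.
Qed.

Lemma derivable_is_derive1 f (x : R) : derivable f x 1 -> is_derive x 1 f ((derive1 f) x).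
Proof. by move=> df; apply: DeriveDef => //; rewrite derive1E. Qed.

Lemma nderivableW n f : nderivable n.+1 f -> nderivable n f.
Proof. by elim: n f => // n ih f [df /ih]. Qed.

Lemma nderivable_cst n c : nderivable n (fun=> c).
Proof.
elim: n c => // n ih c; by apply: (@nderivableS_is_derive _ _ (fun=> 0)) => // x; exact: is_derive_const.
Qed.

Lemma nderivableD n f g : nderivable n f -> nderivable n g ->
  nderivable n (fun x => f x + g x).
Proof.
elim: n f g => // n ih f g [df nf] [dg ng].
apply: nderivableS_is_derive (ih _ _ nf ng) => x.
by apply: is_deriveD; exact: derivable_is_derive1.
Qed.

Lemma nderivableM n f g : nderivable n f -> nderivable n g ->
  nderivable n (fun x => f x * g x).
Proof.
elim: n f g => // n ih f g nf ng; have [df nf'] := nf; have [dg ng'] := ng.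
apply: (@nderivableS_is_derive _ _ (fun x => f x * (derive1 g) x + g x * (derive1 f) x)).
  move=> x; have := is_deriveM (derivable_is_derive1 (df x)) (derivable_is_derive1 (dg x)).
  by [].
by apply: nderivableD; apply: ih => //; exact: nderivableW.
Qed.

Lemma nderivableV n f : (forall x, f x != 0) -> nderivable n f ->
  nderivable n (fun x => (f x)^-1).
Proof.
move=> f0; elim: n f f0 => // n ih f f0 nf; have [df nf'] := nf.
have dV (x : R) : is_derive x 1 (fun x => (f x)^-1)
    (- 1 * derive1 f x * ((f x)^-1 * (f x)^-1)).
  apply: (is_derive_ext (is_deriveV (f0 x) (derivable_is_derive1 (df x)))) => //.
  change (- f x ^- 2 * derive1 f x = -1 * derive1 f x * ((f x)^-1 / f x)).
  by rewrite expr2 invfM; ring.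
apply: (nderivableS_is_derive dV).
apply: nderivableM; first by apply: nderivableM => //; exact: nderivable_cst.
by apply: nderivableM; apply: ih => //; exact: nderivableW.
Qed.

Lemma is_derive_affine f (a b x l : R) : is_derive (a * x + b) 1 f l ->
  is_derive x 1 (fun y => f (a * y + b)) (a * l).
Proof.
move=> fl.
have h : is_derive x 1 (fun y : R => a * y + b) a.
  apply: (is_derive_ext (is_deriveD (is_deriveZ a (is_derive_id x 1)) (is_derive_const b x))) => //.
  by rewrite /GRing.scale/= mulr1 addr0.
apply: (is_derive_ext (@is_derive1_comp R f (fun y => a * y + b) x l a fl h)) => //.
by rewrite mulrC.
Qed.

Lemma nderivable_affine n f a b : nderivable n f ->
  nderivable n (fun x => f (a * x + b)).
Proof.
elim: n f => // n ih f [df nf].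
apply: (@nderivableS_is_derive _ _ (fun x => a * (derive1 f) (a * x + b))).
  by move=> x; apply: is_derive_affine; exact: derivable_is_derive1.
by apply: nderivableM; [exact: nderivable_cst|exact: ih].
Qed.

Lemma smooth_derive1 f : smooth f -> smooth (derive1 f).
Proof. by move=> sf n; have [] := sf n.+1. Qed.

Lemma smooth_derivable f (x : R) : smooth f -> derivable f x 1.
Proof. by move=> /(_ 1%N)[]. Qed.

Lemma smooth_is_derive f (x : R) : smooth f -> is_derive x 1 f ((derive1 f) x).
Proof. by move=> sf; apply: derivable_is_derive1; exact: smooth_derivable. Qed.

Lemma smooth_continuous f : smooth f -> continuous f.
Proof.
move=> sf x; apply: differentiable_continuous; apply/derivable1_diffP.
exact: smooth_derivable.
Qed.

(* The factor [x^-n] makes the family closed under differentiation. *)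
Definition flat (n : nat) (x : R) : R :=
  if 0 < x then x^-1 ^+ n * expR (- x^-1) else 0.

(** For positive [n], raise [t <= expR t] at [t = y / n] to the power [n]. *)
Lemma exprn_le_expR n (y : R) : 0 <= y -> y ^+ n <= n%:R ^+ n * expR y.
Proof.
case: n => [|n] y0.
  by rewrite !expr0 mul1r; apply: le_trans (expR_ge1Dx y); lra.
have -> : y = n.+1%:R * (y / n.+1%:R) by rewrite mulrC divfK.
rewrite expRM_natl exprMn ler_pM2l ?exprn_gt0//.
rewrite lerXn2r ?nnegrE ?divr_ge0 ?expR_ge0//.
by apply: le_trans (expR_ge1Dx _); rewrite lerDr.
Qed.

Lemma flat_ge0 n x : 0 <= flat n x.
Proof.
rewrite /flat; case: ifPn => // x0.
by rewrite mulr_ge0 ?expR_ge0// exprn_ge0// invr_ge0 ltW.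
Qed.

Lemma flat_gt0 n x : 0 < x -> 0 < flat n x.
Proof. by move=> x0; rewrite /flat x0 mulr_gt0 ?expR_gt0// exprn_gt0// invr_gt0. Qed.

Lemma flat_eq0 n x : x <= 0 -> flat n x = 0.
Proof. by move=> x0; rewrite /flat ltNge x0. Qed.

Lemma flat_bounded n x : flat n x <= n%:R ^+ n.
Proof.
rewrite /flat; case: ifPn => x0; last by rewrite exprn_ge0.
rewrite expRN ler_pdivrMr ?expR_gt0//.
by rewrite exprn_le_expR// invr_ge0 ltW.
Qed.

Lemma flatS n x : flat n.+1 x * x = flat n x.
Proof.
rewrite /flat; case: ifPn => [x0|]; last by rewrite mul0r.
by rewrite exprS mulrC !mulrA mulfV ?mul1r// gt_eqF.
Qed.

Lemma is_derive_flat n (x : R) :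
  is_derive x 1 (flat n) (flat n.+2 x + (- n%:R) * flat n.+1 x).
Proof.
have [x0|x0|->] := ltgtP x 0.
- rewrite !(flat_eq0 _ (ltW x0)) mulr0 addr0.
  apply: (is_derive_near (is_derive_const 0 x)).
  by near=> y; rewrite flat_eq0// ltW//; near: y; exact: lt_nbhsl.
- rewrite {2 3}/flat x0.
  apply: (@is_derive_near (fun y : R => (y^-1) ^+ n * expR (- y^-1))); last first.
    by near=> y; rewrite /flat ifT//; near: y; exact: lt_nbhsr.
  have dV : is_derive x 1 (fun y : R => y^-1) (- x ^- 2).
    have xn0 : id x != 0 by rewrite gt_eqF.
    apply: (is_derive_ext (is_deriveV xn0 (is_derive_id x 1))) => //.
    by rewrite /GRing.scale/= mulr1.
  have dE : is_derive x 1 (fun y : R => expR (- y^-1)) (expR (- x^-1) * x ^- 2).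
    apply: (is_derive_ext (@is_derive1_comp R expR (fun y => - y^-1) x _ _ (is_derive_expR _) (is_deriveN dV))) => //.
    by rewrite opprK.
  apply: (is_derive_ext (is_deriveM (is_deriveX n dV) dE)).
    by move=> y; rewrite mulrfctE exprfctE.
  rewrite exprfctE.
  change (x^-1 ^+ n * (expR (- x^-1) / x ^+ 2) +
    expR (- x^-1) * ((n%:R * x^-1 ^+ n.-1) * - x ^- 2) =
    x^-1 ^+ n.+2 * expR (- x^-1) + - n%:R * (x^-1 ^+ n.+1 * expR (- x^-1))).
  have xn0 : x != 0 by rewrite gt_eqF.
  have -> : x ^- 2 = x^-1 ^+ 2 by rewrite exprVn.
  have -> : n%:R * x^-1 ^+ n.-1 = n%:R * x^-1 ^+ n.+1 * x ^+ 2.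
    case: n => [|n]; first by rewrite !mul0r.
    by rewrite /= !exprS expr0; field.
  by rewrite !exprS !expr0; field.
(* At the origin, [flat n h = flat n.+2 h * h ^ 2] with [flat n.+2] bounded, so the quadratic
   criterion gives derivative 0. *)
- rewrite !flat_eq0// mulr0 addr0.
  apply: (@is_derive_quadratic _ _ _ (n.+2%:R ^+ n.+2)) => h _.
  rewrite addr0 (flat_eq0 _ (lexx _)) !subr0 mulr0 subr0 ger0_norm ?flat_ge0//.
  by rewrite -flatS -flatS -mulrA -expr2 ler_wpM2r ?sqr_ge0// flat_bounded.
Unshelve. all: by end_near. Qed.

Lemma smooth_flat n : smooth (flat n).
Proof.
move=> m; elim: m n => // m ih n.
apply: nderivableS_is_derive (is_derive_flat n) _.
by apply: nderivableD => //; apply: nderivableM => //; exact: nderivable_cst.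
Qed.

Definition step (x : R) : R := flat 0 x / (flat 0 x + flat 0 (1 - x)).

Lemma step_den_gt0 x : 0 < flat 0 x + flat 0 (1 - x).
Proof.
have [x0|x0] := ltP 0 x; first by rewrite ltr_pwDl ?flat_gt0// flat_ge0.
by rewrite ltr_pwDr ?flat_gt0 ?flat_ge0//; lra.
Qed.

Lemma smooth_step : smooth step.
Proof.
have sf n : nderivable n (fun x => flat 0 (1 - x)).
  have := nderivable_affine (-1) 1 (@smooth_flat 0 n).
  by congr nderivable; apply/funext => x; rewrite mulN1r addrC.
move=> n; apply: nderivableM; first exact: smooth_flat.
apply: nderivableV; first by move=> x; rewrite gt_eqF// step_den_gt0.
by apply: nderivableD => //; exact: smooth_flat.
Qed.

Lemma step_ge0 x : 0 <= step x.
Proof. by rewrite divr_ge0 ?flat_ge0// ltW// step_den_gt0. Qed.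

Lemma step_le1 x : step x <= 1.
Proof. by rewrite ler_pdivrMr ?step_den_gt0// mul1r lerDl flat_ge0. Qed.

Lemma step_eq0 x : x <= 0 -> step x = 0.
Proof. by move=> x0; rewrite /step flat_eq0// mul0r. Qed.

Lemma step_eq1 x : 1 <= x -> step x = 1.
Proof.
move=> x1; rewrite /step (@flat_eq0 0 (1 - x)) ?addr0 ?subr_le0//.
by rewrite divff// gt_eqF// flat_gt0//; lra.
Qed.

(* A mollifier: it is supported in [0, 1] and has integral [step 1 - step 0 = 1]. *)
Definition moll : R -> R := derive1 step.

Lemma is_derive_step (x : R) : is_derive x 1 step (moll x).
Proof. exact/smooth_is_derive/smooth_step. Qed.

Lemma smooth_moll : smooth moll.
Proof. exact/smooth_derive1/smooth_step. Qed.

(** With a = [flat 0 x] and b = [flat 0 (1 - x)], [step] is a / (a + b). Here a has derivative a' =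
    [flat 2 x] and b has derivative -b', where b' = [flat 2 (1 - x)]; the quotient rule gives the
    numerator a' b + a b', all of whose factors are nonnegative. *)
Lemma moll_ge0 x : 0 <= moll x.
Proof.
have da (y : R) : is_derive y 1 (flat 0) (flat 2 y).
  by apply: is_derive_ext (is_derive_flat 0 y) _ _ => //; rewrite oppr0 mul0r addr0.
have db : is_derive x 1 (fun y => flat 0 (1 - y)) (- flat 2 (1 - x)).
  have := @is_derive_affine (flat 0) (-1) 1 x _ (da _).
  move=> /is_derive_ext; apply; last by rewrite !mulN1r addrC.
  by move=> y; rewrite mulN1r addrC.
have d0 := gt_eqF (step_den_gt0 x).
have := is_deriveM (da x) (is_deriveV (f := fun y => flat 0 y + flat 0 (1 - y)) (negbT d0) (is_deriveD (da x) db)).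
move=> /is_derive_derive1; rewrite /moll => -> /=.
set a := flat 0 x; set b := flat 0 (1 - x); set a' := flat 2 x; set b' := flat 2 (1 - x).
change (0 <= a * (- (a + b) ^- 2 * (a' + - b')) + (a + b)^-1 * a').
rewrite (_ : _ + _ = (a' * b + a * b') * (a + b) ^- 2).
  by rewrite mulr_ge0 ?invr_ge0 ?sqr_ge0// addr_ge0// mulr_ge0// flat_ge0.
by field; rewrite d0.
Qed.

Lemma moll_eq0 (x : R) : ~~ (0 <= x <= 1) -> moll x = 0.
Proof.
rewrite negb_and -!ltNge => /orP[x0|x1]; apply: is_derive_derive1.
  apply: (is_derive_near (is_derive_const 0 x)).
  by near=> y; rewrite step_eq0// ltW//; near: y; exact: lt_nbhsl.
apply: (is_derive_near (is_derive_const 1 x)).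
by near=> y; rewrite step_eq1// ltW//; near: y; exact: lt_nbhsr.
Unshelve. all: by end_near. Qed.

Lemma moll_bounded : exists2 C : R, 0 <= C & forall x, `|moll x| <= C.
Proof.
have cm : {within `[0, 1], continuous moll}.
  by apply: continuous_subspaceT; exact/smooth_continuous/smooth_moll.
have [c _ cP] := EVT_max (@ler01 R) cm.
exists (moll c) => [|x]; first exact: moll_ge0.
rewrite ger0_norm; last exact: moll_ge0.
have [x01|x01] := boolP (0 <= x <= 1); first by apply: cP; rewrite in_itv.
by rewrite moll_eq0// moll_ge0.
Qed.

End smooth.

Section interval_integral.
Context {R : realType}.
Local Notation mu := (@lebesgue_measure R).
Implicit Types f g F G : R -> R.

Lemma continuous_integrable_itv (a b : R) f : {within `[a, b], continuous f} ->
  mu.-integrable `[a, b] (EFin \o f).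
Proof. by move=> cf; apply: continuous_compact_integrable => //; exact: segment_compact. Qed.

Lemma continuous_integrable (a b : R) f : continuous f ->
  mu.-integrable `[a, b] (EFin \o f).
Proof. by move=> cf; apply: continuous_integrable_itv; exact: continuous_subspaceT. Qed.

Lemma Rintegral_FTC2 (a b : R) F f : a < b -> (forall x : R, is_derive x 1 F (f x)) ->
  continuous f -> \int[mu]_(x in `[a, b]) f x = F b - F a.
Proof.
move=> ab Ff cf; rewrite /Rintegral (continuous_FTC2 (F := F) ab)//.
- exact: continuous_subspaceT.
- have cF : continuous F.
    by move=> x; apply: differentiable_continuous; apply/derivable1_diffP; have [] := Ff x.
  split; first by move=> x _; have [] := Ff x.
  + by apply: cvg_at_right_filter; exact: cF.
  + by apply: cvg_at_left_filter; exact: cF.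
- by move=> x _; exact: is_derive_derive1.
Qed.

Lemma Rintegral_bound01 f (C : R) : continuous f ->
  (forall t, 0 <= t <= 1 -> `|f t| <= C) ->
  `|\int[mu]_(t in `[0, 1]) f t| <= C.
Proof.
move=> cf fC; apply: le_trans (le_normr_Rintegral _ _) _ => //.
  exact: continuous_integrable.
have -> : C = \int[mu]_(t in `[0%R, 1%R]) C.
  by rewrite Rintegral_cst//= lebesgue_measure_itv/= lte_fin ltr01 oppr0 adde0 mulr1.
apply: le_Rintegral => //.
- by apply: continuous_integrable => t; apply: continuous_comp; [exact: cf|exact: norm_continuous].
- by apply: (@continuous_integrable 0 1 (fun=> C)); exact: cst_continuous.
Qed.

End interval_integral.

(** * Compactly supported smooth functions on the line: uniform Lipschitz and Taylor bounds *)

Section csmooth.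
Context {R : realType}.
Implicit Types G : R -> R.

Definition csmooth G := smooth G /\ exists M : R, forall z, M < `|z| -> G z = 0.

Lemma csmooth_derive1 G : csmooth G -> csmooth (derive1 G).
Proof.
move=> [sG [M GM]]; split; first exact: smooth_derive1.
exists M => z Mz; apply: is_derive_derive1; apply: (is_derive_near (is_derive_const 0 z)).
near=> y; apply/esym/GM; near: y.
exact: (cvgr_gt _ (@norm_continuous _ _ z)).
Unshelve. all: by end_near. Qed.

Lemma csmooth_continuous G : csmooth G -> continuous G.
Proof. by move=> [sG _]; exact: smooth_continuous. Qed.

Lemma csmooth_is_derive G (z : R) : csmooth G -> is_derive z 1 G (derive1 G z).
Proof. by move=> [sG _]; exact: smooth_is_derive. Qed.

Lemma csmooth_bounded G : csmooth G -> exists2 C : R, 0 <= C & forall z, `|G z| <= C.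
Proof.
move=> cG; have [sG [M GM]] := cG.
have cn : {within `[- `|M|, `|M| ], continuous (fun z => `|G z|)}.
  apply: continuous_subspaceT => z.
  by apply: continuous_comp; [exact: csmooth_continuous|exact: norm_continuous].
have MM : - `|M| <= `|M| by rewrite ge0_cp.
have [c _ cP] := EVT_max MM cn.
exists `|G c| => // z; have [zM|zM] := leP `|z| `|M|; first by apply: cP; rewrite in_itv/= -ler_norml.
by rewrite GM ?normr0// (le_lt_trans (ler_norm M)).
Qed.

Lemma csmooth_MVT G (x y : R) : csmooth G ->
  exists c, `|c - x| <= `|y - x| /\ G y - G x = derive1 G c * (y - x).
Proof.
move=> cG.
have key a b : a < b -> exists c, [/\ a <= c, c <= b & G b - G a = derive1 G c * (b - a)].
  move=> ab; have [c] := @MVT R G (derive1 G) a b ab (fun z _ => csmooth_is_derive z cG)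
    (continuous_subspaceT (csmooth_continuous cG)).
  by rewrite in_itv/= => /andP[/ltW ac /ltW cb] e; exists c.
have [xy|yx|->] := ltgtP x y.
- have [c [xc cy e]] := key _ _ xy; exists c; split => //.
  by rewrite !ger0_norm ?subr_ge0 ?lerB// ltW.
- have [c [xc cy e]] := key _ _ yx; exists c; split.
    by rewrite !ler0_norm ?subr_le0 ?lerN2 ?lerB// ltW.
  by rewrite -opprB e -mulrN opprB.
- by exists y; rewrite !subrr mulr0.
Qed.

Lemma csmooth_lipschitz G : csmooth G ->
  exists2 C : R, 0 <= C & forall x y, `|G y - G x| <= C * `|y - x|.
Proof.
move=> cG; have [C C0 GC] := csmooth_bounded (csmooth_derive1 cG).
exists C => // x y; have [c [_ ->]] := csmooth_MVT x y cG.
by rewrite normrM ler_wpM2r.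
Qed.

(** By the mean value theorem the remainder is [h] times [derive1 G c - derive1 G x] with [c] within
    [|h|] of [x], and the derivative is Lipschitz. The constant does not depend on [x], which is
    what differentiation under the integral requires. *)
Lemma csmooth_taylor G : csmooth G ->
  exists2 C : R, 0 <= C & forall x h, `|G (x + h) - G x - h * derive1 G x| <= C * h ^+ 2.
Proof.
move=> cG; have [C C0 GC] := csmooth_lipschitz (csmooth_derive1 cG).
exists C => // x h; have [c [cx ->]] := csmooth_MVT x (x + h) cG.
rewrite [x + h]addrC addrK in cx *; rewrite mulrC -mulrBr normrM.
rewrite -[h ^+ 2]real_normK ?num_real// expr2 mulrCA ler_wpM2l//.
by apply: le_trans (GC _ _) _; rewrite ler_wpM2l.
Qed.

End csmooth.

(** * Averages over segments *)

Section averages.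
Context {R : realType}.
Local Notation mu := (@lebesgue_measure R).
Implicit Types G : R -> R.

(* Unlike the difference quotients of [G], these averages are smooth across [h = 0]. *)
Definition avg (b : nat) G (h z : R) : R :=
  \int[mu]_(t in `[0, 1]) (t ^+ b * G (z + h * t)).

Lemma continuous_affine (h z : R) : continuous (fun t : R => z + h * t).
Proof.
by move=> t; apply: cvgD; [exact: cvg_cst|apply: cvgM; [exact: cvg_cst|exact: cvg_id]].
Qed.

Lemma continuous_avg_integrand b G h z : continuous G ->
  continuous (fun t : R => t ^+ b * G (z + h * t)).
Proof.
move=> cG t; apply: cvgM; first exact: exprn_continuous.
by apply: continuous_comp; [exact: continuous_affine|exact: cG].
Qed.

Lemma avg_lipschitz b G : csmooth G -> exists2 C : R, 0 <= C &
  forall h z h' z', `|avg b G h z - avg b G h' z'| <= C * (`|h - h'| + `|z - z'|).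
Proof.
move=> cG; have [C C0 GC] := csmooth_lipschitz cG; exists C => // h z h' z'.
have cc := fun h z => @continuous_avg_integrand b G h z (csmooth_continuous cG).
rewrite /avg -RintegralB//; [|exact: continuous_integrable..].
apply: Rintegral_bound01 => [t|t /andP[t0 t1]]; first by apply: cvgB; exact: cc.
rewrite -mulrBr normrM normrX (ger0_norm t0).
rewrite -[leRHS]mul1r ler_pM// ?exprn_ge0// ?exprn_ile1//.
apply: le_trans (GC _ _) _; rewrite ler_wpM2l//.
rewrite (_ : _ - _ = (h - h') * t + (z - z')); last by ring.
apply: le_trans (ler_normD _ _) _; rewrite lerD2r normrM (ger0_norm t0).
by rewrite -[leRHS]mulr1 ler_wpM2l.
Qed.

(** Each derivative in [h] brings out a factor [t]; this is why the averages carry the weight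
    [t ^+ b]. The Taylor remainder at increment [d * t] is at most [C * d ^+ 2], since [t <= 1]. *)
Lemma is_derive_avg_h b G (h z : R) : csmooth G ->
  is_derive h 1 (fun h => avg b G h z) (avg b.+1 (derive1 G) h z).
Proof.
move=> cG; have [C C0 GC] := csmooth_taylor cG.
have cc b' h' z' := @continuous_avg_integrand b' G h' z' (csmooth_continuous cG).
have cc' b' h' z' := @continuous_avg_integrand b' (derive1 G) h' z' (csmooth_continuous (csmooth_derive1 cG)).
apply: (@is_derive_quadratic _ _ _ _ C) => d _.
rewrite /avg -RintegralZl//; last exact: continuous_integrable.
rewrite -RintegralB//; [|exact: continuous_integrable..].
have ccZ : continuous (fun t : R => d * (t ^+ b.+1 * derive1 G (z + h * t))).
  by move=> t; apply: cvgM; [exact: cvg_cst|exact: cc'].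
rewrite -RintegralB//; last 2 first.
- by apply: continuous_integrable => t; apply: cvgB; exact: cc.
- exact: continuous_integrable.
apply: Rintegral_bound01 => [t|t /andP[t0 t1]].
  by apply: cvgB; [apply: cvgB; exact: cc|exact: ccZ].
rewrite (_ : _ - _ = t ^+ b * (G (z + h * t + d * t) - G (z + h * t) - d * t * derive1 G (z + h * t))); last first.
  by rewrite exprS (_ : z + (d + h) * t = z + h * t + d * t); ring.
rewrite normrM normrX (ger0_norm t0).
rewrite -[leRHS]mul1r ler_pM// ?exprn_ge0// ?exprn_ile1//.
apply: le_trans (GC _ _) _; rewrite ler_wpM2l// exprMn ler_piMr ?sqr_ge0//.
by rewrite exprn_ile1.
Qed.

Lemma is_derive_avg_z b G (h z : R) : csmooth G ->
  is_derive z 1 (fun z => avg b G h z) (avg b (derive1 G) h z).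
Proof.
move=> cG; have [C C0 GC] := csmooth_taylor cG.
have cc b' h' z' := @continuous_avg_integrand b' G h' z' (csmooth_continuous cG).
have cc' b' h' z' := @continuous_avg_integrand b' (derive1 G) h' z' (csmooth_continuous (csmooth_derive1 cG)).
apply: (@is_derive_quadratic _ _ _ _ C) => d _.
rewrite /avg -RintegralZl//; last exact: continuous_integrable.
rewrite -RintegralB//; [|exact: continuous_integrable..].
have ccZ : continuous (fun t : R => d * (t ^+ b * derive1 G (z + h * t))).
  by move=> t; apply: cvgM; [exact: cvg_cst|exact: cc'].
rewrite -RintegralB//; last 2 first.
- by apply: continuous_integrable => t; apply: cvgB; exact: cc.
- exact: continuous_integrable.
apply: Rintegral_bound01 => [t|t /andP[t0 t1]].
  by apply: cvgB; [apply: cvgB; exact: cc|exact: ccZ].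
rewrite (_ : _ - _ = t ^+ b * (G (z + h * t + d) - G (z + h * t) - d * derive1 G (z + h * t))); last first.
  by rewrite (_ : d + z + h * t = z + h * t + d); ring.
rewrite normrM normrX (ger0_norm t0).
by rewrite -[leRHS]mul1r ler_pM// ?exprn_ge0// ?exprn_ile1.
Qed.

Lemma is_derive_affine_comp G (h z t : R) : csmooth G ->
  is_derive t 1 (fun t => G (z + h * t)) (h * derive1 G (z + h * t)).
Proof.
move=> cG; have := @is_derive_affine R G h z t _ (csmooth_is_derive _ cG).
move=> /is_derive_ext; apply => [y|]; first by rewrite addrC.
by rewrite [h * t + z]addrC.
Qed.

Lemma avg0_derive1 G h z : csmooth G -> h * avg 0 (derive1 G) h z = G (z + h) - G z.
Proof.
move=> cG.
have cc := @continuous_avg_integrand 0 (derive1 G) h z (csmooth_continuous (csmooth_derive1 cG)).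
rewrite /avg -RintegralZl//; last exact: continuous_integrable.
have := @Rintegral_FTC2 R 0 1 _ _ ltr01 (fun t => is_derive_affine_comp h z t cG).
rewrite mulr1 mulr0 addr0 => <-; last first.
  move=> t; apply: cvgM; first exact: cvg_cst.
  apply: continuous_comp; first exact: continuous_affine.
  by apply: csmooth_continuous; exact: csmooth_derive1.
by apply: eq_Rintegral => t _; rewrite expr0 mul1r.
Qed.

(** Integration by parts: the derivative of [t * G (z + h * t)] in [t] is
    [G (z + h * t) + h * t * G' (z + h * t)]. As the formula is not divided by [h], it holds at
    [h = 0] as well. *)
Lemma avg1_derive1 G h z : csmooth G -> h * avg 1 (derive1 G) h z = G (z + h) - avg 0 G h z.
Proof.
move=> cG; apply/eqP; rewrite -subr_eq opprK addrC eq_sym; apply/eqP.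
have c0 := @continuous_avg_integrand 0 G h z (csmooth_continuous cG).
have c1 := @continuous_avg_integrand 1 (derive1 G) h z (csmooth_continuous (csmooth_derive1 cG)).
rewrite /avg -RintegralZl//; last exact: continuous_integrable.
have c2 : continuous (fun t : R => h * (t ^+ 1 * derive1 G (z + h * t))).
  by move=> t; apply: cvgM; [exact: cvg_cst|exact: c1].
rewrite -RintegralD//; [|exact: continuous_integrable..].
have dt (t : R) : is_derive t 1 (fun t => t * G (z + h * t))
    (t ^+ 0 * G (z + h * t) + h * (t ^+ 1 * derive1 G (z + h * t))).
  apply: (is_derive_ext (is_deriveM (is_derive_id t 1) (is_derive_affine_comp h z t cG))) => //.
  change (t * (h * derive1 G (z + h * t)) + G (z + h * t) * 1 = 
    t ^+ 0 * G (z + h * t) + h * (t ^+ 1 * derive1 G (z + h * t))).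
  by rewrite expr0 expr1; ring.
rewrite (@Rintegral_FTC2 R 0 1 _ _ ltr01 dt); first by rewrite mul0r subr0 mul1r mulr1.
by move=> t; apply: cvgD; [exact: c0|exact: c2].
Qed.

End averages.

(** * Real test functions *)

Section real_operators.
Context {R : realType}.
Implicit Types (f g : R * R -> R) (U : set R).

Definition drR f : R * R -> R := fun x => derive1 (fun r => f (r, x.2)) x.1.

Definition dzR f : R * R -> R := fun x => derive1 (fun z => f (x.1, z)) x.2.

Definition calDR (j : int) f : R * R -> R := fun x => drR f x + j%:~R / x.1 * f x.

Fixpoint calDnR (n : nat) (j : int) f : R * R -> R :=
  if n is n'.+1 then calDR (j - n'%:Z) (calDnR n' j f) else f.

Definition mixedDR (k l i m : nat) f : R * R -> R :=
  calDnR l (i%:Z - k%:Z) (calDnR i k%:Z (iter m dzR f)).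

Definition dr_existsR f := forall x, 0 < x.1 -> derivable (fun r => f (r, x.2)) x.1 1.

Definition dz_existsR f := forall x, 0 < x.1 -> derivable (fun z => f (x.1, z)) x.2 1.

(** [U] constrains r alone, so whole lines in z are covered and z-derivatives preserve the relation;
    r-derivatives preserve it when [U] is open. *)
Definition eq_on U f g := forall x, U x.1 -> f x = g x.

Lemma eq_on_sym U f g : eq_on U f g -> eq_on U g f.
Proof. by move=> fg x Ux; rewrite fg. Qed.

Lemma near_eq_on U f g x : open U -> U x.1 -> eq_on U f g ->
  \forall r \near x.1, f (r, x.2) = g (r, x.2).
Proof.
move=> oU Ux fg; have : nbhs x.1 U by exact: open_nbhs_nbhs.
by apply: filterS => r Ur; exact: fg.
Qed.

Lemma near_derive1 (h h' : R -> R) (x : R) : (\forall y \near x, h y = h' y) ->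
  derive1 h x = derive1 h' x.
Proof. by move=> hh; rewrite !derive1E; apply: near_eq_derive. Qed.

Lemma near_derivable (h h' : R -> R) (x : R) : (\forall y \near x, h y = h' y) ->
  derivable h x 1 -> derivable h' x 1.
Proof. by move=> hh; apply: near_eq_derivable. Qed.

Lemma eq_on_drR U f g : open U -> eq_on U f g -> eq_on U (drR f) (drR g).
Proof. by move=> oU fg x Ux; apply: near_derive1; exact: near_eq_on fg. Qed.

Lemma eq_on_dzR U f g : eq_on U f g -> eq_on U (dzR f) (dzR g).
Proof.
move=> fg x Ux; rewrite /dzR; congr (derive1 _ _); apply/funext => z.
exact: (fg (x.1, z)).
Qed.

Lemma eq_on_iter_dzR U m f g : eq_on U f g ->
  eq_on U (iter m dzR f) (iter m dzR g).
Proof. by move=> fg; elim: m => //= m ih; exact: eq_on_dzR. Qed.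

Lemma eq_on_calDR U j f g : open U -> eq_on U f g ->
  eq_on U (calDR j f) (calDR j g).
Proof.
by move=> oU fg x Ux; rewrite /calDR (eq_on_drR oU fg)// fg.
Qed.

Lemma eq_on_calDnR U n j f g : open U -> eq_on U f g ->
  eq_on U (calDnR n j f) (calDnR n j g).
Proof. by move=> oU fg; elim: n => //= n ih; exact: eq_on_calDR. Qed.

Lemma eq_on_mixedDR U k l i m f g : open U -> eq_on U f g ->
  eq_on U (mixedDR k l i m f) (mixedDR k l i m g).
Proof. by move=> oU fg; do 2 apply: eq_on_calDnR => //; exact: eq_on_iter_dzR. Qed.

Lemma eq_on_dr_existsR f g : eq_on [set r | 0 < r] f g -> dr_existsR f -> dr_existsR g.
Proof.
move=> fg df x x0; apply: near_derivable (df x x0).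
exact: (near_eq_on (@open_gt R 0) x0 fg).
Qed.

Lemma eq_on_dz_existsR f g : eq_on [set r | 0 < r] f g -> dz_existsR f -> dz_existsR g.
Proof.
move=> fg df x x0; suff <- : (fun z => f (x.1, z)) = (fun z => g (x.1, z)) by exact: df.
by apply/funext => z; exact: (fg (x.1, z)).
Qed.

Lemma drRD f g : dr_existsR f -> dr_existsR g ->
  eq_on [set r | 0 < r] (drR (fun x => f x + g x)) (fun x => drR f x + drR g x).
Proof.
move=> df dg x x0; apply: is_derive_derive1.
by apply: is_deriveD; apply: derivable_is_derive1; [exact: df|exact: dg].
Qed.

Lemma dr_existsRD f g : dr_existsR f -> dr_existsR g -> dr_existsR (fun x => f x + g x).
Proof. by move=> df dg x x0; apply: derivableD; [exact: df|exact: dg]. Qed.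

Lemma drRM f g : dr_existsR f -> dr_existsR g ->
  eq_on [set r | 0 < r] (drR (fun x => f x * g x)) (fun x => f x * drR g x + g x * drR f x).
Proof.
move=> df dg [x z] x0; apply: is_derive_derive1.
exact: (is_deriveM (derivable_is_derive1 (df (x, z) x0)) (derivable_is_derive1 (dg (x, z) x0))).
Qed.

Lemma dr_existsRM f g : dr_existsR f -> dr_existsR g -> dr_existsR (fun x => f x * g x).
Proof. by move=> df dg x x0; apply: derivableM; [exact: df|exact: dg]. Qed.

Lemma dr_existsR_cst c : dr_existsR (fun=> c).
Proof. by move=> x _; exact: derivable_cst. Qed.

Lemma drR_cst c : drR (fun=> c) = fun=> 0.
Proof. by apply/funext => x; exact: derive1_cst. Qed.

Lemma drRZ a f : dr_existsR f ->
  eq_on [set r | 0 < r] (drR (fun x => a * f x)) (fun x => a * drR f x).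
Proof.
by move=> df x x0; rewrite (drRM (@dr_existsR_cst a) df x0) drR_cst mulr0 addr0.
Qed.

Lemma dr_existsRZ a f : dr_existsR f -> dr_existsR (fun x => a * f x).
Proof. by move=> df; exact: (dr_existsRM (@dr_existsR_cst a) df). Qed.

Lemma calDR_lin j a b f g : dr_existsR f -> dr_existsR g ->
  eq_on [set r | 0 < r] (calDR j (fun x => a * f x + b * g x))
    (fun x => a * calDR j f x + b * calDR j g x).
Proof.
move=> df dg x x0; rewrite /calDR.
rewrite (drRD (@dr_existsRZ a _ df) (@dr_existsRZ b _ dg) x0).
by rewrite (@drRZ a _ df _ x0) (@drRZ b _ dg _ x0); ring.
Qed.

Lemma dzR_lin a b f g : dz_existsR f -> dz_existsR g ->
  eq_on [set r | 0 < r] (dzR (fun x => a * f x + b * g x))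
    (fun x => a * dzR f x + b * dzR g x).
Proof.
move=> df dg x x0; apply: is_derive_derive1.
have df' := derivable_is_derive1 (df _ x0); have dg' := derivable_is_derive1 (dg _ x0).
have ma c h (l : R) : is_derive x.2 1 h l -> is_derive x.2 1 (fun z => c * h z) (c * l).
  by move=> hl; exact: (is_deriveZ c hl).
exact: is_deriveD (ma a _ _ df') (ma b _ _ dg').
Qed.

Lemma dz_existsR_lin a b f g : dz_existsR f -> dz_existsR g ->
  dz_existsR (fun x => a * f x + b * g x).
Proof.
by move=> df dg x x0; apply: derivableD; apply: derivableM;
  [exact: derivable_cst|exact: df|exact: derivable_cst|exact: dg].
Qed.

(** Existence and joint continuity of the first [n] r-derivatives off the axis. Unlike the
    conditions phrased with the operators $D_j$, this is visibly stable under products and under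
    multiplication by functions of r such as 1/r. *)
Fixpoint radial (n : nat) f : Prop :=
  (forall x, 0 < x.1 -> {for x, continuous f}) /\
  (if n is n'.+1 then dr_existsR f /\ radial n' (drR f) else True).

Lemma radial_continuous n f x : radial n f -> 0 < x.1 -> {for x, continuous f}.
Proof. by case: n => [|n] [cf _]; exact: cf. Qed.

Lemma radialW n f : radial n.+1 f -> radial n f.
Proof. by elim: n f => [|n ih] f [cf [df /= rf]]; split => //; split=> //; exact: ih. Qed.

Lemma radial_dr_existsR n f : radial n.+1 f -> dr_existsR f.
Proof. by case=> _ []. Qed.

Lemma near_gt0 (x : R * R) : 0 < x.1 -> \forall y \near x, 0 < y.1.
Proof. by move=> x0; apply: (cvgr_gt _ (@cvg_fst _ _ _ _ _)). Qed.

Lemma eq_on_continuous f g x : eq_on [set r | 0 < r] f g -> 0 < x.1 ->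
  {for x, continuous f} -> {for x, continuous g}.
Proof.
move=> fg x0 cf; rewrite /prop_for /continuous_at -(fg x x0).
apply: cvg_trans cf; apply: near_eq_cvg; near=> y; rewrite fg//.
by near: y; exact: near_gt0.
Unshelve. all: by end_near. Qed.

Lemma eq_on_radial n f g : eq_on [set r | 0 < r] f g -> radial n f -> radial n g.
Proof.
elim: n f g => [|n ih] f g fg.
  by move=> [cf _]; split=> // x x0; exact: eq_on_continuous (cf x x0).
move=> [cf [df rf]]; split; first by move=> x x0; exact: eq_on_continuous (cf x x0).
split; first exact: eq_on_dr_existsR df.
by apply: ih rf; apply: eq_on_drR => //; exact: open_gt.
Qed.

Lemma radialS n f df : (forall x, 0 < x.1 -> {for x, continuous f}) ->
  (forall x : R * R, 0 < x.1 -> is_derive x.1 1 (fun r => f (r, x.2)) (df x)) ->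
  radial n df -> radial n.+1 f.
Proof.
move=> cf fdf rdf; split => //; split; first by move=> x /fdf[].
by apply: eq_on_radial rdf => x x0; apply/esym/is_derive_derive1; exact: fdf.
Qed.

Lemma radial_cst n c : radial n (fun=> c).
Proof.
elim: n c => [|n ih] c; first by split=> // x _; exact: cst_continuous.
apply: (@radialS _ _ (fun=> 0)) => // x _; first exact: cst_continuous.
exact: is_derive_const.
Qed.

Lemma radialD n f g : radial n f -> radial n g -> radial n (fun x => f x + g x).
Proof.
elim: n f g => [|n ih] f g [cf rf] [cg rg].
  by split=> // x x0; apply: continuousD; [exact: cf|exact: cg].
have [df rf'] := rf; have [dg rg'] := rg.
split; first by move=> x x0; apply: continuousD; [exact: cf|exact: cg].
split; first exact: dr_existsRD.
exact: eq_on_radial (eq_on_sym (drRD df dg)) (ih _ _ rf' rg').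
Qed.

Lemma radialM n f g : radial n f -> radial n g -> radial n (fun x => f x * g x).
Proof.
elim: n f g => [|n ih] f g hf hg; have [cf rf] := hf; have [cg rg] := hg.
  by split=> // x x0; apply: continuousM; [exact: cf|exact: cg].
have [df rf'] := rf; have [dg rg'] := rg.
split; first by move=> x x0; apply: continuousM; [exact: cf|exact: cg].
split; first exact: dr_existsRM.
apply: eq_on_radial (eq_on_sym (drRM df dg)) _.
by apply: radialD; apply: ih => //; exact: radialW.
Qed.

Lemma radial_fst n (chi : R -> R) : smooth chi -> radial n (fun x => chi x.1).
Proof.
elim: n chi => [|n ih] chi schi.
  split=> // x _; apply: continuous_comp; first exact: cvg_fst.
  exact: smooth_continuous.
apply: (@radialS _ _ (fun x => derive1 chi x.1)) => [x _|x _|]; last first.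
- exact: (ih _ (smooth_derive1 schi)).
- exact: smooth_is_derive.
- apply: continuous_comp; first exact: cvg_fst.
  exact: smooth_continuous.
Qed.

Lemma radial_inv n : radial n (fun x => x.1^-1).
Proof.
have c0 (x : R * R) : 0 < x.1 -> {for x, continuous (fun x : R * R => x.1^-1)}.
  by move=> x0; apply: continuousV; [rewrite gt_eqF|exact: cvg_fst].
elim: n => [|n ih]; first by split.
apply: (@radialS _ _ (fun x => - 1 * (x.1^-1 * x.1^-1))) => // [x x0|].
  have xn0 : id x.1 != 0 by rewrite gt_eqF.
  apply: (is_derive_ext (is_deriveV xn0 (is_derive_id x.1 1))) => //.
  change (- x.1 ^- 2 * 1 = - 1 * (x.1^-1 * x.1^-1)).
  by rewrite expr2 invfM; ring.
by apply: radialM; [exact: radial_cst|exact: radialM].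
Qed.

Lemma continuous_avg b (G : R -> R) : csmooth G ->
  continuous (fun x : R * R => avg b G (x.1 - 1) x.2).
Proof.
move=> cG x; have [C C0 GC] := avg_lipschitz b cG.
apply/cvgrPdist_le => e e0.
have e1 : 0 < e / (C + 1) / 2 by rewrite !divr_gt0// ltr_wpDl.
near=> y; apply: le_trans (GC _ _ _ _) _.
have -> : x.1 - 1 - (y.1 - 1) = x.1 - y.1 by ring.
have h1 : `|x.1 - y.1| <= e / (C + 1) / 2.
  by near: y; exact: (@cvgr_dist_le _ _ _ (nbhs x) _ fst x.1 cvg_fst _ e1).
have h2 : `|x.2 - y.2| <= e / (C + 1) / 2.
  by near: y; exact: (@cvgr_dist_le _ _ _ (nbhs x) _ snd x.2 cvg_snd _ e1).
apply: (@le_trans _ _ ((C + 1) * (e / (C + 1)))); last first.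
  by rewrite mulrC divfK// gt_eqF// ltr_wpDl.
by apply: ler_pM => //; [rewrite lerDl|lra].
Unshelve. all: by end_near. Qed.

Lemma radial_avg n b (G : R -> R) : csmooth G ->
  radial n (fun x => avg b G (x.1 - 1) x.2).
Proof.
elim: n b G => [|n ih] b G cG; first by split=> // x _; exact: continuous_avg.
apply: (@radialS _ _ (fun x => avg b.+1 (derive1 G) (x.1 - 1) x.2)).
- by move=> x _; exact: continuous_avg.
- move=> x _; have := @is_derive_affine R (fun h => avg b G h x.2) 1 (-1) x.1 _ (is_derive_avg_h b _ _ cG).
  by rewrite !mul1r => /is_derive_ext; apply => // y; rewrite mul1r.
- by apply: ih; exact: csmooth_derive1.
Qed.

Lemma radial_calDR n j f : radial n.+1 f -> radial n (calDR j f).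
Proof.
move=> rf; apply: radialD; first by case: rf => _ [].
apply: radialM; last exact: radialW.
by apply: radialM; [exact: radial_cst|exact: radial_inv].
Qed.

Lemma radial_calDnR n m j f : radial (n + m) f -> radial n (calDnR m j f).
Proof.
elim: m n f => [|m ih] n f; first by rewrite addn0.
by move=> rf; apply: radial_calDR; apply: ih; rewrite addSnnS.
Qed.

End real_operators.

Section real_test_functions.
Context {R : realType}.
Implicit Types (f g F : R * R -> R) (k : nat).

Definition CinftyR k f : Prop :=
  [/\ (forall m, dz_existsR (iter m dzR f)) /\
        (forall l i m, dr_existsR (mixedDR k l i m f)),
      {within half_plane R, continuous f} &
      forall i n p : nat, (i <= n <= p)%N ->
        exists E : R * R -> R,
          [/\ {within half_plane R, continuous E},
              forall x, 0 < x.1 -> E x = mixedDR k (n - i) i (p - n) f x &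
              forall z : R, (k%:Z + n%:Z - 2 * i%:Z)%:~R * E (0, z) = 0]].

Definition supported_in (A : set (R * R)) f : Prop :=
  exists K : set (R * R),
    [/\ compact K, K `<=` A & forall x, half_plane R x -> ~ K x -> f x = 0].

Lemma iter_dzR_lin m a b f g : (forall m, dz_existsR (iter m dzR f)) ->
  (forall m, dz_existsR (iter m dzR g)) ->
  eq_on [set r | 0 < r] (iter m dzR (fun x => a * f x + b * g x))
    (fun x => a * iter m dzR f x + b * iter m dzR g x).
Proof.
move=> df dg; elim: m => //= m ih x x0.
by rewrite (eq_on_dzR ih x0) (dzR_lin _ _ (df m) (dg m) x0).
Qed.

Lemma calDnR_lin n j a b f g : (forall n, dr_existsR (calDnR n j f)) ->
  (forall n, dr_existsR (calDnR n j g)) ->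
  eq_on [set r | 0 < r] (calDnR n j (fun x => a * f x + b * g x))
    (fun x => a * calDnR n j f x + b * calDnR n j g x).
Proof.
move=> df dg; elim: n => //= n ih x x0.
by rewrite (eq_on_calDR _ (@open_gt R 0) ih x0) (calDR_lin _ _ _ (df n) (dg n) x0).
Qed.

Lemma mixedDR_lin k l i m a b f g : CinftyR k f -> CinftyR k g ->
  eq_on [set r | 0 < r] (mixedDR k l i m (fun x => a * f x + b * g x))
    (fun x => a * mixedDR k l i m f x + b * mixedDR k l i m g x).
Proof.
move=> [[zf rf] _ _] [[zg rg] _ _] x x0; rewrite /mixedDR.
have oU := @open_gt R 0.
rewrite -(@calDnR_lin l _ a b _ _ (fun n => rf n i m) (fun n => rg n i m) x x0).
apply: (eq_on_calDnR _ _ oU _ x0) => y y0.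
have cf n : dr_existsR (calDnR n k%:Z (iter m dzR f)) by exact: (rf 0%N n m).
have cg n : dr_existsR (calDnR n k%:Z (iter m dzR g)) by exact: (rg 0%N n m).
rewrite -(@calDnR_lin i _ a b _ _ cf cg y y0).
by apply: (eq_on_calDnR _ _ oU _ y0); exact: iter_dzR_lin.
Qed.

Lemma within_continuous_lin (A : set (R * R)) (a b : R) f g :
  {within A, continuous f} -> {within A, continuous g} ->
  {within A, continuous (fun x => a * f x + b * g x)}.
Proof.
move=> cf cg x; apply: cvgD; (apply: cvgM; first exact: cvg_cst).
  exact: cf.
exact: cg.
Qed.

Lemma CinftyR_lin k a b f g : CinftyR k f -> CinftyR k g ->
  CinftyR k (fun x => a * f x + b * g x).
Proof.
move=> hf hg; have [[zf rf] cf ef] := hf; have [[zg rg] cg eg] := hg; split.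
- split=> [m|l i m].
    apply: (eq_on_dz_existsR (eq_on_sym (iter_dzR_lin m a b zf zg))).
    exact: dz_existsR_lin.
  apply: (eq_on_dr_existsR (eq_on_sym (mixedDR_lin l i m a b hf hg))).
  by apply: dr_existsRD; exact: dr_existsRZ.
- exact: within_continuous_lin.
- move=> i n p inp; have [E1 [c1 e1 z1]] := ef _ _ _ inp.
  have [E2 [c2 e2 z2]] := eg _ _ _ inp.
  exists (fun x => a * E1 x + b * E2 x); split.
  + exact: within_continuous_lin.
  + by move=> x x0; rewrite mixedDR_lin// e1// e2.
  + by move=> z; rewrite mulrDr mulrCA z1 mulr0 add0r mulrCA z2 mulr0.
Qed.

Lemma supported_in_lin A a b f g : supported_in A f -> supported_in A g ->
  supported_in A (fun x => a * f x + b * g x).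
Proof.
move=> [K [cK KA fK]] [L [cL LA gL]]; exists (K `|` L); split.
- exact: compactU.
- by move=> x [/KA|/LA].
- by move=> x hx /not_orP[Kx Lx]; rewrite fK// gL// !mulr0 addr0.
Qed.

Lemma within_continuousP (A : set (R * R)) f :
  {within A, continuous f} <-> (forall x, A x -> f y @[y --> within A (nbhs x)] --> f x).
Proof. exact: subspace_continuousP. Qed.

Lemma within_continuous_near (A : set (R * R)) f g x : A x ->
  (\forall y \near x, A y -> f y = g y) ->
  f y @[y --> within A (nbhs x)] --> f x -> g y @[y --> within A (nbhs x)] --> g x.
Proof.
move=> Ax fg; rewrite -(nbhs_singleton fg Ax); apply: cvg_trans.
by apply: near_eq_cvg.
Qed.

Lemma near_lt (x : R * R) (a : R) : x.1 < a -> \forall y \near x, y.1 < a.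
Proof. by move=> x0; apply: (cvgr_lt _ (@cvg_fst _ _ _ _ _)). Qed.

Lemma glue_continuous (a : R) f g : 0 < a -> {within half_plane R, continuous g} ->
  (forall x, 0 <= x.1 -> x.1 < a -> f x = g x) ->
  (forall x, 0 < x.1 -> {for x, continuous f}) ->
  {within half_plane R, continuous f}.
Proof.
move=> a0 /within_continuousP cg fg cf; apply/within_continuousP => x hx.
have [x0|x0] := ltP 0 x.1.
  by apply: cvg_within_filter; exact: cf.
apply: (within_continuous_near hx _ (cg _ hx)).
have xa : x.1 < a by exact: le_lt_trans a0.
by apply: filterS (near_lt xa) => y ya y0; rewrite fg.
Qed.

Lemma radial_mixedDR k l i m n f : (forall n, radial n (iter m dzR f)) ->
  radial n (mixedDR k l i m f).
Proof. by move=> rf; do 2 apply: radial_calDnR; exact: rf. Qed.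

(* The conditions defining [CinftyR] constrain [f] only on the axis; off the axis it
   suffices that [f] is smooth. *)
Lemma CinftyR_glue k (a : R) f g : 0 < a -> CinftyR k g ->
  (forall x, 0 <= x.1 -> x.1 < a -> f x = g x) ->
  (forall m, dz_existsR (iter m dzR f)) ->
  (forall m n, radial n (iter m dzR f)) ->
  CinftyR k f.
Proof.
move=> a0 [_ cg eg] fg zf rf.
have eqfg : eq_on [set r | 0 < r < a] f g by move=> x /= /andP[/ltW x0 xa]; exact: fg.
have oU : open [set r : R | 0 < r < a].
  rewrite (_ : mkset _ = `]0, a[%classic); last by apply/seteqP; split=> r /=; rewrite in_itv.
  exact: interval_open.
split.
- split=> [|l i m]; first exact: zf.
  by apply: (@radial_dr_existsR _ 0); apply: radial_mixedDR => n; exact: rf.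
- apply: (glue_continuous a0 cg fg) => x x0.
  exact: (radial_continuous (rf 0%N 0%N)).
- move=> i n p inp; have [E [cE eE zE]] := eg _ _ _ inp.
  (* For [x.1 < a] this is the extension belonging to [g], beyond it the derivative of [f] itself;
     the two agree on [0 < x.1 < a], and only the first branch meets the axis. *)
  exists (fun x => if x.1 < a then E x else mixedDR k (n - i) i (p - n) f x).
  have Ef x : 0 < x.1 -> (if x.1 < a then E x else mixedDR k (n - i) i (p - n) f x) =
      mixedDR k (n - i) i (p - n) f x.
    move=> x0; case: ifPn => // xa; rewrite eE//.
    by apply/esym/(eq_on_mixedDR _ _ _ _ oU eqfg); rewrite /= x0 xa.
  split => //.
  + apply: (glue_continuous a0 cE) => x x0.
      by move=> ->.
    have Ef' : eq_on [set r | 0 < r] (mixedDR k (n - i) i (p - n) f)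
        (fun x => if x.1 < a then E x else mixedDR k (n - i) i (p - n) f x).
      by move=> y y0; rewrite Ef.
    apply: (eq_on_continuous Ef' x0).
    by apply: (radial_continuous (n := 0)) => //; exact: radial_mixedDR.
  + by move=> z /=; rewrite a0.
Qed.

Lemma CinftyR0 k : CinftyR k (fun=> 0).
Proof.
have z0 m : iter m dzR (fun=> 0) = fun=> 0 :> R.
  by elim: m => //= m ->; apply/funext => x; exact: derive1_cst.
have c0 l j : eq_on [set r | 0 < r] (calDnR l j (fun=> 0)) (fun=> 0 : R).
  elim: l => //= l ih x x0.
  by rewrite (eq_on_calDR _ (@open_gt R 0) ih x0) /calDR drR_cst mulr0 addr0.
have m0 l i m : eq_on [set r | 0 < r] (mixedDR k l i m (fun=> 0)) (fun=> 0 : R).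
  move=> x x0; rewrite /mixedDR z0 -[RHS](c0 l (i%:Z - k%:Z) x x0).
  by apply: (eq_on_calDnR _ _ (@open_gt R 0) (c0 _ _) x0).
split.
- split=> [m|l i m]; first by rewrite z0 => x _; exact: derivable_cst.
  by apply: (eq_on_dr_existsR (eq_on_sym (m0 l i m))); exact: dr_existsR_cst.
- by apply: continuous_subspaceT => x; exact: cst_continuous.
- move=> i n p _; exists (fun=> 0); split.
  + by apply: continuous_subspaceT => x; exact: cst_continuous.
  + by move=> x x0; rewrite m0.
  + by move=> z; rewrite mulr0.
Qed.

Lemma within_half_plane_continuous f x : {within half_plane R, continuous f} ->
  0 < x.1 -> {for x, continuous f}.
Proof.
move=> cf x0.
have oP : open [set x : R * R | 0 < x.1] by rewrite openE => y y0; exact: near_gt0.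
have : {within [set x : R * R | 0 < x.1], continuous f}.
  by apply: continuous_subspaceW cf => y /ltW.
by rewrite continuous_open_subspace// => /(_ x); apply; rewrite inE.
Qed.

(** Take [i = 0]. The next operator applied to [mixedDR k l 0 m f] is the r-derivative plus [c / r],
    so that derivative is [mixedDR k l.+1 0 m f] minus [c / r] times [mixedDR k l 0 m f]. Induction
    on the order, for all [l] at once, recovers ordinary r-derivatives off the axis. *)
Lemma CinftyR_radial k f m n : CinftyR k f -> radial n (iter m dzR f).
Proof.
move=> [[_ rf] _ ef].
suff h : forall l, radial n (mixedDR k l 0 m f) by exact: (h 0%N).
have cM l x : 0 < x.1 -> {for x, continuous (mixedDR k l 0 m f)}.
  move=> x0; have [|E [cE eE _]] := ef 0%N l (l + m)%N; first by rewrite leq_addr.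
  rewrite subn0 addKn in eE; apply: (eq_on_continuous eE x0).
  exact: within_half_plane_continuous.
elim: n => [|n ih] l; first by split=> // x; exact: cM.
split; first by move=> x; exact: cM.
split; first exact: rf.
pose c : R := (0%:Z - k%:Z - l%:Z)%:~R.
apply: (@eq_on_radial _ _ (fun x => mixedDR k l.+1 0 m f x + (- c) * x.1^-1 * mixedDR k l 0 m f x)).
  move=> x x0; rewrite {1}/mixedDR /= -/(mixedDR k l 0 m f).
  by rewrite /calDR /c -/(mixedDR k l 0 m f); ring.
apply: radialD; first exact: ih.
apply: radialM; last exact: ih.
by apply: radialM; [exact: radial_cst|exact: radial_inv].
Qed.

Lemma iter_dzR_fst m (chi : R -> R) f : (forall m, dz_existsR (iter m dzR f)) ->
  eq_on [set r | 0 < r] (iter m dzR (fun x => chi x.1 * f x))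
    (fun x => chi x.1 * iter m dzR f x).
Proof.
move=> df; elim: m => //= m ih x x0; rewrite (eq_on_dzR ih x0).
apply: is_derive_derive1.
exact: (is_deriveZ (chi x.1) (derivable_is_derive1 (df m x x0))).
Qed.

Lemma dz_existsR_fst m (chi : R -> R) f : (forall m, dz_existsR (iter m dzR f)) ->
  dz_existsR (iter m dzR (fun x => chi x.1 * f x)).
Proof.
move=> df; apply: (eq_on_dz_existsR (eq_on_sym (iter_dzR_fst m chi df))) => x x0.
by have [] := is_deriveZ (chi x.1) (derivable_is_derive1 (df m x x0)).
Qed.

Lemma radial_iter_dzR_fst m n (chi : R -> R) f : smooth chi ->
  (forall m, dz_existsR (iter m dzR f)) -> radial n (iter m dzR f) ->
  radial n (iter m dzR (fun x => chi x.1 * f x)).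
Proof.
move=> schi df rf; apply: (eq_on_radial (eq_on_sym (iter_dzR_fst m chi df))).
by apply: radialM => //; exact: radial_fst.
Qed.

Lemma CinftyR_cutoff k (a : R) (chi : R -> R) f : 0 < a -> smooth chi ->
  (forall r, r < a -> chi r = 1) -> CinftyR k f ->
  CinftyR k (fun x => chi x.1 * f x).
Proof.
move=> a0 schi chi1 hf; have [[zf _] _ _] := hf.
apply: (CinftyR_glue a0 hf).
- by move=> x _ xa; rewrite chi1// mul1r.
- by move=> m; exact: dz_existsR_fst.
- by move=> m n; apply: radial_iter_dzR_fst => //; exact: CinftyR_radial hf.
Qed.

(** The averages are smooth but need not meet the conditions on the axis. Since [chi] vanishes for
    [r < a], the product agrees near the axis with the zero function, which meets them all. *)
Lemma CinftyR_lift k (a : R) (chi G : R -> R) : 0 < a -> smooth chi ->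
  (forall r, r < a -> chi r = 0) -> csmooth G ->
  CinftyR k (fun x => chi x.1 * avg 0 G (x.1 - 1) x.2).
Proof.
move=> a0 schi chi0 cG.
have cGm m : csmooth (iter m (@derive1 R _) G).
  by elim: m => //= m; exact: csmooth_derive1.
have E m : iter m dzR (fun x => avg 0 G (x.1 - 1) x.2) =
    fun x => avg 0 (iter m (@derive1 R _) G) (x.1 - 1) x.2.
  elim: m => // m ih; rewrite iterS ih; apply/funext => x.
  exact: (is_derive_derive1 (is_derive_avg_z 0 (x.1 - 1) x.2 (cGm m))).
have zf m : dz_existsR (iter m dzR (fun x => avg 0 G (x.1 - 1) x.2)).
  by rewrite E => x _; have [] := is_derive_avg_z 0 (x.1 - 1) x.2 (cGm m).
apply: (CinftyR_glue a0 (CinftyR0 k)).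
- by move=> x _ xa; rewrite chi0// mul0r.
- by move=> m; exact: dz_existsR_fst.
- by move=> m n; apply: radial_iter_dzR_fst => //; rewrite E; exact: radial_avg.
Qed.

Lemma supported_bounded f : supported_in (half_plane R) f ->
  exists M : R, forall x, 0 <= x.1 -> M < `|x.2| -> f x = 0.
Proof.
move=> [K [cK _ fK]]; have [M [_ KM]] := compact_bounded cK.
exists (M + 1) => x x0 Mx; apply: fK => // Kx.
have M1 : M < M + 1 by rewrite ltrDl.
have := KM (M + 1) M1 x Kx; rewrite /= prod_normE.
by rewrite ge_max leNgt => /andP[_]; rewrite leNgt Mx.
Qed.

Lemma trace_csmooth k f (r : R) : 0 < r -> CinftyR k f ->
  supported_in (half_plane R) f -> csmooth (fun z => f (r, z)).
Proof.
move=> r0 [[zf _] _ _] sf; split; last first.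
  have [M fM] := supported_bounded sf; exists M => z Mz.
  by apply: fM => //=; exact: ltW.
move=> n; rewrite (_ : (fun z => f (r, z)) = fun z => iter 0 dzR f (r, z))//.
elim: n 0%N => // n ih m; split; first by move=> z; exact: (zf m (r, z)).
by have := ih m.+1.
Qed.

End real_test_functions.

(** * Jets of test functions and the Poincare inequality *)

Section continuous_unit_interval.
Context {R : realType}.

Definition cont01 (a : R -> R) : Prop := {within `[0, 1], continuous a}.

Lemma cont01_cst (c : R) : cont01 (fun=> c).
Proof. by apply: continuous_subspaceT => r; exact: cst_continuous. Qed.

Lemma cont01_id : cont01 (fun r => r).
Proof. by apply: continuous_subspaceT => r; exact: cvg_id. Qed.

Lemma cont01M (a b : R -> R) : cont01 a -> cont01 b -> cont01 (fun r => a r * b r).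
Proof. by move=> ca cb r; apply: cvgM; [exact: ca|exact: cb]. Qed.

Lemma cont01X2 (a : R -> R) : cont01 a -> cont01 (fun r => a r ^+ 2).
Proof. by move=> ca; exact: (cont01M ca ca). Qed.

Lemma cont01D (a b : R -> R) : cont01 a -> cont01 b -> cont01 (fun r => a r + b r).
Proof. by move=> ca cb r; apply: cvgD; [exact: ca|exact: cb]. Qed.

Lemma cont01N (a : R -> R) : cont01 a -> cont01 (fun r => - a r).
Proof. by move=> ca r; apply: cvgN; exact: ca. Qed.

End continuous_unit_interval.

Ltac prove_cont01 := repeat match goal with
  | H : cont01 ?a |- cont01 ?a => exact H
  | |- cont01 (fun r => r) => exact cont01_id
  | |- cont01 (fun _ => ?c) => exact (@cont01_cst _ c)
  | |- cont01 (fun r => @?a r + @?b r) => apply (@cont01D _ a b)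
  | |- cont01 (fun r => - @?a r) => apply (@cont01N _ a)
  | |- cont01 (fun r => @?a r ^+ 2) => apply (@cont01X2 _ a)
  | |- cont01 (fun r => @?a r * @?b r) => apply (@cont01M _ a b)
  end.

Section real_jets.
Context {R : realType}.
Local Notation MR := (measurableTypeR R).
Local Notation mu := (@lebesgue_measure R).
Local Notation S := (strip R : set (MR * MR)).
Implicit Types (f g E F : R * R -> R) (k : nat).

Lemma measurable_fst_strip : measurable_fun S (fst : MR * MR -> MR).
Proof. by apply: measurable_funTS; exact: measurable_fst. Qed.

Lemma strip_gt0 (x : R * R) : S x -> 0 < x.1.
Proof. by case/andP. Qed.

Definition L2R f := wL2 (leb2 R) S fst f.
Definition ipR f g := wip (leb2 R) S fst f g.
Definition sqR f := wsq (leb2 R) S fst f.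

(** Indexing the four components by a natural number lets measurability, linearity and integrability
    be proved once for all [j]; the default 0 keeps these statements true beyond index 3. *)
Definition jetR k f (j : nat) : R * R -> R :=
  match j with
  | 0%N => f
  | 1%N => dzR f
  | 2%N => calDR k%:Z f
  | 3%N => calDR (- k%:Z) f
  | _ => fun=> 0
  end.

Lemma open_oo (a b : R) : open [set r : R | a < r < b].
Proof.
rewrite (_ : mkset _ = `]a, b[%classic); first exact: interval_open.
by apply/seteqP; split=> r /=; rewrite in_itv.
Qed.

Lemma eq_on_jetR U k f g j : open U -> eq_on U f g -> eq_on U (jetR k f j) (jetR k g j).
Proof.
move=> oU fg; case: j => [|[|[|[|j]]]] //=; first exact: eq_on_dzR.
- exact: eq_on_calDR.
- exact: eq_on_calDR.
Qed.

Lemma jetR_closed_strip k f g j : (forall x, closed_strip R x -> f x = g x) ->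
  forall x, S x -> jetR k f j x = jetR k g j x.
Proof.
move=> fg x Sx; apply: (@eq_on_jetR [set r : R | 0 < r < 1]) => //.
  exact: open_oo.
by move=> y /andP[/ltW y0 /ltW y1]; apply: fg; rewrite /closed_strip/= y0.
Qed.

Lemma jetR_lin k a b f g j : CinftyR k f -> CinftyR k g ->
  eq_on [set r | 0 < r] (jetR k (fun x => a * f x + b * g x) j)
    (fun x => a * jetR k f j x + b * jetR k g j x).
Proof.
move=> [[zf rf] _ _] [[zg rg] _ _].
have df := rf 0%N 0%N 0%N; have dg := rg 0%N 0%N 0%N.
case: j => [|[|[|[|j]]]] //=.
- exact: dzR_lin (zf 0%N) (zg 0%N).
- exact: (calDR_lin _ _ _ df dg).
- exact: (calDR_lin _ _ _ df dg).
- by move=> x _; rewrite !mulr0 addr0.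
Qed.

(** The first-order components are the derivatives with [p = 1], for [(i, n)] equal to [(0, 0)],
    [(1, 1)] and [(0, 1)]. So they stay continuous up to the axis in spite of their 1/r terms. *)
Lemma jetR_extension k f j : CinftyR k f ->
  exists2 E, {within half_plane R, continuous E} & eq_on [set r | 0 < r] E (jetR k f j).
Proof.
move=> [_ cf ef]; case: j => [|[|[|[|j]]]] /=.
- by exists f.
- by have [//|E [cE eE _]] := ef 0%N 0%N 1%N; exists E.
- have [//|E [cE eE _]] := ef 1%N 1%N 1%N; exists E => // x x0.
  by rewrite eE// /mixedDR/= subr0.
- have [//|E [cE eE _]] := ef 0%N 1%N 1%N; exists E => // x x0.
  by rewrite eE// /mixedDR/= subr0 sub0r.
- exists (fun=> 0) => //; apply: continuous_subspaceT => x; exact: cst_continuous.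
Qed.

Lemma measurable_eq_on_continuous f E : {within half_plane R, continuous E} ->
  eq_on [set r | 0 < r] E f -> measurable_fun S f.
Proof.
move=> cE Ef; apply: open_continuous_measurable_fun2; first exact: open_strip.
move=> x; rewrite inE => /strip_gt0 x0; apply: (eq_on_continuous Ef x0).
exact: within_half_plane_continuous.
Qed.

Lemma measurable_jetR k f j : CinftyR k f -> measurable_fun S (jetR k f j).
Proof. by move=> /(jetR_extension j)[E cE Ef]; exact: measurable_eq_on_continuous cE Ef. Qed.

Lemma jetR_supported k f j (M : R) : (forall x, 0 <= x.1 -> M < `|x.2| -> f x = 0) ->
  forall x, 0 < x.1 -> M < `|x.2| -> jetR k f j x = 0.
Proof.
move=> fM x x0 Mx.
have drf : drR f x = 0.
  rewrite /drR (near_derive1 (h' := fun=> 0)); first exact: derive1_cst.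
  by apply: filterS (lt_nbhsr x0) => r r0; apply: fM => //=; exact: ltW.
have f0 : f x = 0 by apply: fM => //; exact: ltW.
case: j => [|[|[|[|j]]]] //=.
- rewrite /dzR (near_derive1 (h' := fun=> 0)); first exact: derive1_cst.
  have nM : \forall z \near x.2, M < `|z| by exact: (cvgr_gt _ (@norm_continuous _ _ x.2)).
  by apply: filterS nM => z Mz; apply: fM => //=; exact: ltW.
- by rewrite /calDR drf f0 mulr0 addr0.
- by rewrite /calDR drf f0 mulr0 addr0.
Qed.

Lemma compact_box (a b c d : R) : compact (`[a, b] `*` `[c, d] : set (R * R)).
Proof. by apply: compact_setX; exact: segment_compact. Qed.

Lemma jetR_bounded k f j : CinftyR k f -> supported_in (half_plane R) f ->
  exists C M : R, [/\ 0 <= C, forall x, S x -> `|jetR k f j x| <= C &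
    forall x, S x -> M < `|x.2| -> jetR k f j x = 0].
Proof.
move=> hf sf; have [M fM] := supported_bounded sf.
have [E cE eE] := jetR_extension j hf.
have cb : compact (E @` (`[0, 1] `*` `[- M, M])).
  apply: continuous_compact; last exact: compact_box.
  by apply: continuous_subspaceW cE => x [/=]; rewrite in_itv/= => /andP[].
have [C [_ CP]] := compact_bounded cb.
have CE : C < Num.max (C + 1) 0 by rewrite lt_max ltrDl ltr01.
have := CP _ CE => {}CP.
have supp x : S x -> M < `|x.2| -> jetR k f j x = 0.
  by move=> /strip_gt0 x0; exact: jetR_supported fM _ x0.
exists (Num.max (C + 1) 0), M; split => //; first by rewrite le_max lexx orbT.
move=> x Sx; have [xM|xM] := leP `|x.2| M; last first.
  by rewrite supp// normr0 le_max lexx orbT.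
rewrite -eE; last exact: strip_gt0 Sx.
apply: CP; exists x => //; split; rewrite /= in_itv/=.
  by case/andP: Sx => /ltW -> /ltW ->.
by rewrite -ler_norml.
Qed.

Definition zbox (M : R) : set (MR * MR) := setT `*` `[- M, M].

Lemma zboxE M x : zbox M x = (`|x.2| <= M) :> Prop.
Proof. by rewrite /zbox/=; apply/propext; split=> [[_]|h]; rewrite ?in_itv/= -?ler_norml. Qed.

Lemma measurable_zbox M : measurable (zbox M).
Proof. by apply: measurableX. Qed.

Lemma integrable_zbox (C M : R) :
  (leb2 R).-integrable S (fun x => (C * \1_(zbox M) x)%:E).
Proof.
under eq_fun do rewrite EFinM.
apply: integrableZl; first exact: measurable_strip.
apply/integrableP; split.
  by apply/measurable_EFinP; apply: measurable_indic; exact: measurable_zbox.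
under eq_integral do rewrite gee0_abs ?lee_fin//.
rewrite integral_indic//=; [|exact: measurable_strip|exact: measurable_zbox].
rewrite (_ : _ `&` _ = (`]0, 1[ : set MR) `*` (`[- M, M] : set MR)); last first.
  apply/seteqP; split=> [[r z] [[_ /= zM]]|[r z] [/= r0 zM]].
    by rewrite /strip/= => ?; split => //=; rewrite in_itv.
  by split => //; rewrite /strip/=; rewrite in_itv in r0.
rewrite /leb2 product_measure1E//= !lebesgue_measure_itv/=.
by case: ifP => _; case: ifP => _; rewrite ?mule0 ?mul0e// -EFinD -?EFinB -EFinM ltry.
Qed.

Lemma bounded_L2R f (C M : R) : measurable_fun S f -> (forall x, S x -> `|f x| <= C) ->
  (forall x, S x -> M < `|x.2| -> f x = 0) -> L2R f.
Proof.
move=> mf fC fM; have mS := @measurable_strip R.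
apply: (wL2_integrable_lt mS measurable_fst_strip strip_gt0 mf).
apply: le_integrable (integrable_zbox (C ^+ 2) M) => //.
  exact: (wL2_measurable_sqr measurable_fst_strip mf).
move=> x Sx; rewrite !abse_EFin lee_fin.
have /andP[x0 x1] := Sx.
rewrite normrM normrX (gtr0_norm x0).
rewrite indicE; have [xM|xM] := boolP (x \in _).
  rewrite mulr1 [leRHS]ger0_norm ?sqr_ge0// -[leRHS]mulr1.
  apply: ler_pM; rewrite ?sqr_ge0//; last exact: ltW.
    exact: ltW.
  by rewrite ler_sqr ?nnegrE// ?fC// (le_trans _ (fC _ Sx)).
rewrite fM// ?normr0 ?expr0n/= ?mul0r//.
by move: xM; rewrite notin_setE zboxE ltNge => /negP.
Qed.

Lemma L2R_jetR k f j : CinftyR k f -> supported_in (half_plane R) f -> L2R (jetR k f j).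
Proof.
move=> hf sf; have [C [M [C0 fC fM]]] := jetR_bounded j hf sf.
exact: bounded_L2R (measurable_jetR j hf) fC fM.
Qed.

(** Common mechanism of the Poincare and Hardy inequalities: the correction [b] is the derivative of
    [B] and integrates to [B 1 - B 0 <= 0]. *)
Lemma le_integral_FTC (u v b B : R -> R) :
  {within `[0, 1], continuous u} -> {within `[0, 1], continuous v} ->
  {within `[0, 1], continuous b} -> derivable_oo_LRcontinuous B 0 1 ->
  {in `]0, 1[, derive1 B =1 b} -> B 1 <= B 0 ->
  (forall x, 0 < x < 1 -> u x <= v x + b x) ->
  (\int[mu]_(x in `]0%R, 1%R[) (u x)%:E <= \int[mu]_(x in `]0%R, 1%R[) (v x)%:E)%E.
Proof.
move=> cu cv cb dB Bb B10 uvb.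
have iu := continuous_integrable_itv cu; have iv := continuous_integrable_itv cv.
have ib := continuous_integrable_itv cb.
have sub01 : (`]0, 1[ : set R) `<=` `[0, 1] by exact: subset_itv_oo_cc.
have I01 (f : R -> R) : mu.-integrable `[0, 1] (EFin \o f) -> mu.-integrable `]0, 1[ (EFin \o f).
  by apply: integrableS.
apply: (@le_trans _ _ (\int[mu]_(x in `]0%R, 1%R[) ((v x)%:E + (b x)%:E))%E).
  apply: le_integral => //; [exact: I01|apply: integrableD => //; exact: I01|].
  by move=> x; rewrite inE/= in_itv/= => x01; rewrite -EFinD lee_fin uvb.
rewrite integralD//; [|exact: I01..].
have -> : (\int[mu]_(x in `]0%R, 1%R[) (b x)%:E = (B 1 - B 0)%:E)%E.
  rewrite EFinB -(continuous_FTC2 ltr01 cb dB Bb).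
  have mb : measurable_fun (`[0%R, 1%R]%classic : set MR) (fun x => (b x)%:E) by case/integrableP: ib.
  rewrite -[RHS]integral_itv_obnd_cbnd; last first.
    by apply: measurable_funS mb => //; exact: subset_itv_oc_cc.
  rewrite integral_itv_bndo_bndc//.
  by apply: measurable_funS mb.
by rewrite geeDl// lee_fin subr_le0.
Qed.

Lemma slice_continuous E (z : R) : {within half_plane R, continuous E} ->
  {within `[0, 1], continuous (fun r : R => E (r, z))}.
Proof.
move=> /within_continuousP cE.
apply/subspace_continuousP => r; rewrite /= in_itv/= => /andP[r0 r1].
have : (fun r' => (r', z)) @ within `[0, 1] (nbhs r) --> within (half_plane R) (nbhs (r, z)).
  move=> A [[P Q] [/= Pr Qz] PQ]; rewrite /= /within/=; apply: filterS Pr => r' Pr'.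
  rewrite in_itv/= => /andP[r'0 _]; apply: (PQ (r', z)) => //; split => //=.
  exact: nbhs_singleton Qz.
by move=> /cvg_comp; apply; exact: (cE (r, z)).
Qed.

Lemma derivable_oo_is_derive (B b : R -> R) :
  {within `[0, 1], continuous B} -> (forall x : R, 0 < x < 1 -> is_derive x 1 B (b x)) ->
  derivable_oo_LRcontinuous B 0 1.
Proof.
move=> cB dB.
have [_ cB0 cB1] := (continuous_within_itvP B (@ltr01 R)).1 cB.
split => // x; rewrite in_itv/= => x01.
by have [] := dB x x01.
Qed.

(* [d/dr (r^2 f^2) = 2 r f^2 + 2 r^2 f f'] integrates to [0], so the second term
   controls the first one. *)
Lemma poincare_slice k f (z : R) : CinftyR k f -> f (1, z) = 0 ->
  (\int[mu]_(r in `]0%R, 1%R[) (f (r, z) ^+ 2 * r)%:E <=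
   \int[mu]_(r in `]0%R, 1%R[)
     ((2^-1 * jetR k f 2 (r, z) ^+ 2 + 2^-1 * jetR k f 3 (r, z) ^+ 2) * r)%:E)%E.
Proof.
move=> hf f1; have [[_ rf] cf _] := hf.
have [E2 cE2 E2f] := jetR_extension 2 hf.
have [E3 cE3 E3f] := jetR_extension 3 hf.
have c0 := @slice_continuous f z cf.
have c2 := @slice_continuous E2 z cE2; have c3 := @slice_continuous E3 z cE3.
(* Since $D_k + D_{-k} = 2\,d/dr$, half the sum of the two extensions is the r-derivative for r > 0,
   in a form continuous up to the axis. *)
pose p r := 2^-1 * (E2 (r, z) + E3 (r, z)).
have dfr (r : R) : 0 < r -> is_derive r 1 (fun r => f (r, z)) (p r).
  move=> r0; apply: (is_derive_ext (derivable_is_derive1 (rf 0%N 0%N 0%N (r, z) r0))) => //.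
  rewrite /p E2f// E3f//= /calDR /drR/= mulrNz; field; by rewrite gt_eqF.
rewrite [leRHS](_ : _ = \int[mu]_(r in `]0%R, 1%R[) ((2^-1 * E2 (r, z) ^+ 2 + 2^-1 * E3 (r, z) ^+ 2) * r)%:E)%E; last first.
  by apply: eq_integral => r; rewrite inE/= in_itv/= => /andP[r0 _]; rewrite E2f ?E3f.
pose b r := 2 * r * f (r, z) ^+ 2 + r ^+ 2 * (2 * f (r, z) * p r).
have dB (r : R) : 0 < r -> is_derive r 1 (fun r => (r * f (r, z)) * (r * f (r, z))) (b r).
  move=> r0; have d1 := is_deriveM (is_derive_id r 1) (dfr _ r0).
  apply: (is_derive_ext (is_deriveM d1 d1)) => //.
  change ((r * f (r, z)) * (r * p r + f (r, z) * 1) + (r * f (r, z)) * (r * p r + f (r, z) * 1) = b r).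
  by rewrite /b; ring.
have c0' : cont01 (fun r => f (r, z)) by exact: c0.
have c2' : cont01 (fun r => E2 (r, z)) by exact: c2.
have c3' : cont01 (fun r => E3 (r, z)) by exact: c3.
apply: (le_integral_FTC (u := fun r => f (r, z) ^+ 2 * r)
  (v := fun r => (2^-1 * E2 (r, z) ^+ 2 + 2^-1 * E3 (r, z) ^+ 2) * r) (b := b)
  (B := fun r => (r * f (r, z)) * (r * f (r, z)))).
- by rewrite -/(cont01 _); prove_cont01.
- by rewrite -/(cont01 _); prove_cont01.
- by rewrite -/(cont01 _) /b /p; prove_cont01.
- apply: (@derivable_oo_is_derive _ b); first by rewrite -/(cont01 _); prove_cont01.
  by move=> r /andP[r0 _]; exact: dB.
- by move=> r; rewrite in_itv/= => /andP[r0 _]; apply: is_derive_derive1; exact: dB.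
- by rewrite f1 !mulr0 !mul0r.
- move=> r /andP[r0 r1]; rewrite /b /p.
  set a := f (r, z); set e2 := E2 (r, z); set e3 := E3 (r, z).
  suff : 0 <= r * (a ^+ 2 + 2^-1 * e2 ^+ 2 + 2^-1 * e3 ^+ 2 + r * a * (e2 + e3)).
    set X := _ * (_ + _); move=> X0; rewrite -subr_ge0.
    suff -> : (2^-1 * e2 ^+ 2 + 2^-1 * e3 ^+ 2) * r + (2 * r * a ^+ 2 +
      r ^+ 2 * (2 * a * (2^-1 * (e2 + e3)))) - a ^+ 2 * r = X by [].
    by rewrite /X; field.
  apply: mulr_ge0; first exact: ltW.
  (* Completing both squares uses up [r ^+ 2 * a ^+ 2] of the term [a ^+ 2]; the rest is nonnegative
     because r < 1. *)
  rewrite (_ : _ + _ = 2^-1 * (r * a + e2) ^+ 2 + 2^-1 * (r * a + e3) ^+ 2 +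
    (1 - r ^+ 2) * a ^+ 2); last by field.
  rewrite addr_ge0//; first by rewrite addr_ge0// mulr_ge0// sqr_ge0.
  by rewrite mulr_ge0 ?sqr_ge0// subr_ge0 exprn_ile1// ltW.
Qed.

Lemma measurable_weighted f : measurable_fun S f ->
  measurable_fun S (fun x => (f x * x.1)%:E).
Proof.
by move=> mf; apply/measurable_EFinP/measurable_funM => //; exact: measurable_fst_strip.
Qed.

Lemma sqRE f : L2R f -> (sqR f)%:E = (\int[leb2 R]_(x in S) (f x ^+ 2 * x.1)%:E)%E.
Proof. by move=> Lf; apply: wsqE => //; [exact: measurable_strip|exact: measurable_fst_strip|exact: strip_gt0]. Qed.

Lemma poincareR k f : CinftyR k f -> supported_in (half_plane R) f ->
  (forall z, f (1, z) = 0) ->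
  sqR f <= 2^-1 * sqR (jetR k f 2) + 2^-1 * sqR (jetR k f 3).
Proof.
move=> hf sf f1; have L j := L2R_jetR j hf sf; have mj j := measurable_jetR j hf.
have h0 g : forall x, S x -> (0 <= (g x ^+ 2 * x.1)%:E)%E.
  by move=> x /strip_gt0/ltW x0; rewrite lee_fin mulr_ge0 ?sqr_ge0.
have mm g : measurable_fun S g -> measurable_fun S (fun x => (g x ^+ 2 * x.1)%:E).
  by move=> mg; apply: measurable_weighted; exact: measurable_funX.
have mS := @measurable_strip R.
rewrite -lee_fin EFinD !EFinM !sqRE//; last exact: (L 0%N).
have mm2 j : measurable_fun S (fun x => (2^-1)%:E * (jetR k f j x ^+ 2 * x.1)%:E)%E.
  by apply: measurable_funeM; exact: mm.
have hh2 j x : S x -> (0 <= (2^-1)%:E * (jetR k f j x ^+ 2 * x.1)%:E)%E.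
  by move=> Sx; apply: mule_ge0; [rewrite lee_fin|exact: h0].
rewrite -!ge0_integralZl//; [|exact: mm..|exact: h0|exact: mm|exact: h0].
rewrite -ge0_integralD//; try solve [exact: hh2|exact: mm2].
apply: le_integral_strip => //.
- by apply: mm; exact: (mj 0%N).
- by apply: emeasurable_funD; exact: mm2.
- by move=> x; exact: h0.
- by move=> x Sx; apply: adde_ge0; exact: hh2.
- move=> z; apply: le_trans (poincare_slice hf (f1 z)) _.
  rewrite le_eqVlt; apply/orP; left; apply/eqP; apply: eq_integral => r _.
  by rewrite -!EFinM -EFinD mulrDl !mulrA.
Qed.

End real_jets.

(** * Lifting boundary data *)

Section bdlift.
Context {R : realType}.
Local Notation MR := (measurableTypeR R).
Local Notation mu := (@lebesgue_measure R).
Local Notation S := (strip R : set (MR * MR)).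
Implicit Types (f g E F : R * R -> R) (G : R -> R) (k : nat).

(** It vanishes for r < 1/3, which secures the conditions on the axis and bounds 1/r by 3 on its
    support; it is 1 for 2/3 <= r <= 4/3, hence leaves the trace unchanged, and it vanishes for r >
    2, so that the lift has compact support in the half plane. *)
Definition cutL (r : R) : R := step (3 * r + -1) * step (-3 * r + 5).

Lemma smooth_cutL : smooth cutL.
Proof.
by move=> n; apply: nderivableM; apply: nderivable_affine; exact: smooth_step.
Qed.

Lemma cutL_eq0 r : r < 3^-1 -> cutL r = 0.
Proof. by move=> r3; rewrite /cutL step_eq0 ?mul0r//; lra. Qed.

Lemma cutL_eq0r r : 2 < r -> cutL r = 0.
Proof. by move=> r3; rewrite /cutL mulrC step_eq0 ?mul0r//; lra. Qed.

Lemma cutL1 : cutL 1 = 1.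
Proof. by rewrite /cutL !step_eq1 ?mulr1//; lra. Qed.

Lemma cutL_ge0 r : 0 <= cutL r.
Proof. by rewrite mulr_ge0 ?step_ge0. Qed.

Lemma cutL_le1 r : cutL r <= 1.
Proof. by rewrite -[leRHS]mulr1 ler_pM ?step_ge0 ?step_le1. Qed.

(* The gradient of the average is bounded by difference quotients of [G], whose [L^2]
   norm over the strip is the Gagliardo seminorm; this replaces an extension by a
   Fourier multiplier. *)
Definition bdlift G (x : R * R) : R := cutL x.1 * avg 0 G (x.1 - 1) x.2.

Lemma avg0_0 G z : avg 0 G 0 z = G z.
Proof.
rewrite /avg; rewrite (@eq_Rintegral _ _ _ mu _ (fun=> G z)); last first.
  by move=> t _; rewrite mul0r addr0 expr0 mul1r.
by rewrite Rintegral_cst//= lebesgue_measure_itv/= lte_fin ltr01 oppr0 adde0 mulr1.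
Qed.

Lemma lift_trace G z : bdlift G (1, z) = G z.
Proof. by rewrite /bdlift/= cutL1 subrr avg0_0 mul1r. Qed.

Lemma CinftyR_liftG k G : csmooth G -> CinftyR k (bdlift G).
Proof.
move=> cG; apply: (@CinftyR_lift _ _ 3^-1) => //; first exact: smooth_cutL.
exact: cutL_eq0.
Qed.

Lemma supported_lift G : csmooth G -> supported_in (half_plane R) (bdlift G).
Proof.
move=> [_ [M GM]]; exists (`[0, 2] `*` `[- (M + 1), M + 1]); split.
- exact: compact_box.
- by move=> x [/=]; rewrite in_itv/= => /andP[].
- move=> [r z]; rewrite /half_plane/= => r0 nK; rewrite /bdlift/=.
  have [r2|r2] := ltP 2 r; first by rewrite cutL_eq0r ?mul0r.
  have zM : M + 1 < `|z|.
    rewrite ltNge; apply/negP => zM; apply: nK; split; rewrite /= in_itv/=.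
      by rewrite r0 r2.
    by rewrite -ler_norml.
  rewrite /avg; rewrite (@eq_Rintegral _ _ _ mu _ (fun=> 0)).
    by rewrite Rintegral_cst//= mul0r mulr0.
  move=> t; rewrite inE/= in_itv/= => /andP[t0 t1].
  rewrite GM ?mulr0//.
  have := ler_normD (z + (r - 1) * t) (- ((r - 1) * t)); rewrite addrK normrN => h.
  have : `|(r - 1) * t| <= 1.
    rewrite normrM -[leRHS]mulr1; apply: ler_pM => //; last by rewrite ger0_norm.
    by rewrite ler_norml; apply/andP; split; lra.
  by lra.
Qed.

(* With [h = r - 1], these are [(G (z + h) - G z) / h] and [(avg 0 G h z - G z) / h]. *)
Definition quot G (x : R * R) : R := avg 0 (derive1 G) (x.1 - 1) x.2.
Definition rem G (x : R * R) : R := quot G x - avg 1 (derive1 G) (x.1 - 1) x.2.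

Lemma avg0_rem G (x : R * R) : csmooth G ->
  avg 0 G (x.1 - 1) x.2 = G x.2 + (x.1 - 1) * rem G x.
Proof.
move=> cG; rewrite /rem /quot mulrBr avg0_derive1// avg1_derive1//.
by ring.
Qed.

Lemma quotE G (x : R * R) : csmooth G -> x.1 != 1 ->
  quot G x = (G (x.2 + (x.1 - 1)) - G x.2) / (x.1 - 1).
Proof.
move=> cG x1; rewrite -avg0_derive1// mulrAC mulfV ?mul1r//.
by rewrite subr_eq0.
Qed.

Lemma is_derive_avg_r b G (x : R * R) : csmooth G ->
  is_derive x.1 1 (fun r => avg b G (r - 1) x.2) (avg b.+1 (derive1 G) (x.1 - 1) x.2).
Proof.
move=> cG; have := @is_derive_affine R (fun h => avg b G h x.2) 1 (-1) x.1 _ (is_derive_avg_h b _ _ cG).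
by rewrite !mul1r => /is_derive_ext; apply => // y; rewrite mul1r.
Qed.

(** With h = r - 1, g = [G x.2], q = [quot G x] and s = [rem G x], the average is g + h s, its
    z-derivative is q and its r-derivative is q - s. Since |h| <= 1 and [cutL] lies between 0 and 1,
    everything is bounded by the squares of g, q and s, uniformly in [G]. *)
Lemma lift_jets_bounded k : exists2 C : R, 0 <= C &
  forall G j x, csmooth G -> S x ->
    jetR k (bdlift G) j x ^+ 2 <= C * (G x.2 ^+ 2 + quot G x ^+ 2 + rem G x ^+ 2).
Proof.
have ccut : {within `[0, 1], continuous (fun r => `|derive1 cutL r|)}.
  apply: continuous_subspaceT => r; apply: continuous_comp; last exact: norm_continuous.
  by apply: smooth_continuous; apply: smooth_derive1; exact: smooth_cutL.
have [c _ cP] := EVT_max (@ler01 R) ccut.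
(* [c1] bounds the factor of the average in $D_{\pm k}$ of the lift: the derivative of the cutoff
   plus k / r, with 1/r <= 3 wherever the cutoff is nonzero. *)
pose c1 := `|derive1 cutL c| + 3 * k%:R.
have c10 : 0 <= c1 by rewrite addr_ge0// mulr_ge0.
exists (4 * c1 ^+ 2 + 4); first by rewrite addr_ge0// mulr_ge0// sqr_ge0.
move=> G j x cG Sx; have /andP[x0 x1] := Sx.
set q := quot G x; set s := rem G x; set g := G x.2.
set Phi := avg 0 G (x.1 - 1) x.2; set p := avg 1 (derive1 G) (x.1 - 1) x.2.
have Phi2 : Phi ^+ 2 <= 2 * g ^+ 2 + 2 * s ^+ 2.
  rewrite /Phi avg0_rem// -/g -/s; set h := x.1 - 1.
  have : 0 <= (g - h * s) ^+ 2 by exact: sqr_ge0.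
  have : (h * s) ^+ 2 <= s ^+ 2.
    by rewrite exprMn ler_piMl ?sqr_ge0// -real_normK ?num_real// exprn_ile1// /h ler_norml; lra.
  move=> h1 h2; rewrite -subr_ge0 (_ : _ - _ = (g - h * s) ^+ 2 + 2 * (s ^+ 2 - (h * s) ^+ 2)); last by ring.
  by rewrite addr_ge0// mulr_ge0// subr_ge0.
have p2 : p ^+ 2 <= 2 * q ^+ 2 + 2 * s ^+ 2.
  have -> : p = q - s by rewrite /s /rem opprB addrC subrK.
  have : 0 <= (q + s) ^+ 2 by exact: sqr_ge0.
  move=> h1; rewrite -subr_ge0 (_ : _ - _ = (q + s) ^+ 2) //; by ring.
have g0 := sqr_ge0 g; have q0 := sqr_ge0 q; have s0 := sqr_ge0 s.
have cc0 := sqr_ge0 c1.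
have T0 : 0 <= g ^+ 2 + q ^+ 2 + s ^+ 2 by rewrite !addr_ge0.
have cut0 := cutL_ge0 x.1; have cut1 := cutL_le1 x.1.
have cut2 y : (cutL x.1 * y) ^+ 2 <= y ^+ 2.
  by rewrite exprMn ler_piMl ?sqr_ge0// exprn_ile1.
have DrE : drR (bdlift G) x = cutL x.1 * p + Phi * derive1 cutL x.1.
  apply: is_derive_derive1.
  exact: (is_deriveM (smooth_is_derive x.1 smooth_cutL) (is_derive_avg_r 0 x cG)).
have cD : `|derive1 cutL x.1| <= `|derive1 cutL c|.
  by apply: cP; rewrite in_itv/= !ltW.
have key (e : int) : `|e%:~R| <= k%:R :> R ->
    (drR (bdlift G) x + e%:~R / x.1 * bdlift G x) ^+ 2 <= (4 * c1 ^+ 2 + 4) * (g ^+ 2 + q ^+ 2 + s ^+ 2).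
  move=> ek; rewrite DrE /bdlift -/Phi.
  pose d : R := derive1 cutL x.1 + e%:~R / x.1 * cutL x.1.
  have dc : `|d| <= c1.
    apply: le_trans (ler_normD _ _) _; rewrite lerD//.
    have [x3|x3] := ltP x.1 3^-1; first by rewrite cutL_eq0// mulr0 normr0 mulr_ge0.
    rewrite normrM (ger0_norm cut0) normrM normfV (gtr0_norm x0).
    have i0 : 0 <= x.1^-1 by rewrite invr_ge0 ltW.
    have i3 : x.1^-1 <= 3 by rewrite -[leRHS]invrK lef_pV2 ?posrE// invr_gt0.
    have e0 := normr_ge0 (e%:~R : R).
    rewrite -[leRHS]mulr1; apply: ler_pM => //; first by rewrite mulr_ge0.
    by rewrite mulrC; apply: ler_pM.
  have -> : cutL x.1 * p + Phi * derive1 cutL x.1 + e%:~R / x.1 * (cutL x.1 * Phi) = cutL x.1 * p + d * Phi.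
    by rewrite mulrA -addrA (mulrC Phi) -mulrDl.
  have h1 : (d * Phi) ^+ 2 <= c1 ^+ 2 * Phi ^+ 2.
    by rewrite exprMn ler_wpM2r ?sqr_ge0// -[d ^+ 2]real_normK ?num_real// lerXn2r ?nnegrE.
  have h2 := cut2 p.
  have h3 : 0 <= (cutL x.1 * p - d * Phi) ^+ 2 by exact: sqr_ge0.
  apply: (@le_trans _ _ (2 * p ^+ 2 + 2 * (c1 ^+ 2 * Phi ^+ 2))).
    rewrite -subr_ge0; set A := cutL x.1 * p in h2 h3 *; set B := d * Phi in h1 h3 *.
    rewrite (_ : _ - _ = (A - B) ^+ 2 + 2 * (p ^+ 2 - A ^+ 2) + 2 * (c1 ^+ 2 * Phi ^+ 2 - B ^+ 2)); last by ring.
    by rewrite !addr_ge0// mulr_ge0// subr_ge0.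
  apply: (@le_trans _ _ (2 * (2 * q ^+ 2 + 2 * s ^+ 2) + 2 * (c1 ^+ 2 * (2 * g ^+ 2 + 2 * s ^+ 2)))).
    by rewrite lerD// ler_pM2l// ler_wpM2l.
  rewrite -subr_ge0 (_ : _ - _ = 4 * c1 ^+ 2 * q ^+ 2 + 4 * g ^+ 2); last by ring.
  by rewrite addr_ge0// mulr_ge0// mulr_ge0.
have C1 y : y <= 2 * (g ^+ 2 + q ^+ 2 + s ^+ 2) -> y <= (4 * c1 ^+ 2 + 4) * (g ^+ 2 + q ^+ 2 + s ^+ 2).
  move=> /le_trans; apply; rewrite ler_wpM2r//.
  by rewrite -subr_ge0 (_ : _ - _ = 4 * c1 ^+ 2 + 2); [rewrite addr_ge0// mulr_ge0|ring].
case: j => [|[|[|[|j]]]] /=.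
- by apply: C1; apply: le_trans (cut2 _) _; apply: (le_trans Phi2); rewrite -mulrDr ler_pM2l// addrAC lerDl.
- apply: C1; have -> : dzR (bdlift G) x = cutL x.1 * q.
    apply: is_derive_derive1.
    exact: (is_deriveZ (cutL x.1) (is_derive_avg_z 0 (x.1 - 1) x.2 cG)).
  apply: le_trans (cut2 _) _; rewrite -[leLHS]mul1r; apply: ler_pM => //; rewrite ?ler1n//.
  by rewrite addrAC lerDr addr_ge0.
- by apply: key; rewrite ger0_norm.
- by apply: key; rewrite mulrNz normrN ger0_norm.
- by rewrite expr0n/= mulr_ge0// addr_ge0// mulr_ge0.
Qed.

(* With [s = rem G] and [h = r - 1], the derivative of [- h s^2] is [3 s^2 - 2 s q];
   this is a Hardy inequality. *)
Lemma hardy_slice G (z : R) : csmooth G ->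
  (\int[mu]_(r in `]0%R, 1%R[) (rem G (r, z) ^+ 2)%:E <=
   \int[mu]_(r in `]0%R, 1%R[) (quot G (r, z) ^+ 2)%:E)%E.
Proof.
move=> cG; have cG' := csmooth_derive1 cG; have cG'' := csmooth_derive1 cG'.
have sl f : continuous f -> cont01 (fun r => f (r, z)).
  by move=> cf; apply: slice_continuous; exact: continuous_subspaceT.
have ca b H : csmooth H -> cont01 (fun r => avg b H (r - 1) z).
  by move=> cH; apply: (sl (fun x => avg b H (x.1 - 1) x.2)); exact: continuous_avg.
pose s r := rem G (r, z); pose q r := quot G (r, z).
have c_q : cont01 q by exact: ca.
have c_p : cont01 (fun r => avg 1 (derive1 G) (r - 1) z) by exact: ca.
have c_s : cont01 s by rewrite /s /rem; prove_cont01.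
pose p r := avg 1 (derive1 G) (r - 1) z.
pose sg r := avg 1 (derive1 (derive1 G)) (r - 1) z - avg 2 (derive1 (derive1 G)) (r - 1) z.
have ds (r : R) : is_derive r 1 s (sg r).
  exact: (is_deriveB (is_derive_avg_r 0 (r, z) cG') (is_derive_avg_r 1 (r, z) cG')).
pose e r := avg 0 G (r - 1) z - G z.
have eE r : e r = (r - 1) * s r by rewrite /e (@avg0_rem G (r, z))//= addrC addKr.
have de (r : R) : is_derive r 1 e (p r).
  have := is_deriveB (is_derive_avg_r 0 (r, z) cG) (is_derive_const (G z) r).
  by move=> /is_derive_ext; apply => //; rewrite subr0.
(* Differentiating [e = (r - 1) * s] in two ways gives this identity at every r, with no division at
   r = 1. *)
have sgE r : (r - 1) * sg r = p r - s r.
  have d1 : is_derive r 1 e ((r - 1) * sg r + s r).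
    have dr1 : is_derive r 1 (fun r => r - 1) 1.
      by apply: (is_derive_ext (is_deriveB (is_derive_id r 1) (is_derive_const 1 r))) => //; rewrite subr0.
    apply: (is_derive_ext (is_deriveM dr1 (ds r))) => [y|]; first by rewrite eE.
    change ((r - 1) * sg r + s r * 1 = (r - 1) * sg r + s r).
    by rewrite mulr1.
  have := is_derive_derive1 d1; rewrite (is_derive_derive1 (de r)) => ->.
  by rewrite addrK.
have pqs r : p r = q r - s r by rewrite /s /rem opprB addrC subrK.
pose b r := 3 * s r ^+ 2 - 2 * s r * q r.
have dB (r : R) : is_derive r 1 (fun r => - (e r * s r)) (b r).
  apply: (is_derive_ext (is_deriveN (is_deriveM (de r) (ds r)))) => //.
  change (- (e r * sg r + s r * p r) = b r).
  rewrite eE mulrAC sgE pqs /b; ring.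
have : (\int[mu]_(r in `]0%R, 1%R[) (2 * s r ^+ 2)%:E <=
   \int[mu]_(r in `]0%R, 1%R[) (q r ^+ 2)%:E)%E.
  have c_e : cont01 e by rewrite /e; apply: cont01D; [exact: ca|exact: cont01_cst].
  apply: (le_integral_FTC (u := fun r => 2 * s r ^+ 2) (v := fun r => q r ^+ 2)
    (b := b) (B := fun r => - (e r * s r))).
  - by rewrite -/(cont01 _); prove_cont01.
  - by rewrite -/(cont01 _); prove_cont01.
  - by rewrite -/(cont01 _) /b; prove_cont01.
  - apply: (@derivable_oo_is_derive _ _ b); first by rewrite -/(cont01 _); prove_cont01.
  - by move=> r _; apply: is_derive_derive1; exact: dB.
  (* [B] is [(1 - r) * s ^+ 2]: it vanishes at r = 1 and equals [s 0 ^+ 2] at r = 0. *)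
  - rewrite !eE subrr sub0r mul0r mul0r oppr0 mulN1r mulNr opprK -expr2 sqr_ge0//.
  - move=> r _; rewrite /b -subr_ge0.
    by rewrite (_ : _ - _ = (q r - s r) ^+ 2); [exact: sqr_ge0|ring].
apply: le_trans; apply: ge0_le_integral => //.
- by move=> r _; rewrite lee_fin sqr_ge0.
- have [+ _] := integrableP _ _ _ (continuous_integrable_itv (cont01X2 c_s)).
  by apply: measurable_funS => //; exact: subset_itv_oo_cc.
- have c2 : cont01 (fun r => 2 * s r ^+ 2) by prove_cont01.
  have [+ _] := integrableP _ _ _ (continuous_integrable_itv c2).
  by apply: measurable_funS => //; exact: subset_itv_oo_cc.
- by move=> r _; rewrite lee_fin ler_peMl ?sqr_ge0//; lra.
Qed.

Definition H12sqR (g : R -> R) : \bar R :=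
  (\int[leb R]_x (g x ^+ 2)%:E +
   \int[leb2 R]_x ((g x.1 - g x.2) ^+ 2 / (x.1 - x.2) ^+ 2)%:E)%E.

Lemma measurable_inv : measurable_fun setT (fun x : MR => x^-1 : MR).
Proof.
have oN0 : open [set x : R | x != 0].
  rewrite openE => x /= x0; exact: open_neq.
have mN0 : measurable ([set x : R | x != 0] : set MR) by exact: open_measurable.
rewrite (_ : setT = [set x : R | x != 0] `|` [set 0]); last first.
  by apply/seteqP; split=> // x _ /=; have [->|] := eqVneq x 0; [right|left].
apply/measurable_funU => //; split; last exact: measurable_fun_set1.
apply: open_continuous_measurable_fun => //.
by move=> x; rewrite inE/= => x0; exact: inv_continuous.
Qed.

Definition gagl (g : R -> R) (x : MR * MR) : \bar R :=
  ((g x.1 - g x.2) ^+ 2 / (x.1 - x.2) ^+ 2)%:E.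

Lemma gagl_ge0 (g : R -> R) x : (0 <= gagl g x)%E.
Proof. by rewrite lee_fin mulr_ge0 ?invr_ge0 ?sqr_ge0. Qed.

Lemma measurable_gagl (g : MR -> MR) : measurable_fun setT g -> measurable_fun setT (gagl g).
Proof.
move=> mg; apply/measurable_EFinP; apply: measurable_funM.
  by apply: measurable_funX; apply: measurable_funB; apply: (measurableT_comp mg).
have m2 : measurable_fun setT (fun x : MR * MR => (x.1 - x.2) ^+ 2 : MR).
  by apply: measurable_funX; apply: measurable_funB.
exact: (measurableT_comp measurable_inv m2).
Qed.

Lemma continuous_quot G : csmooth G -> continuous (quot G).
Proof.
by move=> cG; apply: (@continuous_avg _ 0); exact: csmooth_derive1.
Qed.

Lemma continuous_rem G : csmooth G -> continuous (rem G).
Proof.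
move=> cG x; apply: cvgB; first exact: continuous_quot.
by apply: (@continuous_avg _ 1); exact: csmooth_derive1.
Qed.

Lemma measurable_cont_strip f : continuous f -> measurable_fun S f.
Proof.
by move=> cf; apply: open_continuous_measurable_fun2; [exact: open_strip|move=> x _; exact: cf].
Qed.

Lemma measurable_sqr_strip f : measurable_fun S f -> measurable_fun S (fun x => (f x ^+ 2)%:E).
Proof. by move=> mf; apply/measurable_EFinP; exact: measurable_funX. Qed.

(** For fixed z, the substitution y = z + r - 1 carries 0 < r < 1 onto the interval from z - 1 to z
    and turns [quot G] squared into the Gagliardo integrand at (y, z). The strip thus sees part of
    the double integral. *)
Lemma le_quot_gagliardo G : csmooth G ->
  (\int[leb2 R]_(x in S) (quot G x ^+ 2)%:E <= \int[leb2 R]_x gagl G x)%E.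
Proof.
move=> cG.
have mq : measurable_fun S (fun x => (quot G x ^+ 2)%:E).
  by apply: measurable_sqr_strip; apply: measurable_cont_strip; exact: continuous_quot.
have q0 x : S x -> (0 <= (quot G x ^+ 2)%:E)%E by rewrite lee_fin sqr_ge0.
have mG : measurable_fun setT (G : MR -> MR).
  by apply: continuous_measurable_fun; exact: csmooth_continuous.
have mg := measurable_gagl mG.
rewrite integral_strip// (fubini_tonelli2 _ mg (gagl_ge0 G)).
apply: ge0_le_integral => //.
- by move=> z _; apply: integral_ge0 => r _; rewrite lee_fin sqr_ge0.
- rewrite -(fubini_G_strip (fun x => (quot G x ^+ 2)%:E)).
  apply: measurable_fun_fubini_tonelli_G; first exact: measurable_strip_restrict.
  by move=> x; exact: erestrict_ge0.
- exact: measurable_fun_fubini_tonelli_G mg (gagl_ge0 G).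
move=> z _; rewrite /fubini_G.
have mz : measurable_fun setT (fun y : MR => gagl G (y, z)) by exact: measurableT_comp mg _.
rewrite -(lebesgue_shift (z - 1) mz); last by move=> y; exact: gagl_ge0.
rewrite [leLHS](_ : _ = \int[mu]_(r in `]0%R, 1%R[) gagl G ((r + (z - 1))%R, z))%E; last first.
  apply: eq_integral => r; rewrite inE/= in_itv/= => /andP[r0 r1].
  rewrite quotE//=; last by rewrite lt_eqF.
  rewrite /gagl/= expr_div_n; congr ((_ / _)%:E).
    by rewrite addrCA.
  by rewrite -addrA [_ - 1 - _]addrAC subrr add0r.
apply: ge0_subset_integral => //; last by move=> r _; exact: gagl_ge0.
apply: (measurableT_comp mz); exact: measurable_funD.
Qed.

Lemma integral_strip_snd G : csmooth G ->
  (\int[leb2 R]_(x in S) (G x.2 ^+ 2)%:E = \int[leb R]_z (G z ^+ 2)%:E)%E.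
Proof.
move=> cG; rewrite integral_strip//.
- apply: eq_integral => z _.
  transitivity (\int[mu]_(r in `]0%R, 1%R[) cst (G z ^+ 2)%:E r)%E => //.
  rewrite integral_cst//= lebesgue_measure_itv/= lte_fin ltr01.
  by rewrite oppr0 adde0 mule1.
- apply: measurable_sqr_strip; apply: measurable_cont_strip => x.
  by apply: continuous_comp; [exact: cvg_snd|exact: csmooth_continuous].
- by move=> x _; rewrite lee_fin sqr_ge0.
Qed.

Lemma le_rem_quot G : csmooth G ->
  (\int[leb2 R]_(x in S) (rem G x ^+ 2)%:E <= \int[leb2 R]_(x in S) (quot G x ^+ 2)%:E)%E.
Proof.
move=> cG; apply: le_integral_strip => //.
- by apply: measurable_sqr_strip; apply: measurable_cont_strip; exact: continuous_rem.
- by apply: measurable_sqr_strip; apply: measurable_cont_strip; exact: continuous_quot.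
- by move=> x _; rewrite lee_fin sqr_ge0.
- by move=> x _; rewrite lee_fin sqr_ge0.
- by move=> z; exact: hardy_slice.
Qed.

(** The weight r is at most 1 and is dropped. The three terms of the pointwise bound then integrate
    to the squared $L^2$ norm [A], at most the seminorm [B], and by Hardy at most [B] again;
    [A + B + B] is at most twice [A + B]. *)
Lemma lift_bound k : exists2 C : R, 0 <= C &
  forall G j, csmooth G -> ((sqR (jetR k (bdlift G) j))%:E <= C%:E * H12sqR G)%E.
Proof.
have [C C0 hC] := lift_jets_bounded k.
exists (2 * C) => [|G j cG]; first by rewrite mulr_ge0.
have hf := CinftyR_liftG k cG; have sf := supported_lift cG.
rewrite sqRE; last exact: L2R_jetR.
have mS := @measurable_strip R.
have mq : measurable_fun S (fun x => (quot G x ^+ 2)%:E).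
  by apply: measurable_sqr_strip; apply: measurable_cont_strip; exact: continuous_quot.
have mr : measurable_fun S (fun x => (rem G x ^+ 2)%:E).
  by apply: measurable_sqr_strip; apply: measurable_cont_strip; exact: continuous_rem.
have mg : measurable_fun S (fun x : MR * MR => (G x.2 ^+ 2)%:E).
  apply: measurable_sqr_strip; apply: measurable_cont_strip => x.
  by apply: continuous_comp; [exact: cvg_snd|exact: csmooth_continuous].
have n0 (h : R * R -> R) x : S x -> (0 <= (h x ^+ 2)%:E)%E by rewrite lee_fin sqr_ge0.
pose T x := ((G x.2 ^+ 2)%:E + (quot G x ^+ 2)%:E + (rem G x ^+ 2)%:E)%E.
have mT : measurable_fun S T by apply: emeasurable_funD => //; exact: emeasurable_funD.
have T0 x : S x -> (0 <= T x)%E by move=> Sx; apply: adde_ge0; [apply: adde_ge0; [exact: (n0 (fun x => G x.2))|exact: n0]|exact: n0].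
apply: (@le_trans _ _ (\int[leb2 R]_(x in S) (C%:E * T x))%E).
  apply: ge0_le_integral => //.
  - by move=> x /strip_gt0/ltW x0; rewrite lee_fin mulr_ge0 ?sqr_ge0.
  - apply: measurable_weighted; apply: measurable_funX; exact: measurable_jetR.
  - exact: measurable_funeM.
  - move=> x Sx; rewrite /T -!EFinD -EFinM lee_fin.
    apply: le_trans (hC G j x cG Sx).
    have /andP[x0 /ltW x1] := Sx.
    by rewrite ler_piMr ?sqr_ge0.
rewrite ge0_integralZl// mulrC EFinM -muleA; apply: lee_wpmul2l; first by rewrite lee_fin.
have n1 x : S x -> (0 <= (G x.2 ^+ 2)%:E + (quot G x ^+ 2)%:E)%E.
  by move=> Sx; apply: adde_ge0; [exact: (n0 (fun x => G x.2))|exact: n0].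
have m1 : measurable_fun S (fun x : MR * MR => (G x.2 ^+ 2)%:E + (quot G x ^+ 2)%:E)%E.
  exact: emeasurable_funD.
have nG := n0 (fun x => G x.2); have nq := n0 (quot G); have nr := n0 (rem G).
rewrite /T ge0_integralD// ge0_integralD// (integral_strip_snd cG).
pose A := (\int[leb R]_x (G x ^+ 2)%:E)%E; pose B := (\int[leb2 R]_x gagl G x)%E.
have -> : H12sqR G = (A + B)%E by [].
have A0 : (0 <= A)%E by apply: integral_ge0 => x _; rewrite lee_fin sqr_ge0.
have B0 : (0 <= B)%E by apply: integral_ge0 => x _; exact: gagl_ge0.
have h1 : (_ <= B)%E := le_quot_gagliardo cG; have h2 := le_trans (le_rem_quot cG) h1.
apply: (@le_trans _ _ (A + B + B)%E); first by apply: leeD => //; exact: leeD.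
rewrite mule_natl mule2n; apply: leeD => //.
by rewrite -[leLHS]add0e leeD.
Qed.

End bdlift.

(** * The fractional Sobolev norm *)

(** Both sides are sums of nonnegative terms, so the pointwise identity integrates in the extended
    reals. *)
Lemma integral_parallelogram d (T : measurableType d) (R : realType)
    (nu : {measure set T -> \bar R}) (A B : T -> R) :
  measurable_fun setT A -> measurable_fun setT B ->
  (\int[nu]_x (A x ^+ 2)%:E + \int[nu]_x (B x ^+ 2)%:E =
   2%:E * \int[nu]_x ((2^-1 * (A x + B x)) ^+ 2)%:E +
   (2^-1)%:E * \int[nu]_x ((A x - B x) ^+ 2)%:E)%E.
Proof.
move=> mA mB.
have m2 (f : T -> R) : measurable_fun setT f -> measurable_fun setT (fun x => (f x ^+ 2)%:E).
  by move=> mf; apply/measurable_EFinP; exact: measurable_funX.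
have mP : measurable_fun setT (fun x => 2^-1 * (A x + B x)).
  by apply: measurable_funM => //; exact: measurable_funD.
have mM : measurable_fun setT (fun x => A x - B x) by exact: measurable_funB.
have p0 (f : T -> R) x : setT x -> (0 <= (f x ^+ 2)%:E)%E by rewrite lee_fin sqr_ge0.
rewrite -ge0_integralD//; try solve [exact: p0|exact: m2].
rewrite -ge0_integralZl//; try solve [exact: (p0 (fun x => 2^-1 * (A x + B x)))|exact: m2].
rewrite -ge0_integralZl//; try solve [exact: (p0 (fun x => A x - B x))|exact: m2].
rewrite -ge0_integralD//.
- by apply: eq_integral => x _; rewrite -!EFinM -!EFinD; congr (_%:E); field.
- by move=> x _; rewrite -EFinM lee_fin mulr_ge0 ?sqr_ge0.
- by apply: measurable_funeM; exact: m2.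
- by move=> x _; rewrite -EFinM lee_fin mulr_ge0 ?sqr_ge0.
- by apply: measurable_funeM; exact: m2.
Qed.

Section gagliardo.
Context {R : realType}.
Local Notation MR := (measurableTypeR R).
Local Notation mu := (@lebesgue_measure R).
Implicit Types (f g b : R -> R).

Definition N2 (f : R -> R) : \bar R := (\int[leb R]_x (f x ^+ 2)%:E)%E.

Definition shiftB (g : R -> R) (h z : R) : R := g (z + h) - g z.

Lemma N2_ge0 f : (0 <= N2 f)%E.
Proof. by apply: integral_ge0 => x _; rewrite lee_fin sqr_ge0. Qed.

Lemma H12sqR_ge0 f : (0 <= H12sqR f)%E.
Proof. by apply: adde_ge0; [exact: N2_ge0|apply: integral_ge0 => x _; exact: gagl_ge0]. Qed.

Lemma measurable_N2 (f : MR -> MR) : measurable_fun setT f ->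
  measurable_fun setT (fun x => (f x ^+ 2)%:E).
Proof. by move=> mf; apply/measurable_EFinP; exact: measurable_funX. Qed.

Lemma measurable_shift (f : MR -> MR) (h : R) : measurable_fun setT f ->
  measurable_fun setT (fun x : MR => f (x + h)%R : MR).
Proof. by move=> mf; apply: (measurableT_comp mf); exact: measurable_funD. Qed.

Lemma measurable_shiftB (g : MR -> MR) (h : R) : measurable_fun setT g ->
  measurable_fun setT (shiftB g h : MR -> MR).
Proof. by move=> mg; apply: measurable_funB => //; exact: measurable_shift. Qed.

Lemma measurable_gagl2 (g : MR -> MR) : measurable_fun setT g ->
  measurable_fun setT (fun p : MR * MR => gagl g ((p.1 + p.2)%R, p.1)).
Proof.
move=> mg; have mp : measurable_fun setT (fun p : MR * MR => (((p.1 + p.2)%R, p.1) : MR * MR)).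
  by apply: measurable_fun_pair => //=; exact: measurable_funD.
exact: measurableT_comp (measurable_gagl mg) mp.
Qed.

Lemma gagl_shiftE (g : MR -> MR) (h : R) : measurable_fun setT g ->
  (\int[mu]_z gagl g ((z + h)%R, z) = (h ^+ 2)^-1%:E * N2 (shiftB g h))%E.
Proof.
move=> mg; rewrite -ge0_integralZl//.
- apply: eq_integral => z _; rewrite /gagl/= -EFinM mulrC.
  by congr (_ ^- 2 * _)%:E; rewrite addrAC subrr add0r.
- by apply: measurable_N2; exact: measurable_shiftB.
- by move=> z _; rewrite lee_fin sqr_ge0.
- by rewrite lee_fin invr_ge0 sqr_ge0.
Qed.

Lemma measurable_N2_shift (g : MR -> MR) : measurable_fun setT g ->
  measurable_fun setT (fun h : MR => (h ^+ 2)^-1%:E * N2 (shiftB g h))%E.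
Proof.
move=> mg; under eq_fun do rewrite -(gagl_shiftE _ mg).
by apply: (measurable_fun_fubini_tonelli_G _ (measurable_gagl2 mg)) => x; exact: gagl_ge0.
Qed.

(** Substitute y = z + h. The seminorm becomes a weighted integral of squared $L^2$ norms of the
    increments of [g], so that cutoff and mollification can be estimated for one shift at a time. *)
Lemma gagl_shift (g : MR -> MR) : measurable_fun setT g ->
  (\int[leb2 R]_x gagl g x =
   \int[mu]_h ((h ^+ 2)^-1%:E * N2 (shiftB g h)))%E.
Proof.
move=> mg; rewrite (fubini_tonelli2 _ (measurable_gagl mg) (gagl_ge0 g)).
transitivity (\int[mu]_z \int[mu]_h gagl g ((z + h)%R, z))%E.
  apply: eq_integral => z _; rewrite /fubini_G.
  have mz : measurable_fun setT (fun y : MR => gagl g (y, z)).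
    exact: measurableT_comp (measurable_gagl mg) _.
  rewrite -(lebesgue_shift z mz); last by move=> y; exact: gagl_ge0.
  by apply: eq_integral => h _; rewrite addrC.
rewrite (fubini_tonelli _ (measurable_gagl2 mg)); last by move=> x; exact: gagl_ge0.
by apply: eq_integral => h _; rewrite gagl_shiftE.
Qed.

Lemma H12sqRE (g : MR -> MR) : measurable_fun setT g ->
  (H12sqR g = N2 g + \int[mu]_h ((h ^+ 2)^-1%:E * N2 (shiftB g h)))%E.
Proof. by move=> mg; rewrite /H12sqR -(gagl_shift mg). Qed.

(** Linear in [g], with the Gagliardo integrand as its square: the seminorm is an $L^2$ norm in the
    plane and inherits the parallelogram identity. *)
Definition dq g (x : MR * MR) : R := (g x.1 - g x.2) / (x.1 - x.2).

Lemma gagl_dq g x : gagl g x = (dq g x ^+ 2)%:E.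
Proof. by rewrite /gagl /dq expr_div_n. Qed.

Lemma measurable_dq (g : MR -> MR) : measurable_fun setT g -> measurable_fun setT (dq g).
Proof.
move=> mg; apply: measurable_funM.
  by apply: measurable_funB; apply: (measurableT_comp mg).
have m2 : measurable_fun setT (fun x : MR * MR => x.1 - x.2 : MR) by exact: measurable_funB.
exact: (measurableT_comp measurable_inv m2).
Qed.

Lemma H12sqR_dq g : (H12sqR g = N2 g + \int[leb2 R]_x (dq g x ^+ 2)%:E)%E.
Proof. by rewrite /H12sqR; congr (_ + _)%E; apply: eq_integral => x _; rewrite -gagl_dq. Qed.

Lemma H12sqR_parallelogram (f g : MR -> MR) : measurable_fun setT f -> measurable_fun setT g ->
  (H12sqR f + H12sqR g = 2%:E * H12sqR (fun x => (2^-1 * (f x + g x))%R) +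
    (2^-1)%:E * H12sqR (fun x => (f x - g x)%R))%E.
Proof.
move=> mf mg; rewrite !H12sqR_dq addeACA.
rewrite (integral_parallelogram _ (measurable_dq mf) (measurable_dq mg)).
rewrite {1 2}/N2 (integral_parallelogram _ mf mg) addeACA -!muleDr//; last 2 first.
- by apply: ge0_adde_def; rewrite inE; apply: integral_ge0 => x _; rewrite lee_fin sqr_ge0.
- by apply: ge0_adde_def; rewrite inE; apply: integral_ge0 => x _; rewrite lee_fin sqr_ge0.
by congr (_ * (_ + _) + _ * (_ + _))%E; apply: eq_integral => x _; congr (_ ^+ 2)%:E;
  rewrite /dq -?mulrDl -?mulrBl ?mulrA; congr (_ * _); ring.
Qed.

Lemma H12sqRZ a (f : MR -> MR) : measurable_fun setT f ->
  H12sqR (fun x => (a * f x)%R) = ((a ^+ 2)%:E * H12sqR f)%E.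
Proof.
move=> mf; rewrite !H12sqR_dq muleDr//; last first.
  by apply: ge0_adde_def; rewrite inE; apply: integral_ge0 => x _; rewrite lee_fin sqr_ge0.
rewrite /N2 -!ge0_integralZl//; try solve [by rewrite lee_fin sqr_ge0|by move=> x _; rewrite lee_fin sqr_ge0|exact: measurable_N2].
  congr (_ + _)%E; apply: eq_integral => x _; rewrite -EFinM -exprMn//.
  by rewrite /dq -mulrBr mulrA.
by apply/measurable_EFinP; apply: measurable_funX; exact: measurable_dq.
Qed.

Lemma H12sqRB (f g : MR -> MR) : measurable_fun setT f -> measurable_fun setT g ->
  (H12sqR (fun x => (f x - g x)%R) <= 2%:E * (H12sqR f + H12sqR g))%E.
Proof.
move=> mf mg; rewrite (H12sqR_parallelogram mf mg) muleDr//; last first.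
  by apply: ge0_adde_def; rewrite inE mule_ge0// H12sqR_ge0.
by rewrite !muleA -!EFinM mulfV// mul1e -[leLHS]add0e leeD// mule_ge0// H12sqR_ge0.
Qed.

Lemma H12sqR_ae (f g : MR -> MR) (Z : set MR) : measurable Z -> mu Z = 0 ->
  measurable_fun setT f -> measurable_fun setT g -> (forall x, ~ Z x -> f x = g x) ->
  H12sqR f = H12sqR g.
Proof.
move=> mZ Z0 mf mg fg; rewrite !H12sqR_dq /N2; congr (_ + _)%E.
  apply: ge0_ae_eq_integral => //; try solve [exact: measurable_N2|by move=> x _; rewrite lee_fin sqr_ge0].
  exists Z; split => // x /= nfg; apply: contrapT => /fg e; apply: nfg => _; by rewrite e.
apply: ge0_ae_eq_integral => //; try solve [by move=> x _; rewrite lee_fin sqr_ge0].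
- by apply/measurable_EFinP; apply: measurable_funX; exact: measurable_dq.
- by apply/measurable_EFinP; apply: measurable_funX; exact: measurable_dq.
have mZ1 : measurable (Z `*` setT : set (MR * MR)) by exact: measurableX.
have mZ2 : measurable (setT `*` Z : set (MR * MR)) by exact: measurableX.
(* The difference quotient at (x, y) can change only if x or y lies in [Z], and both cylinders over
   a null set are null in the plane. *)
exists ((Z `*` setT) `|` (setT `*` Z)); split.
- exact: measurableU.
- apply: null_set_setU => //.
    by rewrite -(mul0e (mu setT)) -Z0; exact: product_measure1E.
  by rewrite -(mule0 (mu setT)) -Z0; exact: product_measure1E.
- move=> x /= nfg; apply: contrapT => /not_orP[n1 n2]; apply: nfg => _.
  rewrite /dq !fg//; first by move=> Zx; apply: n2.
  by move=> Zx; apply: n1.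
Qed.

(** Fatou is applied to each of the two terms separately, and each is at most [M]; hence [M + M]. *)
Lemma H12sqR_fatou (f_ : nat -> MR -> MR) f (M : \bar R) : (forall n, measurable_fun setT (f_ n)) ->
  (forall x, f_ n x @[n --> \oo] --> f x) -> (\forall n \near \oo, H12sqR (f_ n) <= M)%E ->
  (H12sqR f <= M + M)%E.
Proof.
move=> mf cf fM; rewrite H12sqR_dq; apply: leeD.
- apply: (fatou_le (F_ := fun n x => f_ n x ^+ 2)) => //.
  + by move=> n; apply: measurable_funX; exact: mf.
  + by move=> n x _; rewrite sqr_ge0.
  + by move=> x _; apply: cvgM; exact: cf.
  + apply: filterS fM => n; apply: le_trans; rewrite H12sqR_dq leeDl//.
    by apply: integral_ge0 => x _; rewrite lee_fin sqr_ge0.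
- apply: (fatou_le (F_ := fun n x => dq (f_ n) x ^+ 2)) => //.
  + by move=> n; apply: measurable_funX; exact: measurable_dq.
  + by move=> n x _; rewrite sqr_ge0.
  + have cdq x : dq (f_ n) x @[n --> \oo] --> dq f x by apply: cvgMl; apply: cvgB; exact: cf.
    by move=> x _; apply: cvgM; exact: cdq.
  + apply: filterS fM => n; apply: le_trans; rewrite H12sqR_dq leeDr//; exact: N2_ge0.
Qed.

End gagliardo.

(** * Mollification: smoothing without increase of the fractional norm *)

Section mollification.
Context {R : realType}.
Local Notation MR := (measurableTypeR R).
Local Notation mu := (@lebesgue_measure R).
Implicit Types (f g b rho : R -> R).

Lemma Rintegral_shift (a : R) (f : MR -> MR) : measurable_fun setT f ->
  \int[mu]_x f (x + a) = \int[mu]_x f x.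
Proof.
move=> mf; rewrite /Rintegral; congr fine; rewrite integralE [RHS]integralE.
have mE : measurable_fun setT (fun x : MR => (f x)%:E) by exact/measurable_EFinP.
congr (_ - _)%E.
  rewrite -[RHS](lebesgue_shift a (measurable_funepos mE) (funepos_ge0 _)).
  by apply: eq_integral => x _; rewrite !funeposE.
rewrite -[RHS](lebesgue_shift a (measurable_funeneg mE) (funeneg_ge0 _)).
by apply: eq_integral => x _; rewrite !funenegE.
Qed.

Lemma integrable_mul_bounded b (r : R -> R) (C : R) : mu.-integrable setT (EFin \o b) ->
  measurable_fun setT (r : MR -> MR) -> (forall y, `|r y| <= C) ->
  mu.-integrable setT (EFin \o (fun y => b y * r y)).
Proof.
move=> ib mr rC.
have mb : measurable_fun setT (b : MR -> MR).
  by case/integrableP: ib => /measurable_EFinP.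
apply: (le_integrable _ _ _ (integrableZl _ C ib)) => //.
  by apply/measurable_EFinP; exact: measurable_funM.
move=> y _; change (`|b y * r y|%:E <= `|C * b y|%:E)%E.
rewrite lee_fin !normrM mulrC ler_wpM2r//.
exact: le_trans (rC y) (ler_norm C).
Qed.

Lemma csmooth_measurable f : csmooth f -> measurable_fun setT (f : MR -> MR).
Proof. by move=> cf; apply: continuous_measurable_fun; exact: csmooth_continuous. Qed.

(** The kernel is [rho (y - z)], reflected with respect to the usual convolution: a [rho] supported
    in [0, d] averages [b] over [z, z + d]. *)
Definition convo rho b (z : R) : R := \int[mu]_y (b y * rho (y - z)).

Lemma integrable_conv rho b z : csmooth rho -> mu.-integrable setT (EFin \o b) ->
  mu.-integrable setT (EFin \o (fun y => b y * rho (y - z))).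
Proof.
move=> cr ib; have [C _ rC] := csmooth_bounded cr.
apply: integrable_mul_bounded ib _ (fun y => rC (y - z)).
by apply: (measurableT_comp (csmooth_measurable cr)); exact: measurable_funB.
Qed.

(** The derivative falls on [rho], with a sign because z enters as [y - z]. The uniform Taylor
    remainder of [rho], integrated against [|b|], is the quadratic remainder that the criterion asks
    for. *)
Lemma is_derive_conv rho b (z : R) : csmooth rho -> mu.-integrable setT (EFin \o b) ->
  is_derive z 1 (convo rho b) (convo (fun y => -1 * derive1 rho y) b z).
Proof.
move=> cr ib; have [C C0 rC] := csmooth_taylor cr.
have cr1 := csmooth_derive1 cr.
have i1 h := integrable_conv h cr ib; have i2 h := integrable_conv h cr1 ib.
have iN : mu.-integrable setT (EFin \o (fun y => b y * (-1 * derive1 rho (y - z)))).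
  have := integrableZl measurableT (-1) (i2 z); apply: eq_integrable => // y _ /=.
  by rewrite -EFinM; congr _%:E; ring.
have iabs : mu.-integrable setT (EFin \o (fun y => `|b y|)) by exact: integrable_norm.
apply: (@is_derive_quadratic _ _ _ _ (C * \int[mu]_y `|b y|)) => h _.
have iNh : mu.-integrable setT (EFin \o (fun y => h * (b y * (-1 * derive1 rho (y - z))))).
  by have := integrableZl measurableT h iN; apply: eq_integrable.
have iB : mu.-integrable setT (EFin \o (fun y => b y * rho (y - (h + z)) - b y * rho (y - z))).
  by have := integrableB measurableT (i1 (h + z)) (i1 z); apply: eq_integrable.
rewrite /convo -RintegralZl// -RintegralB// -RintegralB//.
have iall : mu.-integrable setT (EFin \o (fun y => b y * rho (y - (h + z)) - b y * rho (y - z)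
    - h * (b y * (-1 * derive1 rho (y - z))))).
  by have := integrableB measurableT iB iNh; apply: eq_integrable.
apply: le_trans (le_normr_Rintegral measurableT iall) _.
rewrite mulrAC -RintegralZl//; apply: le_Rintegral => //.
- exact: integrable_norm.
- by have := integrableZl measurableT (C * h ^+ 2) iabs; apply: eq_integrable.
move=> y _; rewrite (_ : _ - _ = b y * (rho ((y - z) + (- h)) - rho (y - z) - (- h) * derive1 rho (y - z))).
  rewrite normrM mulrC ler_wpM2r//; apply: le_trans (rC _ _) _.
  by rewrite sqrrN.
by rewrite (_ : y - z + - h = y - (h + z)); [ring|rewrite opprD addrA addrAC].
Qed.

Lemma csmooth_lin (a1 a2 : R) f g : csmooth f -> csmooth g -> csmooth (fun x => a1 * f x + a2 * g x).
Proof.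
move=> [sf [M fM]] [sg [L gL]]; split.
  move=> n; apply: nderivableD; apply: nderivableM; [exact: nderivable_cst|exact: sf|exact: nderivable_cst|exact: sg].
exists (Num.max M L) => z; rewrite gt_max => /andP[h1 h2].
by rewrite fM// gL// !mulr0 addr0.
Qed.

Lemma smooth_conv rho b : csmooth rho -> mu.-integrable setT (EFin \o b) -> smooth (convo rho b).
Proof.
move=> cr ib n; elim: n rho cr => // n ih rho cr.
apply: nderivableS_is_derive (fun z => is_derive_conv z cr ib) _; apply: ih.
have := csmooth_lin (-1) 0 (csmooth_derive1 cr) (csmooth_derive1 cr).
by congr csmooth; apply/funext => y; rewrite mul0r addr0.
Qed.

Lemma csmooth_conv rho b (M : R) : csmooth rho -> mu.-integrable setT (EFin \o b) ->
  (forall y, M < `|y| -> b y = 0) -> csmooth (convo rho b).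
Proof.
move=> cr ib bM; split; first exact: smooth_conv.
have [_ [L rL]] := cr; exists (M + L) => z zML.
rewrite /convo /Rintegral integral0_eq// => y _; congr EFin.
have [yM|yM] := ltP M `|y|; first by rewrite bM// mul0r.
rewrite rL ?mulr0// -[y - z]opprB normrN.
have := ler_normD (z - y) y; rewrite subrK; lra.
Qed.

Lemma conv_shift rho b z : csmooth rho -> mu.-integrable setT (EFin \o b) ->
  convo rho b z = \int[mu]_y (b (y + z) * rho y).
Proof.
move=> cr ib; rewrite /convo.
have [/measurable_EFinP m _] := integrableP _ _ _ (integrable_conv z cr ib).
rewrite -(Rintegral_shift z m); apply: eq_Rintegral => y _.
by rewrite addrK.
Qed.

Lemma integrable_shift b (h : R) : mu.-integrable setT (EFin \o b) ->
  mu.-integrable setT (EFin \o (fun y => b (y + h))).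
Proof.
move=> /integrableP[/measurable_EFinP mb boo].
apply/integrableP; split; first by apply/measurable_EFinP; exact: measurable_shift.
rewrite (lebesgue_shift h (f := fun x => `|(b x)%:E|%E))//.
by apply/measurable_EFinP; exact: measurableT_comp.
Qed.

Lemma shiftB_conv rho b h : csmooth rho -> mu.-integrable setT (EFin \o b) ->
  shiftB (convo rho b) h = convo rho (shiftB b h).
Proof.
move=> cr ib; apply/funext => z; rewrite /shiftB /convo.
have ih := integrable_conv z cr (integrable_shift h ib).
have i0 := integrable_conv z cr ib.
have [/measurable_EFinP m _] := integrableP _ _ _ (integrable_conv (z + h) cr ib).
rewrite -(Rintegral_shift h m).
under [X in X - _]eq_Rintegral do rewrite opprD addrACA subrr addr0.
rewrite -RintegralB//; apply: eq_Rintegral => y _; by rewrite mulrBl.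
Qed.

(** The tangent to the square at the mean [m] gives [b ^+ 2 >= 2 * m * b - m ^+ 2]; integrating
    against the probability density [w] gives [m ^+ 2] on the right. *)
Lemma jensen_sqr (b w : R -> R) : (forall y, 0 <= w y) -> mu.-integrable setT (EFin \o w) ->
  \int[mu]_y w y = 1 -> measurable_fun setT (b : MR -> MR) ->
  mu.-integrable setT (EFin \o (fun y => b y * w y)) ->
  (((\int[mu]_y (b y * w y)) ^+ 2)%:E <= \int[mu]_y (b y ^+ 2 * w y)%:E)%E.
Proof.
move=> w0 iw w1 mb ibw; set m := \int[mu]_y (b y * w y).
have [->|] := eqVneq (\int[mu]_y (b y ^+ 2 * w y)%:E)%E +oo%E; first exact: leey.
rewrite -ltey => fin.
have mw : measurable_fun setT (w : MR -> MR) by case/integrableP: iw => /measurable_EFinP.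
have i2 : mu.-integrable setT (EFin \o (fun y => b y ^+ 2 * w y)).
  apply/integrableP; split.
    by apply/measurable_EFinP; apply: measurable_funM => //; exact: measurable_funX.
  apply: le_lt_trans fin; rewrite le_eqVlt; apply/orP; left; apply/eqP; apply: eq_integral => y _.
  by rewrite /= ger0_norm// mulr_ge0 ?sqr_ge0.
rewrite -[leRHS](fineK (integrable_fin_num measurableT i2)) lee_fin -/(Rintegral _ _ _).
have i3 : mu.-integrable setT (EFin \o (fun y => 2 * m * (b y * w y))).
  by have := integrableZl measurableT (2 * m) ibw; apply: eq_integrable.
have i4 : mu.-integrable setT (EFin \o (fun y => m ^+ 2 * w y)).
  by have := integrableZl measurableT (m ^+ 2) iw; apply: eq_integrable.
have -> : m ^+ 2 = \int[mu]_y (2 * m * (b y * w y) - m ^+ 2 * w y).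
  by rewrite RintegralB// !RintegralZl// w1 -/m; ring.
apply: le_Rintegral => //.
  by have := integrableB measurableT i3 i4; apply: eq_integrable.
move=> y _; rewrite -subr_ge0 (_ : _ - _ = (b y - m) ^+ 2 * w y); last by ring.
by rewrite mulr_ge0 ?sqr_ge0.
Qed.

Lemma csmooth_integrable f : csmooth f -> mu.-integrable setT (EFin \o f).
Proof.
move=> cf; have [_ [M fM]] := cf.
have := continuous_integrable (- M) M (csmooth_continuous cf).
have [h _] := @integrable_mkcond _ _ _ mu `[- M, M]%classic (EFin \o f) (measurable_itv _).
move=> /h; apply: eq_integrable => // y _.
rewrite patchE; case: ifPn => // /negP ny /=; rewrite fM//.
by rewrite ltNge; apply/negP => yM; apply: ny; rewrite inE/= in_itv/= -ler_norml.
Qed.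

(** Jensen for the density [rho] at each z, then Tonelli: by translation invariance every shift of
    [b] contributes [N2 b], and [rho] has total mass 1. *)
Lemma N2_conv rho b : csmooth rho -> (forall y, 0 <= rho y) -> \int[mu]_y rho y = 1 ->
  mu.-integrable setT (EFin \o b) -> (N2 (convo rho b) <= N2 b)%E.
Proof.
move=> cr r0 r1 ib.
have [/measurable_EFinP mb _] := integrableP _ _ _ ib.
have mr := csmooth_measurable cr.
have mc : measurable_fun setT (convo rho b : MR -> MR).
  by apply: continuous_measurable_fun; apply: smooth_continuous; exact: smooth_conv.
pose F (p : MR * MR) := (b (p.2 + p.1) ^+ 2 * rho p.2)%:E.
have mF : measurable_fun setT F.
  apply/measurable_EFinP; apply: measurable_funM; last by apply: (measurableT_comp mr).
  apply: measurable_funX; apply: (measurableT_comp mb); exact: measurable_funD.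
have F0 p : (0 <= F p)%E by rewrite lee_fin mulr_ge0 ?sqr_ge0.
apply: (@le_trans _ _ (\int[mu]_z \int[mu]_y F (z, y))%E).
  apply: ge0_le_integral => //.
  - by move=> z _; rewrite lee_fin sqr_ge0.
  - exact: measurable_N2.
  - exact: measurable_fun_fubini_tonelli_F mF F0.
  move=> z _; rewrite (conv_shift z cr ib); apply: jensen_sqr => //.
  - exact: csmooth_integrable.
  - exact: measurable_shift.
  - have [C _ rC] := csmooth_bounded cr.
    exact: (integrable_mul_bounded (integrable_shift z ib) mr rC).
rewrite (fubini_tonelli F mF F0).
have e y : (\int[mu]_z F (z, y) = (rho y)%:E * N2 b)%E.
  rewrite /F/= -ge0_integralZl//; last 3 first.
  - exact: measurable_N2.
  - by move=> z _; rewrite lee_fin sqr_ge0.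
  - by rewrite lee_fin.
  have mm : measurable_fun setT (fun z : MR => (rho y)%:E * (b z ^+ 2)%:E)%E.
    by apply: measurable_funeM; exact: measurable_N2.
  rewrite -(lebesgue_shift y mm); last by move=> x; rewrite mule_ge0// lee_fin ?sqr_ge0.
  by apply: eq_integral => z _; rewrite -EFinM mulrC addrC.
under eq_integral do rewrite e.
rewrite ge0_integralZr//; last 3 first.
- exact/measurable_EFinP.
- by move=> y _; rewrite lee_fin.
- exact: N2_ge0.
have i := csmooth_integrable cr.
rewrite -[X in (X * _)%E](fineK (integrable_fin_num measurableT i)).
by rewrite -/(Rintegral _ _ _) r1 mul1e.
Qed.

(** Mollification commutes with taking increments, so the $L^2$ contraction applies to each
    increment in the shift formula of the seminorm. *)
Lemma H12sqR_conv rho b : csmooth rho -> (forall y, 0 <= rho y) -> \int[mu]_y rho y = 1 ->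
  mu.-integrable setT (EFin \o b) -> (H12sqR (convo rho b) <= H12sqR b)%E.
Proof.
move=> cr r0 r1 ib.
have [/measurable_EFinP mb _] := integrableP _ _ _ ib.
have mc : measurable_fun setT (convo rho b : MR -> MR).
  by apply: continuous_measurable_fun; apply: smooth_continuous; exact: smooth_conv.
rewrite (H12sqRE mc) (H12sqRE mb); apply: leeD; first exact: N2_conv.
apply: ge0_le_integral => //.
- by move=> h _; rewrite mule_ge0 ?lee_fin ?invr_ge0 ?sqr_ge0// N2_ge0.
- exact: measurable_N2_shift.
- exact: measurable_N2_shift.
move=> h _; rewrite (shiftB_conv h cr ib); apply: lee_wpmul2l.
  by rewrite lee_fin invr_ge0 sqr_ge0.
apply: N2_conv => //; have := integrableB measurableT (integrable_shift h ib) ib.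
by apply: eq_integrable.
Qed.

End mollification.

(** * Density of smooth functions in the fractional Sobolev space *)

Section density.
Context {R : realType}.
Local Notation MR := (measurableTypeR R).
Local Notation mu := (@lebesgue_measure R).
Implicit Types (f g b rho : R -> R).

(** A piecewise linear plateau: 1 on [-M, M], 0 beyond M + 1, with Lipschitz constant 1 for every
    [M]. Smoothness comes from the mollification applied afterwards. *)
Definition eta (M y : R) : R := Num.max 0 (Num.min 1 (M + 1 - `|y|)).

Lemma eta_ge0 (M y : R) : 0 <= eta M y.
Proof. by rewrite le_max lexx. Qed.

Lemma eta_le1 (M y : R) : eta M y <= 1.
Proof. by rewrite ge_max ler01 ge_min lexx. Qed.

Lemma eta_eq1 (M y : R) : `|y| <= M -> eta M y = 1.
Proof. by move=> yM; rewrite /eta min_l ?max_r//; lra. Qed.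

Lemma eta_eq0 (M y : R) : M + 1 < `|y| -> eta M y = 0.
Proof. by move=> yM; rewrite /eta max_l// ge_min subr_le0 (ltW yM) orbT. Qed.

Lemma eta_lipschitz (M x y : R) : `|eta M x - eta M y| <= `|x - y|.
Proof.
have key (c d : R) : c <= d -> 0 <= Num.max 0 (Num.min 1 (M + 1 - c)) -
    Num.max 0 (Num.min 1 (M + 1 - d)) <= d - c.
  move=> cd; rewrite /Num.max /Num.min.
  case: (ltP 1 (M + 1 - c)) => hc; case: (ltP 1 (M + 1 - d)) => hd; rewrite ?ltr01;
    do ?[case: ifPn; rewrite -?leNgt => ?]; apply/andP; split; lra.
have key2 (c d : R) : `|Num.max 0 (Num.min 1 (M + 1 - c)) -
    Num.max 0 (Num.min 1 (M + 1 - d))| <= `|c - d|.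
  have [cd|dc] := leP c d.
    have /andP[h1 h2] := key _ _ cd.
    by rewrite (ger0_norm h1) distrC ger0_norm ?subr_ge0.
  have /andP[h1 h2] := key _ _ (ltW dc).
  by rewrite distrC (ger0_norm h1) ger0_norm ?subr_ge0// ltW.
exact: le_trans (key2 _ _) (ler_dist_dist x y).
Qed.

(** The squared increment is at most [h ^+ 2] and at most 1, and the minimum of the two divided by
    [h ^+ 2] is at most 2 / (1 + h^2). The bound is integrable in [h] and free of [M]. At [h = 0]
    the left side is 0, as [0^-1 = 0]. *)
Lemma eta_lipschitz_sqr M (z h : R) :
  (h ^+ 2)^-1 * (eta M (z + h) - eta M z) ^+ 2 <= 2 * (oneDsqr h)^-1.
Proof.
have h2 := sqr_ge0 h.
have D0 : 0 < oneDsqr h by rewrite (lt_le_trans ltr01 (oneDsqr_ge1 h)).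
have [->|h0] := eqVneq h 0; first by rewrite expr0n/= invr0 mul0r mulr_ge0 ?invr_ge0 ?ltW.
have h20 : 0 < h ^+ 2 by rewrite exprn_even_gt0.
have e1 : (eta M (z + h) - eta M z) ^+ 2 <= h ^+ 2.
  rewrite -[leLHS]real_normK ?num_real// -[leRHS]real_normK ?num_real// lerXn2r ?nnegrE//.
  by apply: le_trans (eta_lipschitz _ _ _) _; rewrite [z + h]addrC addrK.
have e2 : (eta M (z + h) - eta M z) ^+ 2 <= 1.
  rewrite -[leLHS]real_normK ?num_real// exprn_ile1// ler_norml.
  have := eta_ge0 M (z + h); have := eta_ge0 M z; have := eta_le1 M (z + h); have := eta_le1 M z.
  by move=> *; apply/andP; split; lra.
rewrite mulrC ler_pdivrMr// mulrAC ler_pdivlMr// /oneDsqr.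
set E := _ ^+ 2 in e1 e2 *.
have [h1|h1] := leP (h ^+ 2) 1.
  apply: (@le_trans _ _ (E * 2)); first by rewrite ler_wpM2l ?sqr_ge0//; lra.
  by rewrite mulrC ler_wpM2l.
apply: (@le_trans _ _ (1 * (1 + h ^+ 2))); last by rewrite mul1r; lra.
by rewrite ler_wpM2r//; lra.
Qed.

Lemma measurable_eta M : measurable_fun setT (eta M : MR -> MR).
Proof.
apply: measurable_maxr; first exact: measurable_cst.
apply: measurable_minr; first exact: measurable_cst.
apply: measurable_funB; first exact: measurable_cst.
exact: normr_measurable.
Qed.

Lemma integral_oneDsqr_fin : (\int[mu]_h ((oneDsqr h)^-1)%:E < +oo)%E.
Proof.
rewrite (@ge0_symfun_integralT R (fun h => (oneDsqr h)^-1)).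
- rewrite (_ : [set x : R | 0 <= x] = `[0%R, +oo[%classic); last first.
    by apply/seteqP; split => x /=; rewrite in_itv/= andbT.
  by rewrite integral0y_oneDsqr -EFinM ltry.
- by move=> h; rewrite invr_ge0 (le_trans ler01 (oneDsqr_ge1 h)).
- exact: continuous_oneDsqrV.
- by move=> h; rewrite /= /oneDsqr sqrrN.
Qed.

(** The increment of [eta * g] is [eta (z + h)] times the increment of [g] plus the increment of
    [eta] times [g z]. Squaring yields twice the seminorm of [g], plus $4K\|g\|^2$ with K the
    integral of 1 / (1 + h^2); the summand 1 of the constant covers the $L^2$ part. The constant is
    uniform in [M]. *)
Lemma H12sqR_cutoff : exists2 C : R, 0 <= C & forall M (g : MR -> MR), measurable_fun setT g ->
  (H12sqR (fun x => eta M x * g x)%R <= C%:E * H12sqR g)%E.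
Proof.
pose K := (\int[mu]_h ((oneDsqr h)^-1)%:E)%E.
have K0 : (0 <= K)%E.
  by apply: integral_ge0 => h _; rewrite lee_fin invr_ge0 (le_trans ler01 (oneDsqr_ge1 h)).
have Kf : K \is a fin_num by rewrite ge0_fin_numE// integral_oneDsqr_fin.
have k0 : 0 <= fine K by exact: fine_ge0.
exists (1 + 2 + 4 * fine K) => [|M g mg]; first by rewrite !addr_ge0// mulr_ge0.
have me := measurable_eta M.
have mf : measurable_fun setT (fun x => eta M x * g x : MR) by exact: measurable_funM.
set f := fun x => eta M x * g x in mf *.
have fg x : f x ^+ 2 <= g x ^+ 2.
  by rewrite /f exprMn ler_piMl ?sqr_ge0// exprn_ile1 ?eta_ge0 ?eta_le1.
have n2 : (N2 f <= N2 g)%E.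
  apply: ge0_le_integral => //.
  - by move=> x _; rewrite lee_fin sqr_ge0.
  - exact: measurable_N2.
  - exact: measurable_N2.
  - by move=> x _; rewrite lee_fin.
have D0 h : 0 <= (oneDsqr h)^-1 :> R by rewrite invr_ge0 (le_trans ler01 (oneDsqr_ge1 h)).
have mD : measurable_fun setT (fun h : MR => (oneDsqr h)^-1 : MR).
  by apply: continuous_measurable_fun; exact: continuous_oneDsqrV.
rewrite (H12sqRE mf) (H12sqRE mg).
set G := (\int[mu]_h ((h ^+ 2)^-1%:E * N2 (shiftB g h)))%E.
have G0 : (0 <= G)%E.
  by apply: integral_ge0 => h _; rewrite mule_ge0 ?N2_ge0// lee_fin invr_ge0 sqr_ge0.
have Ng0 := N2_ge0 g.
have slice h : ((h ^+ 2)^-1%:E * N2 (shiftB f h) <=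
    2%:E * ((h ^+ 2)^-1%:E * N2 (shiftB g h)) + 4%:E * ((oneDsqr h)^-1%:E * N2 g))%E.
  have i0 : 0 <= (h ^+ 2)^-1 by rewrite invr_ge0 sqr_ge0.
  have m1 := measurable_N2 (measurable_shiftB h mf).
  have m2 := measurable_N2 (measurable_shiftB h mg).
  have m3 := measurable_N2 mg.
  have p0 (b : R -> R) x : (0 <= (b x ^+ 2)%:E)%E by rewrite lee_fin sqr_ge0.
  rewrite /N2 -!ge0_integralZl//; try solve [exact: measurable_funeM|by move=> x _; rewrite ?mule_ge0 ?lee_fin ?sqr_ge0].
  rewrite -ge0_integralD//; try solve [by do 2 apply: measurable_funeM|by move=> x _; rewrite ?mule_ge0 ?lee_fin ?sqr_ge0].
  apply: ge0_le_integral => //.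
  - by move=> x _; rewrite mule_ge0 ?lee_fin ?sqr_ge0.
  - exact: measurable_funeM.
  - by apply: emeasurable_funD; do 2 apply: measurable_funeM.
  move=> x _; rewrite -!EFinM -EFinD lee_fin /shiftB /f.
  set d := eta M (x + h) - eta M x; set D := g (x + h) - g x.
  have -> : eta M (x + h) * g (x + h) - eta M x * g x = eta M (x + h) * D + d * g x.
    by rewrite /d /D; ring.
  have hd : (h ^+ 2)^-1 * d ^+ 2 <= 2 * (oneDsqr h)^-1 by exact: eta_lipschitz_sqr.
  have h1 : (eta M (x + h) * D) ^+ 2 <= D ^+ 2.
    by rewrite exprMn ler_piMl ?sqr_ge0// exprn_ile1 ?eta_ge0 ?eta_le1.
  apply: (@le_trans _ _ ((h ^+ 2)^-1 * (2 * D ^+ 2 + 2 * (d * g x) ^+ 2))).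
    rewrite ler_wpM2l//; set A := eta M (x + h) * D in h1 *; set B := d * g x.
    rewrite -subr_ge0 (_ : _ - _ = (A - B) ^+ 2 + 2 * (D ^+ 2 - A ^+ 2)); last by ring.
    by rewrite addr_ge0 ?sqr_ge0// mulr_ge0// subr_ge0.
  rewrite mulrDr; apply: lerD; first by rewrite mulrCA.
  have -> : (h ^+ 2)^-1 * (2 * (d * g x) ^+ 2) = 2 * g x ^+ 2 * ((h ^+ 2)^-1 * d ^+ 2).
    by rewrite exprMn; ring.
  apply: (@le_trans _ _ (2 * g x ^+ 2 * (2 * (oneDsqr h)^-1))).
    by rewrite ler_wpM2l// mulr_ge0 ?sqr_ge0.
  by rewrite le_eqVlt; apply/orP; left; apply/eqP; ring.
have mG := measurable_N2_shift mg; have mF := measurable_N2_shift mf.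
have G0' h : (0 <= (h ^+ 2)^-1%:E * N2 (shiftB g h))%E.
  by rewrite mule_ge0 ?N2_ge0// lee_fin invr_ge0 sqr_ge0.
have mK : measurable_fun setT (fun h : MR => (oneDsqr h)^-1%:E * N2 g)%E.
  by apply: emeasurable_funM => //; exact/measurable_EFinP.
have Kg0 h : (0 <= (oneDsqr h)^-1%:E * N2 g)%E by rewrite mule_ge0// lee_fin.
have gag : (\int[mu]_h ((h ^+ 2)^-1%:E * N2 (shiftB f h)) <= 2%:E * G + 4%:E * (K * N2 g))%E.
  apply: (@le_trans _ _ (\int[mu]_h (2%:E * ((h ^+ 2)^-1%:E * N2 (shiftB g h)) +
      4%:E * ((oneDsqr h)^-1%:E * N2 g)))%E).
    apply: ge0_le_integral => //.
    - by move=> h _; rewrite mule_ge0 ?N2_ge0// lee_fin invr_ge0 sqr_ge0.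
    - by apply: emeasurable_funD; apply: measurable_funeM.
  rewrite ge0_integralD//; try solve [exact: measurable_funeM|by move=> h _; rewrite mule_ge0].
  rewrite !ge0_integralZl//.
  apply: leeD => //; rewrite ge0_integralZr//.
  exact/measurable_EFinP.
rewrite -(fineK Kf) in gag.
apply: le_trans (leeD n2 gag) _.
have k4 : 0 <= 4 * fine K by rewrite mulr_ge0.
rewrite addeA (EFinD (1 + 2)) (EFinD 1 2) !ge0_muleDl ?lee_fin ?addr_ge0//.
have AG : (0 <= N2 g + G)%E by exact: adde_ge0.
apply: leeD; first apply: leeD.
- by rewrite mul1e leeDl.
- by apply: lee_wpmul2l; rewrite ?lee_fin// leeDr.
- by rewrite EFinM -muleA; apply: lee_wpmul2l; rewrite ?lee_fin//; apply: lee_wpmul2l; rewrite ?lee_fin// leeDl.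
Qed.

Definition molln (n : nat) (y : R) : R := n.+1%:R * moll (n.+1%:R * y).

Lemma molln_supp n y : ~~ (0 <= y <= n.+1%:R^-1) -> molln n y = 0.
Proof.
move=> h; rewrite /molln moll_eq0 ?mulr0//; apply: contra h => /andP[h1 h2].
have n0 : 0 < n.+1%:R :> R by [].
by rewrite -(pmulr_rge0 _ n0) h1/= -[n.+1%:R^-1]mul1r ler_pdivlMr// mulrC.
Qed.

Lemma molln_ge0 n y : 0 <= molln n y.
Proof. by rewrite mulr_ge0// moll_ge0. Qed.

Lemma csmooth_molln n : csmooth (molln n).
Proof.
split.
  move=> m; apply: nderivableM; first exact: nderivable_cst.
  have := nderivable_affine n.+1%:R 0 (@smooth_moll R m).
  rewrite (_ : (fun x => moll (n.+1%:R * x + 0)) = fun y => moll (n.+1%:R * y)); first by [].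
  by apply/funext => y; rewrite addr0.
exists 1 => y y1; apply: molln_supp; rewrite negb_and -!ltNge; apply/orP.
have [y0|y0] := ltP y 0; [by left|right].
rewrite ger0_norm// in y1; apply: le_lt_trans y1.
by rewrite invf_le1// ler1n.
Qed.

Lemma integral_molln n : \int[mu]_y molln n y = 1.
Proof.
have d (y : R) : is_derive y 1 (fun y => step (n.+1%:R * y)) (molln n y).
  have := @is_derive_affine R (@step R) n.+1%:R 0 y _ (is_derive_step _).
  rewrite addr0 => /is_derive_ext; apply => // z; by rewrite addr0.
have := @Rintegral_FTC2 R 0 1 _ _ ltr01 d (csmooth_continuous (csmooth_molln n)).
rewrite mulr1 mulr0 (step_eq1 (x := n.+1%:R)) ?ler1n// step_eq0// subr0 => <-.
rewrite /Rintegral [in RHS]integral_mkcond; congr fine; apply: eq_integral => y _.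
rewrite patchE; case: ifPn => // /negP yn; congr EFin; apply: molln_supp.
apply/negP => /andP[y0 yN]; apply: yn; rewrite inE/= in_itv/= y0 (le_trans yN)//.
by rewrite invf_le1// ler1n.
Qed.

Lemma N2_locally_integrable (g : MR -> MR) : measurable_fun setT g -> (N2 g < +oo)%E ->
  forall K : set MR, compact K -> measurable K -> (\int[mu]_(x in K) `|(g x)%:E| < +oo)%E.
Proof.
move=> mg goo K cK mK.
have mg2 := measurable_N2 mg.
apply: (@le_lt_trans _ _ (\int[mu]_(x in K) (cst 1%:E x + (g x ^+ 2)%:E))%E).
  apply: ge0_le_integral => //.
  - by apply: measurable_funTS; apply/measurable_EFinP; exact: measurableT_comp.
  - by apply: measurable_funTS; exact: emeasurable_funD.
  move=> x _; rewrite /cst -EFinD lee_fin -[g x ^+ 2]real_normK ?num_real//.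
  have h (a : R) : 0 <= a -> a <= 1 + a ^+ 2.
    move=> a0; have := sqr_ge0 (a - 1); rewrite -[a <= _]subr_ge0.
    by rewrite (_ : 1 + a ^+ 2 - a = (a - 1) ^+ 2 + a); [move=> ?; rewrite addr_ge0|ring].
  exact: h.
rewrite ge0_integralD//; last 2 first.
- by move=> x _; rewrite lee_fin sqr_ge0.
- exact: measurable_funTS.
rewrite integral_cst//= mul1e lte_add_pinfty//; first exact: compact_finite_measure.
apply: le_lt_trans goo; apply: ge0_subset_integral => //.
by move=> x _; rewrite lee_fin sqr_ge0.
Qed.

Lemma integrable_eta_mul M (g : MR -> MR) : measurable_fun setT g -> (N2 g < +oo)%E ->
  mu.-integrable setT (EFin \o (fun x => eta M x * g x)).
Proof.
move=> mg goo; have me := measurable_eta M.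
have mf : measurable_fun setT (fun x => eta M x * g x : MR) by exact: measurable_funM.
apply/integrableP; split; first exact/measurable_EFinP.
pose K : set MR := `[- (M + 1), M + 1]%classic.
have cK : compact K by exact: segment_compact.
apply: le_lt_trans (N2_locally_integrable mg goo cK (measurable_itv _)).
rewrite [leRHS]integral_mkcond; apply: ge0_le_integral => //.
- by apply: measurableT_comp => //; exact/measurable_EFinP.
- apply/(measurable_restrictT _ _).1; first exact: measurable_itv.
  by apply: measurable_funTS; apply: measurableT_comp => //; exact/measurable_EFinP.
move=> x _; rewrite patchE; case: ifPn => [_|nK].
  rewrite lee_fin normrM ler_piMl// ger0_norm ?eta_ge0//; exact: eta_le1.
rewrite /= eta_eq0 ?mul0r ?normr0//.
rewrite ltNge; apply: contra nK => xM.
by rewrite inE /K/= in_itv/= -ler_norml.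
Qed.

Definition mollify g (n : nat) : R -> R := convo (molln n) (fun x => eta n%:R x * g x).

Lemma csmooth_mollify (g : MR -> MR) n : measurable_fun setT g -> (N2 g < +oo)%E ->
  csmooth (mollify g n).
Proof.
move=> mg goo; apply: (@csmooth_conv _ _ _ (n%:R + 1)).
- exact: csmooth_molln.
- exact: integrable_eta_mul.
- by move=> y yM; rewrite eta_eq0 ?mul0r.
Qed.

Lemma mollify_bounded : exists2 C : R, 0 <= C & forall (g : MR -> MR) n,
  measurable_fun setT g -> (N2 g < +oo)%E -> (H12sqR (mollify g n) <= C%:E * H12sqR g)%E.
Proof.
have [C C0 HC] := H12sqR_cutoff; exists C => // g n mg goo.
apply: le_trans (HC n%:R g mg); apply: H12sqR_conv.
- exact: csmooth_molln.
- exact: molln_ge0.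
- exact: integral_molln.
- exact: integrable_eta_mul.
Qed.

(** The kernel at z lives on [z, z + 1/N], inside the ball of radius 2/N, and is bounded by [N * B].
    The condition on [n] makes the cutoff equal 1 there, so the error is an average of deviations of
    [g] from [g z]. *)
Lemma mollify_le_davg : exists2 B : R, 0 <= B & forall (g : MR -> MR) n (z : R),
  measurable_fun setT g -> (N2 g < +oo)%E -> `|z| + 1 <= n%:R ->
  (`|mollify g n z - g z|%:E <= B%:E * davg g z (2 / n.+1%:R))%E.
Proof.
have [B B0 mB] := @moll_bounded R.
exists (4 * B) => [|g n z mg goo zn]; first by rewrite mulr_ge0.
set N : R := n.+1%:R; have N0 : 0 < N by [].
have cr := csmooth_molln n; have mr := csmooth_measurable cr.
have ib := integrable_eta_mul n%:R mg goo; have me := measurable_eta n%:R.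
pose a x := eta n%:R x * g x.
have ma : measurable_fun setT (a : MR -> MR) by exact: measurable_funM.
have [C _ rC] := csmooth_bounded cr.
have i1 : mu.-integrable setT (EFin \o (fun y => a (y + z) * molln n y)).
  exact: (integrable_mul_bounded (integrable_shift z ib) mr rC).
have i2 : mu.-integrable setT (EFin \o (fun y => g z * molln n y)).
  by have := integrableZl measurableT (g z) (csmooth_integrable cr); apply: eq_integrable.
have i3 : mu.-integrable setT (EFin \o (fun y => a (y + z) * molln n y - g z * molln n y)).
  by have := integrableB measurableT i1 i2; apply: eq_integrable.
have -> : mollify g n z - g z = \int[mu]_y (a (y + z) * molln n y - g z * molln n y).
  rewrite /mollify (conv_shift _ cr ib) RintegralB// RintegralZl ?integral_molln ?mulr1//.
  exact: csmooth_integrable.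
pose D := ball z (2 / N); have mD : measurable (D : set MR) by exact: measurable_ball.
pose F (y : R) : \bar R := ((N * B)%:E * `|(g y - g z)%:E| * (\1_D y)%:E)%E.
have mF : measurable_fun setT (F : MR -> \bar R).
  apply: emeasurable_funM; last by apply/measurable_EFinP; exact: measurable_indic.
  apply: measurable_funeM; apply: measurableT_comp => //; apply/measurable_EFinP.
  exact: measurable_funB.
have F0 y : (0 <= F y)%E by rewrite /F !mule_ge0// lee_fin ?mulr_ge0// ltW.
apply: (@le_trans _ _ (\int[mu]_y F (y + z)%R)%E).
  rewrite /Rintegral -abse_EFin fineK; last exact: (integrable_fin_num measurableT i3).
  apply: le_trans (le_abse_integral _ _ _) _ => //; first by case/integrableP: i3.
  apply: ge0_le_integral => //.
  - by apply: measurableT_comp => //; case/integrableP: i3.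
  - by apply: (measurableT_comp mF); exact: measurable_funD.
  move=> y _; rewrite -mulrBl.
  have [y01|ny] := boolP (0 <= y <= N^-1); last first.
    by rewrite molln_supp// mulr0 abse0 F0.
  have /andP[y0 yN] := y01.
  have yD : D (y + z).
    rewrite /D /ball/= opprD addrA addrAC subrr sub0r normrN ger0_norm//.
    by apply: le_lt_trans yN _; rewrite -[ltLHS]mul1r ltr_pM2r ?invr_gt0// ltr1n.
  have N1 : N^-1 <= 1 by rewrite invf_le1// ler1n.
  have -> : a (y + z) = g (y + z).
    rewrite /a eta_eq1 ?mul1r//; apply: le_trans (ler_normD _ _) _.
    by rewrite (ger0_norm y0) addrC (le_trans _ zn)// lerD2l (le_trans yN).
  rewrite /F indicE mem_set// mule1 abse_EFin -EFinM lee_fin normrM mulrC ler_wpM2r//.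
  by rewrite /molln normrM gtr0_norm// ler_pM2l.
rewrite (lebesgue_shift z mF F0) /F.
have mg1 : measurable_fun setT (fun y : MR => `|(g y - g z)%:E|)%E.
  by apply: measurableT_comp => //; apply/measurable_EFinP; exact: measurable_funB.
have -> : (\int[mu]_y ((N * B)%:E * `|(g y - g z)%:E| * (\1_D y)%:E) =
    (N * B)%:E * \int[mu]_(y in D) `|(g y - g z)%:E|)%E.
  rewrite [X in (_ * X)%E]integral_mkcond -ge0_integralZl//.
  - apply: eq_integral => y _; rewrite patchE indicE -muleA; congr (_ * _)%E.
    by case: ifP => _; rewrite ?mule1 ?mule0.
  - by apply/(measurable_restrictT _ _).1 => //; exact: measurable_funTS.
  - by move=> y _; rewrite patchE; case: ifP.
  - by rewrite lee_fin mulr_ge0// ltW.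
rewrite /davg /iavg lebesgue_measure_ball; last by rewrite divr_ge0// ltW.
(* The ball has measure 4 / N, and [N * B] is [4 * B] divided by it. *)
rewrite muleA (_ : (N * B)%:E = ((4 * B)%:E * ((2 / N) *+ 2)%:E^-1)%E); last first.
  rewrite inver ifF; last by rewrite mulrn_eq0/= mulf_eq0 invr_eq0 gt_eqF// pnatr_eq0.
  by rewrite -EFinM; congr EFin; rewrite -mulr_natl; field; rewrite gt_eqF.
exact: lexx.
Qed.

(** At a Lebesgue point of [g] the mean deviation over shrinking balls tends to 0, and by Lebesgue
    differentiation almost every point is one. *)
Lemma mollify_cvg_ae (g : MR -> MR) : measurable_fun setT g -> (N2 g < +oo)%E ->
  exists Z : set MR, [/\ measurable Z, mu Z = 0 &
    forall z, ~ Z z -> mollify g n z @[n --> \oo] --> g z].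
Proof.
move=> mg goo; have [B B0 HB] := mollify_le_davg.
have locg : locally_integrable setT g.
  split => //; first exact: openT.
  move=> K _ cK; apply: N2_locally_integrable => //; exact: compact_measurable.
have [Z [mZ Z0 ZP]] := lebesgue_differentiation locg.
exists Z; split => // z nZ.
have leb : lebesgue_pt g z by apply: contrapT => h; apply: nZ; exact: ZP.
have c0 : davg g z (2 / n.+1%:R) @[n --> \oo] --> 0%E.
  apply: (cvg_comp _ _ _ leb) => P [e e0 eP].
  have cN : 2 / n.+1%:R @[n --> \oo] --> (0 : R).
    by rewrite -[X in _ --> X](mulr0 2); apply: cvgMr; exact: cvg_harmonic.
  suff : \forall n \near \oo, P (davg g z (2 / n.+1%:R)) by [].
  near=> n; apply: (eP (2 / n.+1%:R)); last by rewrite /= divr_gt0.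
  near: n; move/cvgrPdist_lt : cN; exact.
have /fine_cvgP[fin cf] := c0.
apply/cvgrPdist_le => e e0.
have eB : 0 < e / (B + 1) by rewrite divr_gt0// ltr_pwDr.
near=> n; rewrite distrC.
have zn : `|z| + 1 <= n%:R by near: n; exact: nbhs_infty_ger.
have := HB g n z mg goo zn.
have fn : davg g z (2 / n.+1%:R) \is a fin_num by near: n.
rewrite -(fineK fn) -EFinM lee_fin => /le_trans; apply.
have : `|fine (davg g z (2 / n.+1%:R))| <= e / (B + 1).
  rewrite -normrN -sub0r; near: n; move/cvgrPdist_le : cf; exact.
rewrite ler_norml => /andP[_ h]; apply: le_trans (ler_wpM2l B0 h) _.
rewrite mulrCA ger_pMr// ler_pdivrMr ?mul1r ?lerDl// ltr_pwDr//.
Unshelve. all: by end_near. Qed.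

(* Near-minimizers of the [H^(1/2)] norm over shrinking convex sets of bounded
   sequences converging pointwise form a Cauchy sequence by the parallelogram
   identity; this turns boundedness and pointwise convergence of the
   mollifications into norm convergence. *)
Lemma csmooth_dense (g : MR -> MR) : measurable_fun setT g -> (H12sqR g < +oo)%E ->
  exists c : nat -> R -> R, (forall n, csmooth (c n)) /\
    forall e : R, 0 < e -> exists N, forall n, (N <= n)%N ->
      (H12sqR (fun x => c n x - g x)%R <= e%:E)%E.
Proof.
move=> mg goo.
have Ng : (N2 g < +oo)%E.
  apply: le_lt_trans goo; rewrite /H12sqR leeDl//.
  by apply: integral_ge0 => x _; exact: gagl_ge0.
have [K K0 HK] := mollify_bounded.
have gfin : H12sqR g \is a fin_num by rewrite ge0_fin_numE// H12sqR_ge0.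
pose M := K * fine (H12sqR g).
have aM n : (H12sqR (mollify g n) <= M%:E)%E by rewrite /M EFinM fineK// HK.
have ca n := csmooth_mollify n mg Ng.
pose mid (f h : R -> R) x := 2^-1 * (f x + h x).
(* Membership asks that at each z the error of [c] be at most any bound valid for all mollifications
   of index at least [n]. This is a convex condition, and it transfers pointwise convergence from
   the mollifications to any choice of members of [C n]. *)
pose C n (c : R -> R) := [/\ csmooth c, (H12sqR c <= M%:E)%E &
  forall z (e : R), (forall m, (n <= m)%N -> `|mollify g m z - g z| <= e) -> `|c z - g z| <= e].
pose J (c : R -> R) := fine (H12sqR c).
have finH c : (H12sqR c <= M%:E)%E -> H12sqR c \is a fin_num.
  by move=> h; rewrite ge0_fin_numE ?H12sqR_ge0// (le_lt_trans h)// ltry.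
have par f h : csmooth f -> csmooth h -> (H12sqR f <= M%:E)%E -> (H12sqR h <= M%:E)%E ->
  [/\ H12sqR (mid f h) \is a fin_num, H12sqR (fun x => f x - h x) \is a fin_num &
   J f + J h = 2 * J (mid f h) + 2^-1 * fine (H12sqR (fun x => f x - h x))].
  move=> cf ch Mf Mh.
  have mf := csmooth_measurable cf; have mh := csmooth_measurable ch.
  have e := H12sqR_parallelogram mf mh.
  have fd : H12sqR (fun x => f x - h x) \is a fin_num.
    rewrite ge0_fin_numE ?H12sqR_ge0//; apply: le_lt_trans (H12sqRB mf mh) _.
    by rewrite -(fineK (finH _ Mf)) -(fineK (finH _ Mh)) -EFinD -EFinM ltry.
  have fm : H12sqR (mid f h) \is a fin_num.
    rewrite ge0_fin_numE ?H12sqR_ge0//.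
    have l : (2%:E * H12sqR (mid f h) < +oo)%E.
      apply: (@le_lt_trans _ _ (H12sqR f + H12sqR h)%E).
        by rewrite e leeDl// mule_ge0// H12sqR_ge0.
      by rewrite -(fineK (finH _ Mf)) -(fineK (finH _ Mh)) -EFinD ltry.
    by rewrite ltNge leye_eq; apply/negP => /eqP h1; move: l; rewrite h1 gt0_muley ?lte_fin.
  split => //; apply: EFin_inj.
  rewrite !EFinD !EFinM /J !fineK//; [exact: finH..].
have leJ c : (H12sqR c <= M%:E)%E -> J c <= M by move=> h; rewrite -lee_fin /J fineK ?finH.
have [v [Cv _ cauchy]] : exists v : nat -> R -> R, [/\ forall n, C n (v n),
    forall e : R, 0 < e -> exists N, forall n x, (N <= n)%N -> C n x -> J (v n) <= J x + e &
    forall e : R, 0 < e -> exists N, forall i j, (N <= i)%N -> (N <= j)%N ->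
      J (v i) + J (v j) - 2 * J (mid (v i) (v j)) <= e].
  apply: (@near_minimizers _ _ mid C J 0 M).
  - by move=> n c _; rewrite /J fine_ge0// H12sqR_ge0.
  - move=> n; exists (mollify g n); last exact: leJ.
    by split => // z e; apply.
  - move=> i j c ij [cc Mc hc]; split => // z e he; apply: hc => m jm.
    by apply: he; exact: leq_trans jm.
  - move=> n f h [cf Mf hf] [ch Mh hh].
    have [fm fd e] := par _ _ cf ch Mf Mh.
    split.
    + have := csmooth_lin 2^-1 2^-1 cf ch.
      by congr csmooth; apply/funext => x; rewrite /mid mulrDr.
    + rewrite -(fineK fm) lee_fin.
      have h1 := leJ _ Mf; have h2 := leJ _ Mh.
      have h3 : 0 <= fine (H12sqR (fun x => f x - h x)) by rewrite fine_ge0// H12sqR_ge0.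
      rewrite -/(J (mid f h)); lra.
    + move=> z d hd; rewrite /mid.
      have := hf z d hd; have := hh z d hd; rewrite !ler_norml => /andP[h1 h2] /andP[h3 h4].
      by apply/andP; split; lra.
exists v; split; first by move=> n; have [] := Cv n.
have [Z [mZ Z0 cvgZ]] := mollify_cvg_ae mg Ng.
(* Setting the functions to 0 on the exceptional set turns almost everywhere convergence into
   convergence everywhere, as Fatou is stated, at no cost in norm. *)
pose w (f : R -> R) x := f x * \1_(~` Z) x.
have mw (f : MR -> MR) : measurable_fun setT f -> measurable_fun setT (w f : MR -> MR).
  by move=> mf; apply: measurable_funM => //; apply: measurable_indic; exact: measurableC.
have mv n : measurable_fun setT (v n : MR -> MR).
  by have [cv _ _] := Cv n; exact: csmooth_measurable.
have wE f x : ~ Z x -> w f x = f x by move=> nZ; rewrite /w indicE mem_set ?mulr1.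
have w0 f x : Z x -> w f x = 0 by move=> nZ; rewrite /w indicE memNset ?mulr0//=; exact.
have cw x : w (v n) x @[n --> \oo] --> w g x.
  have [Zx|nZ] := pselect (Z x).
    by rewrite w0//; under eq_fun do rewrite w0//; exact: cvg_cst.
  rewrite wE//; under eq_fun do rewrite wE//.
  apply/cvgrPdist_le => e e0.
  have /cvgrPdist_le/(_ _ e0)[N _ NP] := cvgZ x nZ.
  exists N => // n /= Nn; have [_ _] := Cv n; rewrite distrC; apply => m nm.
  by rewrite distrC; apply: NP; exact: leq_trans Nn nm.
(* The midpoint gap is half the squared norm of the difference, so a gap of e / 4 bounds that norm
   by e / 2; Fatou doubles it to e. *)
move=> e e0; have e4 : 0 < e / 4 by rewrite divr_gt0.
have [N NP] := cauchy _ e4; exists N => n Nn.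
have -> : e%:E = ((e / 2)%:E + (e / 2)%:E)%E by rewrite -EFinD; congr EFin; field.
have aeE (f h : MR -> MR) : measurable_fun setT f -> measurable_fun setT h ->
    H12sqR (fun x => f x - h x) = H12sqR (fun x => w f x - w h x).
  move=> mf mh; apply: (H12sqR_ae mZ Z0).
  - exact: measurable_funB.
  - by apply: measurable_funB; exact: mw.
  - by move=> x nZ; rewrite !wE.
rewrite aeE//; apply: (H12sqR_fatou (f_ := fun k x => w (v n) x - w (v k) x)).
- by move=> k; apply: measurable_funB; exact: mw.
- by move=> x; apply: cvgB; [exact: cvg_cst|exact: cw].
exists N => // k /= Nk; rewrite -aeE//.
have [cn Mn _] := Cv n; have [ck Mk _] := Cv k.
have [fm fd E] := par _ _ cn ck Mn Mk.
have := NP _ _ Nn Nk; rewrite E => h.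
rewrite -(fineK fd) lee_fin; lra.
Qed.

End density.

(** * Weak solutions with real data *)

Section jets.
Context {R : realType}.
Local Notation MR := (measurableTypeR R).
Local Notation mu := (@lebesgue_measure R).
Local Notation S := (strip R : set (MR * MR)).
Local Notation jet := (nat -> R * R -> R).
Implicit Types (f g F G : R * R -> R) (k : nat) (u v w : jet).

Definition testR k F := CinftyR k F /\ supported_in (half_plane R) F.
Definition test0R k F := CinftyR k F /\ supported_in (half_closed_strip R) F.

Lemma test0R_test k F : test0R k F -> testR k F.
Proof.
move=> [hF [K [cK KA hK]]]; split => //; exists K; split => //.
by move=> x /KA /andP[].
Qed.

Lemma testR_lin k a b F G : testR k F -> testR k G -> testR k (fun x => a * F x + b * G x).
Proof. by move=> [hF sF] [hG sG]; split; [exact: CinftyR_lin|exact: supported_in_lin]. Qed.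

Lemma test0R_lin k a b F G : test0R k F -> test0R k G -> test0R k (fun x => a * F x + b * G x).
Proof. by move=> [hF sF] [hG sG]; split; [exact: CinftyR_lin|exact: supported_in_lin]. Qed.

Lemma test0R_trace k F z : test0R k F -> F (1, z) = 0.
Proof.
move=> [_ [K [_ KA hK]]]; apply: hK; rewrite /half_plane//=.
by move=> /KA; rewrite /half_closed_strip/= ltxx andbF.
Qed.

Let mS := @measurable_strip R.
Let mf := @measurable_fst_strip R.
Let w0 := @strip_gt0 R.

Lemma sqR_cvg0 (d : nat -> R * R -> R) (C M : R) : (forall n, measurable_fun S (d n)) ->
  (forall n x, S x -> `|d n x| <= C) -> (forall n x, S x -> M < `|x.2| -> d n x = 0) ->
  (forall x, S x -> d n x @[n --> \oo] --> (0 : R)) ->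
  forall e : R, 0 < e -> exists N, forall n, (N <= n)%N -> sqR (d n) <= e.
Proof.
move=> md dC dM d0 e e0.
have Ld n : L2R (d n) by apply: bounded_L2R (md n) (dC n) (dM n).
have := @dominated_cvg _ _ _ (leb2 R) S mS (fun n x => (d n x ^+ 2 * x.1)%:E) (fun=> 0%E)
  (fun x => (C ^+ 2 * \1_(zbox M) x)%:E).
have h1 n : measurable_fun S (fun x => (d n x ^+ 2 * x.1)%:E).
  by apply: measurable_weighted; exact: measurable_funX.
have h2 x : S x -> (d n x ^+ 2 * x.1)%:E @[n --> \oo] --> 0%E.
  move=> Sx; apply: cvg_EFin; first exact: nearW.
  rewrite -[X in _ --> X](mul0r x.1); apply: cvgMl.
  by rewrite -[X in _ --> X](mul0r (0 : R)); apply: cvgM; exact: d0.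
have h3 (x : MR * MR) : S x -> (C ^+ 2 * \1_(zbox M) x)%:E \is a fin_num by [].
have h4 n x : S x -> (`|(d n x ^+ 2 * x.1)%:E| <= (C ^+ 2 * \1_(zbox M) x)%:E)%E.
  move=> Sx; have /andP[x0 x1] := Sx.
  rewrite abse_EFin lee_fin normrM normrX (gtr0_norm x0).
  rewrite indicE; have [xM|xM] := boolP (x \in _).
    rewrite mulr1 -[leRHS]mulr1.
    apply: ler_pM; rewrite ?sqr_ge0//; [exact: ltW| |exact: ltW].
    by rewrite ler_sqr ?nnegrE// ?dC// (le_trans _ (dC n _ Sx)).
  rewrite dM// ?normr0 ?expr0n/= ?mul0r ?mulr0//.
  by move: xM; rewrite notin_setE zboxE ltNge => /negP.
move=> /(_ h1 h2 h3 (integrable_zbox _ _) h4).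
rewrite integral0 => /fine_cvgP[_ /cvgrPdist_le/(_ e e0)[N _ NP]].
exists N => n Nn; have := NP n Nn; rewrite sub0r normrN => h.
rewrite -lee_fin sqRE//.
have fn : (\int[leb2 R]_(x in S) (d n x ^+ 2 * x.1)%:E)%E \is a fin_num by rewrite -sqRE.
by rewrite -(fineK fn) lee_fin (le_trans (ler_norm _) h).
Qed.

Definition jlin (s : R) u (t : R) v : jet := fun j x => s * u j x + t * v j x.
Definition LJ u := forall j, L2R (u j).
Definition eqJ u v := forall j x, S x -> u j x = v j x.

(** The energy form without the factor $2\pi$ of $L^2_1$; the factor returns only when complex norms
    are split into parts. *)
Definition aJ u v : R :=
  ipR (u 1%N) (v 1%N) + 2^-1 * ipR (u 2%N) (v 2%N) + 2^-1 * ipR (u 3%N) (v 3%N).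
Definition sqJ u : R := sqR (u 0%N) + aJ u u.

Lemma LJ_lin s u t v : LJ u -> LJ v -> LJ (jlin s u t v).
Proof.
by move=> Lu Lv j; exact: (wL2D mS mf w0 (wL2Z mS mf w0 s (Lu j)) (wL2Z mS mf w0 t (Lv j))).
Qed.

Lemma LJ_eq u v : eqJ u v -> LJ u -> LJ v.
Proof. by move=> uv Lu j; apply: eq_wL2 (Lu j) => x; exact: uv. Qed.

Lemma ipR_lin s f t g h : L2R f -> L2R g -> L2R h ->
  ipR (fun x => s * f x + t * g x) h = s * ipR f h + t * ipR g h.
Proof.
move=> Lf Lg Lh; rewrite /ipR.
have Lsf := wL2Z mS mf w0 s Lf; have Ltg := wL2Z mS mf w0 t Lg.
by rewrite (wipDl mS mf w0 Lsf Ltg Lh) (wipZl mS mf w0 s Lf Lh) (wipZl mS mf w0 t Lg Lh).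
Qed.

Lemma ipRC f g : ipR f g = ipR g f.
Proof. exact: wipC. Qed.

Lemma aJC u v : aJ u v = aJ v u.
Proof. by rewrite /aJ ipRC (ipRC (u 2%N)) (ipRC (u 3%N)). Qed.

Lemma aJ_lin s u t v w : LJ u -> LJ v -> LJ w ->
  aJ (jlin s u t v) w = s * aJ u w + t * aJ v w.
Proof. by move=> Lu Lv Lw; rewrite /aJ /jlin !ipR_lin//; ring. Qed.

Lemma aJ_linr s u t v w : LJ u -> LJ v -> LJ w ->
  aJ w (jlin s u t v) = s * aJ w u + t * aJ w v.
Proof. by move=> Lu Lv Lw; rewrite aJC aJ_lin// aJC (aJC v). Qed.

Lemma eq_aJ u u' v v' : eqJ u u' -> eqJ v v' -> aJ u v = aJ u' v'.
Proof.
move=> uu vv; rewrite /aJ; congr (_ + _ * _ + _ * _); apply: eq_wip; by [exact: uu|exact: vv].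
Qed.

Lemma sqR_ge0 f : 0 <= sqR f.
Proof. by apply: wsq_ge0; exact: strip_gt0. Qed.

Lemma aJ_ge0 u : 0 <= aJ u u.
Proof. by rewrite !addr_ge0 ?mulr_ge0//; exact: sqR_ge0. Qed.

Lemma sqJ_ge0 u : 0 <= sqJ u.
Proof. by rewrite addr_ge0 ?aJ_ge0 ?sqR_ge0. Qed.

Lemma eq_sqR f g : (forall x, S x -> f x = g x) -> sqR f = sqR g.
Proof. by move=> fg; apply: eq_wip. Qed.

Lemma eq_sqJ u v : eqJ u v -> sqJ u = sqJ v.
Proof. by move=> uv; rewrite /sqJ (eq_aJ uv uv) (eq_sqR (uv 0%N)). Qed.

Lemma sqJ_sq u j : (j < 4)%N -> sqR (u j) <= 2 * sqJ u.
Proof.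
have := sqR_ge0 (u 1%N); have := sqR_ge0 (u 2%N); have := sqR_ge0 (u 3%N); have := sqR_ge0 (u 0%N).
rewrite /sqJ /aJ /sqR /wsq /ipR.
by case: j => [|[|[|[|j]]]]// *; lra.
Qed.

Lemma sqJ_le u (c : R) : (forall j, (j < 4)%N -> sqR (u j) <= c) -> sqJ u <= 3 * c.
Proof.
move=> h; have := h 0%N isT; have := h 1%N isT; have := h 2%N isT; have := h 3%N isT.
by rewrite /sqJ /aJ /sqR /wsq /ipR => *; lra.
Qed.

Lemma ip_young (t : R) f g : 0 < t -> L2R f -> L2R g -> `|2 * ipR f g| <= t * sqR f + t^-1 * sqR g.
Proof. by move=> t0 Lf Lg; exact: (wip_young mS mf w0). Qed.

Lemma aJ_young (t : R) u v : 0 < t -> LJ u -> LJ v -> `|2 * aJ u v| <= t * aJ u u + t^-1 * aJ v v.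
Proof.
have key (c d p q r p1 q1 r1 p2 q2 r2 : R) : `|2 * p| <= c * p1 + d * p2 ->
    `|2 * q| <= c * q1 + d * q2 -> `|2 * r| <= c * r1 + d * r2 ->
    `|2 * (p + 2^-1 * q + 2^-1 * r)| <=
      c * (p1 + 2^-1 * q1 + 2^-1 * r1) + d * (p2 + 2^-1 * q2 + 2^-1 * r2).
  rewrite !ler_norml => /andP[a1 a2] /andP[b1 b2] /andP[c1 c2].
  by apply/andP; split; lra.
move=> t0 Lu Lv; have h j := ip_young t0 (Lu j) (Lv j).
exact: (key _ _ _ _ _ _ _ _ _ _ _ (h 1%N) (h 2%N) (h 3%N)).
Qed.

Lemma sqR_lin s f t g : L2R f -> L2R g ->
  sqR (fun x => s * f x + t * g x) = s ^+ 2 * sqR f + 2 * s * t * ipR f g + t ^+ 2 * sqR g.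
Proof.
move=> Lf Lg; pose X x := s * f x + t * g x.
have LX : L2R X := wL2D mS mf w0 (wL2Z mS mf w0 s Lf) (wL2Z mS mf w0 t Lg).
change (ipR X X = s ^+ 2 * ipR f f + 2 * s * t * ipR f g + t ^+ 2 * ipR g g).
rewrite (ipR_lin s t Lf Lg LX) (ipRC f X) (ipRC g X) (ipR_lin s t Lf Lg Lf) (ipR_lin s t Lf Lg Lg).
by rewrite (ipRC g f); ring.
Qed.

Lemma sqR_lin2 s f t g : L2R f -> L2R g ->
  sqR (fun x => s * f x + t * g x) <= 2 * s ^+ 2 * sqR f + 2 * t ^+ 2 * sqR g.
Proof.
move=> Lf Lg; have := sqR_ge0 (fun x => s * f x + (- t) * g x).
rewrite !sqR_lin// sqrrN => h; rewrite -subr_ge0.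
by apply: le_trans h _; rewrite le_eqVlt; apply/orP; left; apply/eqP; ring.
Qed.

Lemma sqJ_lin2 s u t v : LJ u -> LJ v ->
  sqJ (jlin s u t v) <= 2 * s ^+ 2 * sqJ u + 2 * t ^+ 2 * sqJ v.
Proof.
have key (c d o p q r o1 p1 q1 r1 o2 p2 q2 r2 : R) : o <= c * o1 + d * o2 ->
    p <= c * p1 + d * p2 -> q <= c * q1 + d * q2 -> r <= c * r1 + d * r2 ->
    o + (p + 2^-1 * q + 2^-1 * r) <= c * (o1 + (p1 + 2^-1 * q1 + 2^-1 * r1)) +
      d * (o2 + (p2 + 2^-1 * q2 + 2^-1 * r2)) by move=> *; lra.
move=> Lu Lv; have h j := sqR_lin2 s t (Lu j) (Lv j).
exact: (key _ _ _ _ _ _ _ _ _ _ _ _ _ _ (h 0%N) (h 1%N) (h 2%N) (h 3%N)).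
Qed.

Lemma aJ_lin2 s u t v : LJ u -> LJ v ->
  aJ (jlin s u t v) (jlin s u t v) = s ^+ 2 * aJ u u + 2 * s * t * aJ u v + t ^+ 2 * aJ v v.
Proof.
move=> Lu Lv; have L := LJ_lin s t Lu Lv.
by rewrite aJ_lin// !aJ_linr// (aJC v u); ring.
Qed.

Definition jcvg (x_ : nat -> jet) x := forall e : R, 0 < e ->
  exists N, forall n, (N <= n)%N -> sqJ (jlin 1 (x_ n) (-1) x) <= e.

Lemma aJ_le_sqJ u : aJ u u <= sqJ u.
Proof. by rewrite /sqJ lerDr sqR_ge0. Qed.

Lemma jcvg_components (x_ : nat -> jet) x : (forall j, (j < 4)%N -> forall e : R, 0 < e ->
    exists N, forall n, (N <= n)%N -> sqR (jlin 1 (x_ n) (-1) x j) <= e) -> jcvg x_ x.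
Proof.
move=> h e e0; have e3 : 0 < e / 3 by rewrite divr_gt0.
have [N0 P0] := h 0%N isT _ e3; have [N1 P1] := h 1%N isT _ e3.
have [N2 P2] := h 2%N isT _ e3; have [N3 P3] := h 3%N isT _ e3.
exists (maxn (maxn N0 N1) (maxn N2 N3)) => n; rewrite !geq_max => /andP[/andP[n0 n1] /andP[n2 n3]].
have -> : e = 3 * (e / 3) by field.
apply: sqJ_le => j j4.
by case: j j4 => [|[|[|[|j]]]]// _; [exact: P0|exact: P1|exact: P2|exact: P3].
Qed.

Lemma jcomplete (x_ : nat -> jet) : (forall n, LJ (x_ n)) ->
  (forall e : R, 0 < e -> exists N, forall i j, (N <= i)%N -> (N <= j)%N ->
     sqJ (jlin 1 (x_ i) (-1) (x_ j)) <= e) ->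
  exists2 x, LJ x & jcvg x_ x.
Proof.
move=> Lx cx.
have ex j : exists f, (j < 4)%N -> L2R f /\ forall e : R, 0 < e -> exists N, forall n, (N <= n)%N ->
    sqR (fun x => x_ n j x - f x) <= e.
  have [j4|j4] := boolP (j < 4)%N; last by exists (fun=> 0).
  have [|f Lf cf] := wL2_complete mS mf w0 (fun n => Lx n j); last by exists f.
  move=> e e0; have e2 : 0 < e / 2 by rewrite divr_gt0.
  have [N NP] := cx _ e2; exists N => i l Ni Nl.
  have := sqJ_sq (jlin 1 (x_ i) (-1) (x_ l)) j4 => h.
  change (sqR (fun x => x_ i j x - x_ l j x) <= e).
  rewrite (@eq_sqR _ (jlin 1 (x_ i) (-1) (x_ l) j)); last by move=> x _; rewrite /jlin; ring.
  by apply: le_trans h _; have := NP _ _ Ni Nl; lra.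
have [y yP] := choice ex.
exists (fun j => if (j < 4)%N then y j else fun=> 0).
  move=> j; case: ifPn => j4; first by have [] := yP _ j4.
  exact: wL2_0.
apply: jcvg_components => j j4 e e0; have [_ /(_ e e0)[N NP]] := yP j j4.
exists N => n Nn; apply: le_trans (NP n Nn).
by rewrite le_eqVlt; apply/orP; left; apply/eqP; apply: eq_sqR => x _; rewrite /jlin j4; ring.
Qed.

Lemma test_LJ k F : testR k F -> LJ (jetR k F).
Proof. by move=> [hF sF] j; exact: L2R_jetR. Qed.

Lemma jetR_jlin k s F t G : testR k F -> testR k G ->
  eqJ (jetR k (fun x => s * F x + t * G x)) (jlin s (jetR k F) t (jetR k G)).
Proof. by move=> [hF _] [hG _] j x Sx; apply: (jetR_lin s t j hF hG); exact: strip_gt0 Sx. Qed.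

Definition in_H10R k u := LJ u /\ exists2 phi : nat -> R * R -> R,
  (forall n, test0R k (phi n)) & jcvg (fun n => jetR k (phi n)) u.

(** Equal to [step (N * (1 - r) - 1)]: 1 up to distance 2 / N from r = 1, and 0 within distance 1 /
    N. The expanded form fits the rule for affine substitutions. *)
Definition cutR (N r : R) : R := step (- N * r + (N - 1)).

Lemma cutRE (N r : R) : cutR N r = step (N * (1 - r) - 1).
Proof. by congr step; ring. Qed.

Lemma cutR_eq1 (N r : R) : 0 < N -> r <= 1 - 2 / N -> cutR N r = 1.
Proof.
move=> N0 h; rewrite cutRE step_eq1//.
have : 2 / N <= 1 - r by lra.
by rewrite ler_pdivrMr// mulrC; lra.
Qed.

Lemma cutR_eq0 (N r : R) : 0 < N -> 1 - N^-1 <= r -> cutR N r = 0.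
Proof.
move=> N0 h; rewrite cutRE step_eq0// subr_le0.
by rewrite -ler_pdivlMl// mulr1; lra.
Qed.

Lemma test0R_cutR k F (N : R) : 2 < N -> testR k F -> test0R k (fun x => cutR N x.1 * F x).
Proof.
move=> N2 [hF sF]; have N0 : 0 < N by exact: lt_trans N2.
split.
  apply: (@CinftyR_cutoff _ _ (1 - 2 / N)) => //.
  - by rewrite subr_gt0 ltr_pdivrMr// mul1r.
  - by move=> m; apply: nderivable_affine; exact: smooth_step.
  - by move=> r /ltW; exact: cutR_eq1.
have [M FM] := supported_bounded sF.
exists (`[0, 1 - N^-1] `*` `[- M, M]); split; first exact: compact_box.
  move=> x [/=]; rewrite in_itv/= /half_closed_strip/= => /andP[-> xn] _ /=.
  by apply: le_lt_trans xn _; rewrite ltrBlDr ltrDl invr_gt0.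
move=> x x0 nK; have [xM|xM] := leP `|x.2| M; last by rewrite FM// mulr0.
rewrite cutR_eq0 ?mul0r//; rewrite leNgt; apply/negP => xn; apply: nK; split.
  by rewrite /= in_itv/= x0 ltW.
by rewrite /= in_itv/= -ler_norml.
Qed.

Lemma is_derive_cutR (N r : R) : is_derive r 1 (cutR N) (- N * moll (N * (1 - r) - 1)).
Proof.
rewrite -(_ : - N * r + (N - 1) = N * (1 - r) - 1); last by ring.
exact: (@is_derive_affine R (@step R) (- N) (N - 1) r _ (is_derive_step _)).
Qed.

(** The r-derivative is half of $D_k F + D_{-k} F$, hence bounded on the strip; the mean value
    theorem between r and 1 gives linear decay. *)
Lemma trace0_le k F : testR k F -> (forall z, F (1, z) = 0) ->
  exists2 C : R, 0 <= C & forall x, S x -> `|F x| <= C * (1 - x.1).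
Proof.
move=> [hF sF] F1.
have [C2 [M2 [C20 h2 _]]] := jetR_bounded 2 hF sF.
have [C3 [M3 [C30 h3 _]]] := jetR_bounded 3 hF sF.
exists (C2 + C3) => [|x Sx]; first exact: addr_ge0.
have /andP[x0 x1] := Sx; have [[_ rF] _ _] := hF.
have dF (r : R) : 0 < r -> is_derive r 1 (fun r => F (r, x.2)) (drR F (r, x.2)).
  by move=> r0; exact: (derivable_is_derive1 (rF 0%N 0%N 0%N (r, x.2) r0)).
have cF : {within `[x.1, 1], continuous (fun r => F (r, x.2))}.
  apply: derivable_within_continuous => r; rewrite in_itv/= => /andP[xr _].
  by have [] := dF r (lt_le_trans x0 xr).
have [|c] := @MVT R (fun r => F (r, x.2)) (fun r => drR F (r, x.2)) x.1 1 x1 _ cF.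
  by move=> r; rewrite in_itv/= => /andP[xr _]; apply: dF; exact: lt_trans xr.
rewrite in_itv/= => /andP[xc c1]; rewrite F1 sub0r => e.
have Sc : S (c, x.2) by rewrite /strip/= (lt_trans x0 xc).
rewrite (surjective_pairing x) -normrN e normrM (gtr0_norm (_ : 0 < 1 - x.1)) ?subr_gt0//=.
rewrite ler_wpM2r ?subr_ge0 ?(ltW x1)//.
have := h2 _ Sc; have := h3 _ Sc; rewrite /= /calDR mulrNz mulNr mulNr.
set D := drR F _; set q := _ / _ * _; rewrite !ler_norml.
by move=> /andP[a1 a2] /andP[b1 b2]; apply/andP; split; lra.
Qed.

(** Multiply [F] by [cutR N]. The derivative of the cutoff has size [N], but lives where
    [1 - r <= 2 / N], and there [|F| <= 2 * C / N]. So the extra term [p] is bounded uniformly and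
    is eventually 0 at each point of the strip; dominated convergence removes it. *)
Lemma trace0_H10R k F : testR k F -> (forall z, F (1, z) = 0) -> in_H10R k (jetR k F).
Proof.
move=> tF F1; split; first exact: test_LJ.
(* Starting above 2 keeps [1 - 2 / N] positive, so that the cutoff is 1 near the axis. *)
have [hF sF] := tF; pose N n : R := n.+4%:R.
have N2 n : 2 < N n by rewrite ltr_nat.
have N0 n : 0 < N n by exact: lt_trans (N2 n).
exists (fun n x => cutR (N n) x.1 * F x) => [n|]; first exact: test0R_cutR.
have [C C0 FC] := trace0_le tF F1.
have [B B0 mB] := @moll_bounded R.
pose d n j x := 1 * jetR k (fun x => cutR (N n) x.1 * F x) j x + -1 * jetR k F j x.
have [[zF rF] _ _] := hF.
pose p (n : nat) (x : R * R) := - N n * moll (N n * (1 - x.1) - 1) * F x.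
have drE n x : S x -> drR (fun x => cutR (N n) x.1 * F x) x = cutR (N n) x.1 * drR F x + p n x.
  move=> /strip_gt0 x0; apply: is_derive_derive1.
  have := is_deriveM (is_derive_cutR (N n) x.1) (derivable_is_derive1 (rF 0%N 0%N 0%N x x0)).
  move=> /is_derive_ext; apply => //.
  change (cutR (N n) x.1 * drR F x + F (x.1, x.2) * (- N n * moll (N n * (1 - x.1) - 1)) =
    cutR (N n) x.1 * drR F x + p n x).
  by rewrite -surjective_pairing /p (mulrC (F x)).
have dE n j x : S x -> d n j x = (cutR (N n) x.1 - 1) * jetR k F j x +
    (if (j == 2%N) || (j == 3%N) then p n x else 0).
  move=> Sx; rewrite /d; case: j => [|[|[|[|j]]]] /=.
  - by ring.
  - have -> : dzR (fun x => cutR (N n) x.1 * F x) x = cutR (N n) x.1 * dzR F x.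
      apply: is_derive_derive1.
      exact: (is_deriveZ (cutR (N n) x.1) (derivable_is_derive1 (zF 0%N x (strip_gt0 Sx)))).
    by ring.
  - by rewrite /calDR drE//; ring.
  - by rewrite /calDR drE//; ring.
  - by ring.
have p_bd n x : S x -> `|p n x| <= 2 * B * C.
  move=> Sx; have n0 := N0 n.
  have /andP[x0 x1] := Sx; rewrite /p !normrM normrN (gtr0_norm n0).
  have [h|h] := boolP (0 <= N n * (1 - x.1) - 1 <= 1); last first.
    by rewrite moll_eq0// normr0 mulr0 mul0r !mulr_ge0.
  apply: (@le_trans _ _ (N n * B * (C * (1 - x.1)))).
    apply: ler_pM => //; last exact: FC.
      by apply: mulr_ge0 => //; exact: ltW.
    by apply: ler_wpM2l => //; exact: ltW.
  have : N n * (1 - x.1) <= 2 by case/andP: h => _; lra.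
  move=> /(ler_wpM2r (mulr_ge0 B0 C0)) => h'; apply: le_trans (le_trans _ h') _.
    by rewrite le_eqVlt; apply/orP; left; apply/eqP; ring.
  by rewrite mulrA.
have pd0 x : S x -> \forall n \near \oo, cutR (N n) x.1 = 1 /\ p n x = 0.
  move=> /andP[x0 x1]; have h : 0 < 1 - x.1 by rewrite subr_gt0.
  near=> n.
  have n2 : 2 / (1 - x.1) < N n.
    apply: (@lt_le_trans _ _ n%:R); last by rewrite /N ler_nat -addn4 leq_addr.
    near: n; exact: nbhs_infty_gtr.
  have h2 : 1 < N n * (1 - x.1) - 1 by move: n2; rewrite ltr_pdivrMr//; lra.
  split; first by rewrite cutRE step_eq1// ltW.
  by rewrite /p moll_eq0 ?mulr0 ?mul0r// negb_and -!ltNge h2 orbT.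
have key j e : 0 < e -> exists N, forall n, (N <= n)%N -> sqR (d n j) <= e.
  have [Cj [M [Cj0 jC jM]]] := jetR_bounded j hF sF.
  have [M' FM] := supported_bounded sF.
  apply: (@sqR_cvg0 _ (Cj + 2 * B * C) (Num.max M M')).
  - move=> n; have [hn _] := test0R_cutR (N2 n) tF.
    by apply: measurable_funD; apply: measurable_funM => //; exact: measurable_jetR.
  - move=> n x Sx; rewrite dE//; apply: le_trans (ler_normD _ _) _; apply: lerD.
      rewrite normrM -[leRHS]mul1r; apply: ler_pM => //; last exact: jC.
      have := step_ge0 (N n * (1 - x.1) - 1); have := step_le1 (N n * (1 - x.1) - 1).
      by rewrite -cutRE => ? ?; rewrite ler_norml; apply/andP; split; lra.
    by case: ifP => _; [exact: p_bd|rewrite normr0 !mulr_ge0].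
  - move=> n x Sx; rewrite gt_max => /andP[xM xM']; rewrite dE// jM// mulr0 add0r.
    by rewrite /p FM ?mulr0 ?if_same//; exact/ltW/strip_gt0.
  - move=> x Sx; apply: cvg_near_cst; apply: filterS (pd0 x Sx) => n [c1 pn].
    by rewrite dE// c1 subrr mul0r pn if_same addr0.
by apply: jcvg_components => j j4; exact: key.
Unshelve. all: by end_near. Qed.

End jets.

(** * The energy estimate and existence for real data *)

Section real_weak_solutions.
Context {R : realType}.
Local Notation MR := (measurableTypeR R).
Local Notation mu := (@lebesgue_measure R).
Local Notation S := (strip R : set (MR * MR)).
Local Notation jet := (nat -> R * R -> R).
Implicit Types (f F G : R * R -> R) (g c : R -> R) (k : nat) (u v w : jet).

Definition traceR k u g := exists phi : nat -> R * R -> R,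
  [/\ forall n, testR k (phi n), jcvg (fun n => jetR k (phi n)) u &
    forall e : R, 0 < e -> exists N, forall n, (N <= n)%N ->
      (H12sqR (fun z => phi n (1, z) - g z)%R <= e%:E)%E].

Definition weakR k f g u := [/\ LJ u, traceR k u g &
  forall v, in_H10R k v -> aJ u v + ipR f (v 0%N) = 0].

Lemma aJE u : aJ u u = sqR (u 1%N) + 2^-1 * sqR (u 2%N) + 2^-1 * sqR (u 3%N).
Proof. by []. Qed.

Lemma ipR_linr s F t G f : L2R F -> L2R G -> L2R f ->
  ipR f (fun x => s * F x + t * G x) = s * ipR f F + t * ipR f G.
Proof. by move=> LF LG Lf; rewrite ipRC ipR_lin// !(ipRC f). Qed.

Lemma testR_trace k F : testR k F -> csmooth (fun z => F (1, z)).
Proof. by move=> [hF sF]; exact: (trace_csmooth ltr01 hF sF). Qed.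

Lemma sqJ_poincare k F : testR k F -> (forall z, F (1, z) = 0) ->
  sqJ (jetR k F) <= 2 * aJ (jetR k F) (jetR k F).
Proof.
move=> [hF sF] F1; have := poincareR hF sF F1.
have := sqR_ge0 (jetR k F 1); rewrite /sqJ aJE /= => *; lra.
Qed.

Lemma jcvg_lin s (x_ : nat -> jet) (x : jet) t (y_ : nat -> jet) (y : jet) : (forall n, LJ (x_ n)) -> LJ x ->
  (forall n, LJ (y_ n)) -> LJ y -> jcvg x_ x -> jcvg y_ y ->
  jcvg (fun n => jlin s (x_ n) t (y_ n)) (jlin s x t y).
Proof.
move=> Lx_ Lx Ly_ Ly cx cy e e0.
pose K := 2 * s ^+ 2 + 2 * t ^+ 2 + 1.
have s0 := sqr_ge0 s; have t0 := sqr_ge0 t; have K0 : 0 < K by rewrite /K; lra.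
have [N NP] := cx (e / K) (divr_gt0 e0 K0); have [M MP] := cy (e / K) (divr_gt0 e0 K0).
exists (maxn N M) => n; rewrite geq_max => /andP[Nn Mn].
set D := jlin 1 (x_ n) (-1) x; set D' := jlin 1 (y_ n) (-1) y.
have -> : sqJ (jlin 1 (jlin s (x_ n) t (y_ n)) (-1) (jlin s x t y)) = sqJ (jlin s D t D').
  by apply: eq_sqJ => j p _; rewrite /D /D' /jlin; ring.
apply: le_trans (sqJ_lin2 s t (LJ_lin 1 (-1) (Lx_ n) Lx) (LJ_lin 1 (-1) (Ly_ n) Ly)) _.
have h1 := NP n Nn; have h2 := MP n Mn; have a0 := sqJ_ge0 D; have b0 := sqJ_ge0 D'.
have eK : e = K * (e / K) by rewrite mulrCA mulfV ?mulr1// gt_eqF.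
have eK0 : 0 < e / K by exact: divr_gt0.
rewrite [leRHS]eK (_ : K * (e / K) = 2 * s ^+ 2 * (e / K) + 2 * t ^+ 2 * (e / K) + e / K); last first.
  by move: (e / K) => q; rewrite /K; ring.
rewrite -[leLHS]addr0; apply: lerD; last exact: ltW.
by apply: lerD; apply: ler_wpM2l => //; rewrite mulr_ge0.
Qed.

Lemma eq_jcvg (x_ y_ : nat -> jet) (x y : jet) : (forall n, eqJ (x_ n) (y_ n)) -> eqJ x y ->
  jcvg x_ x -> jcvg y_ y.
Proof.
move=> xy_ xy cx e e0; have [N NP] := cx e e0; exists N => n Nn.
apply: le_trans (NP n Nn); rewrite le_eqVlt; apply/orP; left; apply/eqP.
by apply: eq_sqJ => j p Sp; rewrite /jlin xy_// xy.
Qed.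

(** The weak form is continuous in the test jet for the $H^1_{(k)}$ norm, so it need only be checked
    on the dense class of test functions. *)
Lemma functional_cvg u f (x_ : nat -> jet) (x : jet) : LJ u -> L2R f -> (forall n, LJ (x_ n)) -> LJ x ->
  jcvg x_ x -> (forall n, aJ u (x_ n) + ipR f (x_ n 0%N) = 0) -> aJ u x + ipR f (x 0%N) = 0.
Proof.
move=> Lu Lf Lx_ Lx cx h; apply/eqP; rewrite -normr_eq0 eq_le normr_ge0 andbT.
apply/ler_addgt0Pr => e e0; rewrite add0r.
(* With [t = e / K] and [sqJ D <= t ^+ 2], Young's inequality with parameter [t] bounds both terms
   by multiples of [t] that add up to at most [e]. *)
pose K := aJ u u + sqR f + 2.
have au0 := aJ_ge0 u; have f0 := sqR_ge0 f; have K0 : 0 < K by rewrite /K; lra.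
pose t := e / K; have t0 : 0 < t by exact: divr_gt0.
have t20 : 0 < t ^+ 2 by exact: exprn_gt0.
have [N NP] := cx _ t20; have {NP} := NP N (leqnn N); set D := jlin _ _ _ _ => hD.
have LD : LJ D by exact: LJ_lin.
have e1 : aJ u x + ipR f (x 0%N) = - (aJ u D + ipR f (D 0%N)).
  have := h N; rewrite /D (aJ_linr 1 (-1) (Lx_ N) Lx Lu) (ipR_linr 1 (-1) (Lx_ N 0%N) (Lx 0%N) Lf).
  by move=> ?; lra.
have y1 := aJ_young t0 Lu LD; have y2 := ip_young t0 Lf (LD 0%N).
have s1 : t^-1 * sqJ D <= t.
  by rewrite ler_pdivrMl// -expr2.
have s2 : t^-1 * sqJ D = t^-1 * sqR (D 0%N) + t^-1 * aJ D D by rewrite -mulrDr.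
have eK : e = t * aJ u u + t * sqR f + 2 * t.
  by rewrite -(mulrC t 2) -!mulrDr -/K /t mulrAC -mulrA mulfV ?mulr1// gt_eqF.
rewrite e1 normrN; move: y1 y2; rewrite !ler_norml => /andP[a1 a2] /andP[b1 b2].
by apply/andP; split; lra.
Qed.

Lemma H12sqR_sub (a b : MR -> MR) (d : R) : measurable_fun setT a -> measurable_fun setT b ->
  (H12sqR a <= d%:E)%E -> (H12sqR b <= d%:E)%E ->
  (H12sqR (fun x => a x - b x)%R <= (4 * d)%:E)%E.
Proof.
move=> ma mb ad bd; apply: le_trans (H12sqRB ma mb) _.
rewrite (_ : 4 * d = 2 * (d + d)); last by ring.
rewrite (EFinM 2) (EFinD d); apply: lee_wpmul2l; first by rewrite lee_fin.
exact: leeD.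
Qed.

Lemma bdlift_lin s c t g x : csmooth c -> csmooth g ->
  bdlift (fun z => s * c z + t * g z) x = s * bdlift c x + t * bdlift g x.
Proof.
move=> cc cg; rewrite /bdlift /avg.
have i1 := continuous_integrable 0 1 (@continuous_avg_integrand R 0 c (x.1 - 1) x.2 (csmooth_continuous cc)).
have i2 := continuous_integrable 0 1 (@continuous_avg_integrand R 0 g (x.1 - 1) x.2 (csmooth_continuous cg)).
have i1' : mu.-integrable `[0, 1] (EFin \o (fun y => s * (y ^+ 0 * c (x.2 + (x.1 - 1) * y)))).
  by have := @integrableZl _ _ _ mu `[0, 1]%classic (measurable_itv _) s _ i1; apply: eq_integrable.
have i2' : mu.-integrable `[0, 1] (EFin \o (fun y => t * (y ^+ 0 * g (x.2 + (x.1 - 1) * y)))).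
  by have := @integrableZl _ _ _ mu `[0, 1]%classic (measurable_itv _) t _ i2; apply: eq_integrable.
rewrite (@eq_Rintegral _ _ _ mu _ (fun y => s * (y ^+ 0 * c (x.2 + (x.1 - 1) * y)) +
   t * (y ^+ 0 * g (x.2 + (x.1 - 1) * y)))); last by move=> y _; ring.
rewrite RintegralD//; rewrite RintegralZl//; rewrite RintegralZl//.
by rewrite mulrDr; congr (_ + _); exact: mulrCA.
Qed.

Lemma testR_lift k c : csmooth c -> testR k (bdlift c).
Proof. by move=> cc; split; [exact: CinftyR_liftG|exact: supported_lift]. Qed.

Lemma sqJ_lift k : exists2 C : R, 0 <= C & forall c, csmooth c ->
  ((sqJ (jetR k (bdlift c)))%:E <= C%:E * H12sqR c)%E.
Proof.
(* The added 1 keeps the constant positive, so that the right side is infinite when the norm of [c]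
   is. *)
have [C C0 HC] := @lift_bound R k; exists (3 * C + 1) => [|c cc]; first by lra.
have H0 := H12sqR_ge0 c.
have [->|] := eqVneq (H12sqR c) +oo%E.
  by rewrite gt0_muley ?leey// lte_fin; lra.
rewrite -ltey => Hoo; have Hf : H12sqR c \is a fin_num by rewrite ge0_fin_numE.
rewrite -(fineK Hf) -EFinM lee_fin.
have h j : sqR (jetR k (bdlift c) j) <= C * fine (H12sqR c).
  by have := HC c j cc; rewrite -{1}(fineK Hf) -EFinM lee_fin.
apply: le_trans (sqJ_le (fun j _ => h j)) _.
have := fine_ge0 H0; rewrite mulrA mulrDl mul1r; lra.
Qed.

(** The jet [u] is only a limit, whereas the approximant [F] has a smooth trace [c] that can be
    lifted. The difference [psi] vanishes at r = 1, hence is admissible in the equation and obeys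
    Poincare. With jets [X], [Y], [P] of [F], the lift and [psi], and [D = X - u], the equation
    bounds [aJ P P] by [D], [Y] and [f]. *)
Lemma energy_estimate k : exists2 C : R, 0 <= C & forall f g u, L2R f ->
  measurable_fun setT (g : MR -> MR) -> weakR k f g u ->
  ((sqJ u)%:E <= C%:E * ((sqR f)%:E + H12sqR g))%E.
Proof.
have [C C0 HC] := sqJ_lift k.
(* The chain below ends in [34 * sqJ D + 36 * sqJ Y + 32 * sqR f], where [sqJ D <= e] and
   [sqJ Y <= 2 * C * (e + H)]. This explains 72, and the factor [34 + 72 * C] of [e]. *)
exists (32 + 72 * C) => [|f g u Lf mg [Lu [phi [tphi cphi cH]] wk]]; first by lra.
have f0 := sqR_ge0 f; have H0 := H12sqR_ge0 g.
have [->|] := eqVneq (H12sqR g) +oo%E.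
  by rewrite addey// gt0_muley ?leey// lte_fin; lra.
rewrite -ltey => Hoo; have Hf : H12sqR g \is a fin_num by rewrite ge0_fin_numE.
rewrite -(fineK Hf) -EFinD -EFinM lee_fin; set H := fine (H12sqR g).
have Hge : 0 <= H by exact: fine_ge0.
apply/ler_addgt0Pr => e' e'0; pose e := e' / (34 + 72 * C).
have K0 : 0 < 34 + 72 * C by lra.
have e0 : 0 < e by exact: divr_gt0.
have [N1 P1] := cphi e e0; have [N2 P2] := cH e e0.
pose n := maxn N1 N2; have {P1} := P1 n (leq_maxl _ _); have {P2} := P2 n (leq_maxr _ _).
set F := phi n; set D := jlin _ _ _ _ => hH hD.
have tF : testR k F by exact: tphi.
pose c z := F (1, z); have cc : csmooth c by exact: (testR_trace tF).
have tL := testR_lift k cc.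
pose psi p := 1 * F p + -1 * bdlift c p; have tpsi : testR k psi by exact: testR_lin.
have psi1 z : psi (1, z) = 0 by rewrite /psi lift_trace /c; ring.
pose X := jetR k F; pose Y := jetR k (bdlift c); pose P := jetR k psi.
have LX : LJ X by exact: test_LJ. have LY : LJ Y by exact: test_LJ.
have LP : LJ P by exact: test_LJ. have LD : LJ D by exact: LJ_lin.
have PE : eqJ P (jlin 1 X (-1) Y) by exact: jetR_jlin.
have wkP : aJ u P + ipR f (P 0%N) = 0 by apply: wk; exact: trace0_H10R.
have aP : aJ P P = aJ D P - ipR f (P 0%N) - aJ Y P.
  rewrite {1}(eq_aJ PE (fun _ _ _ => erefl)) aJ_lin// /D aJ_lin//; lra.
have p1 : sqR (P 0%N) <= aJ P P.
  by have := sqJ_poincare tpsi psi1; rewrite /sqJ; lra.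
have p2 : sqJ P <= 2 * aJ P P by exact: sqJ_poincare.
(* Parameter 4 puts a quarter of the energy of [P] into each of the three products, against
   [2 * aJ P P] on the left, so it can be absorbed. *)
have t4 : 0 < 4 :> R by [].
have y1 := aJ_young t4 LD LP; have y2 := ip_young t4 Lf (LP 0%N); have y3 := aJ_young t4 LY LP.
have d1 := aJ_le_sqJ D; have d2 := aJ_le_sqJ Y.
have aP4 : aJ P P <= 4 * (aJ D D + aJ Y Y + sqR f).
  move: y1 y2 y3; rewrite !ler_norml => /andP[a1 a2] /andP[b1 b2] /andP[c1 c2].
  by clear - aP p1 a1 a2 b1 b2 c1 c2; lra.
have s1 : sqJ u <= 2 * sqJ X + 2 * sqJ D.
  have := sqJ_lin2 1 (-1) LX LD; rewrite sqrrN !expr1n !mulr1; apply: le_trans.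
  by rewrite le_eqVlt; apply/orP; left; apply/eqP; apply: eq_sqJ => j p _; rewrite /D /X /jlin; ring.
have s2 : sqJ X <= 2 * sqJ P + 2 * sqJ Y.
  have := sqJ_lin2 1 1 LP LY; rewrite !expr1n !mulr1; apply: le_trans.
  by rewrite le_eqVlt; apply/orP; left; apply/eqP; apply: eq_sqJ => j p Sp; rewrite /jlin PE// /jlin; ring.
have mc := csmooth_measurable cc.
have Hc : (H12sqR c <= (2 * (e + H))%:E)%E.
  have m1 : measurable_fun setT (fun z => c z - g z : MR) by exact: measurable_funB.
  have m2 : measurable_fun setT (fun z => -1 * g z : MR) by exact: measurable_funM.
  have := H12sqRB m1 m2; rewrite H12sqRZ// sqrrN expr1n mul1e => h.
  rewrite (_ : c = fun x => c x - g x - -1 * g x); last by apply/funext => z; ring.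
  apply: le_trans h _; rewrite (EFinM 2) (EFinD e); apply: lee_wpmul2l; first by rewrite lee_fin.
  apply: leeD => //.
  by rewrite /H fineK.
have sY : sqJ Y <= C * (2 * (e + H)).
  by rewrite -lee_fin; apply: le_trans (HC c cc) _; rewrite EFinM lee_wpmul2l// lee_fin.
have eE : e' = (34 + 72 * C) * e by rewrite mulrCA mulfV ?mulr1// gt_eqF.
have bound : sqJ u <= 34 * sqJ D + 36 * sqJ Y + 32 * sqR f.
  by clear - s1 s2 p2 aP4 d1 d2; lra.
apply: (le_trans bound).
have Cf : 0 <= C * sqR f by rewrite mulr_ge0.
have h36 : 36 * sqJ Y <= 72 * (C * e) + 72 * (C * H).
  by move: sY; rewrite [C * _](_ : _ = 2 * (C * e) + 2 * (C * H)); [clear; lra|ring].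
rewrite eE (_ : (32 + 72 * C) * (sqR f + H) + (34 + 72 * C) * e =
  32 * sqR f + 72 * (C * sqR f) + 32 * H + 72 * (C * H) + 34 * e + 72 * (C * e)); last by ring.
by clear - h36 Cf Hge hD; lra.
Qed.

Lemma weakR_sub k f g u f' g' u' : L2R f -> L2R f' -> measurable_fun setT (g : MR -> MR) ->
  measurable_fun setT (g' : MR -> MR) -> weakR k f g u -> weakR k f' g' u' ->
  weakR k (fun x => 1 * f x + -1 * f' x) (fun z => g z - g' z) (jlin 1 u (-1) u').
Proof.
move=> Lf Lf' mg mg' [Lu [phi [tphi cphi cH]] wk] [Lu' [phi' [tphi' cphi' cH']] wk'].
split.
- exact: LJ_lin.
- exists (fun n x => 1 * phi n x + -1 * phi' n x); split.
  + by move=> n; exact: testR_lin.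
  + apply: (@eq_jcvg (fun n => jlin 1 (jetR k (phi n)) (-1) (jetR k (phi' n))) _ (jlin 1 u (-1) u')) => //.
      by move=> n j x Sx; exact/esym/jetR_jlin.
    by apply: jcvg_lin => // n; exact: test_LJ.
  + move=> e e0; have e4 : 0 < e / 4 by rewrite divr_gt0.
    have [N NP] := cH _ e4; have [M MP] := cH' _ e4.
    exists (maxn N M) => n; rewrite geq_max => /andP[Nn Mn].
    rewrite (_ : (fun z => _) = (fun z => (phi n (1, z) - g z) - (phi' n (1, z) - g' z))); last first.
      by apply/funext => z; ring.
    rewrite (_ : e = 4 * (e / 4)); last by field.
    apply: H12sqR_sub; [| |exact: NP|exact: MP].
      by apply: measurable_funB => //; exact: csmooth_measurable (testR_trace (tphi n)).
    by apply: measurable_funB => //; exact: csmooth_measurable (testR_trace (tphi' n)).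
- move=> v hv; have [Lv _] := hv.
  rewrite aJ_lin// ipR_lin//; have := wk v hv; have := wk' v hv; lra.
Qed.

(** Taking [t = - l / (A + 1)] gives [l ^+ 2 * (A + 1) <= l ^+ 2 * A]. This turns minimality into
    the Euler-Lagrange equation. *)
Lemma linear_le_quadratic (l A : R) : 0 <= A -> (forall t : R, - (t * l) <= t ^+ 2 * A) -> l = 0.
Proof.
move=> A0 h; have := h (- l / (A + 1)).
have A1 : 0 < A + 1 by lra.
rewrite mulNr mulNr opprK sqrrN expr_div_n => h1.
apply/eqP; rewrite -sqrf_eq0 eq_le sqr_ge0 andbT.
have h2 : l ^+ 2 * (A + 1) <= l ^+ 2 * A.
  have := ler_wpM2l (ltW (exprn_gt0 2 A1)) h1.
  rewrite (_ : (A + 1) ^+ 2 * (l / (A + 1) * l) = l ^+ 2 * (A + 1)); last by field; rewrite gt_eqF.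
  by rewrite (_ : (A + 1) ^+ 2 * (l ^+ 2 / (A + 1) ^+ 2 * A) = l ^+ 2 * A); last by field; rewrite gt_eqF.
by move: h2; rewrite mulrDr mulr1; lra.
Qed.

Lemma exists_weakR k f g : L2R f -> measurable_fun setT (g : MR -> MR) ->
  (H12sqR g < +oo)%E -> exists u, weakR k f g u.
Proof.
move=> Lf mg goo.
have [c [cc cg]] := csmooth_dense mg goo.
have mc n := csmooth_measurable (cc n).
have mB n : measurable_fun setT (fun z => c n z - g z : MR).
  by apply: measurable_funB => //; exact: mc.
have [C C0 HC] := sqJ_lift k.
have tW n := testR_lift k (cc n).
pose W n := jetR k (bdlift (c n)).
have LW n : LJ (W n) by exact: test_LJ.
have [w Lw cw] : exists2 w, LJ w & jcvg W w.
  apply: jcomplete => // e e0; pose d := e / (4 * C + 1).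
  have K0 : 0 < 4 * C + 1 by lra.
  have d0 : 0 < d by exact: divr_gt0.
  have [N NP] := cg d d0; exists N => i j Ni Nj.
  have cij := csmooth_lin 1 (-1) (cc i) (cc j).
  have -> : sqJ (jlin 1 (W i) (-1) (W j)) = sqJ (jetR k (bdlift (fun z => 1 * c i z + -1 * c j z))).
    apply: eq_sqJ => l x Sx; rewrite -(jetR_jlin 1 (-1) (tW i) (tW j) l Sx).
    by congr (jetR k _ l x); apply/funext => y; rewrite bdlift_lin.
  have Hij : (H12sqR (fun z => (1 * c i z + -1 * c j z)%R) <= (4 * d)%:E)%E.
    rewrite (_ : (fun z => _) = (fun z => (c i z - g z) - (c j z - g z))); last by apply/funext => z; ring.
    by apply: H12sqR_sub; [exact: mB|exact: mB|exact: NP|exact: NP].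
  rewrite -lee_fin; apply: le_trans (HC _ cij) _.
  apply: (@le_trans _ _ (C%:E * (4 * d)%:E)%E); first by rewrite lee_wpmul2l// lee_fin.
  have eE : e = (4 * C + 1) * d by rewrite mulrCA mulfV ?mulr1// gt_eqF.
  rewrite -EFinM lee_fin [leRHS]eE (_ : (4 * C + 1) * d = C * (4 * d) + d); last by ring.
  by rewrite lerDl ltW.
(* [w] is the limit of the lifts and carries the boundary data. The energy of [w + X] is minimized
   over test functions [X] supported away from r = 1; the load acts on [X] only, which changes the
   energy by a constant. *)
pose E X := 2^-1 * aJ (jlin 1 w 1 X) (jlin 1 w 1 X) + ipR f (X 0%N).
have EE X : LJ X -> E X = 2^-1 * aJ w w + aJ w X + 2^-1 * aJ X X + ipR f (X 0%N).
  by move=> LX; rewrite /E aJ_lin2//; field.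
have eqE X Y : eqJ X Y -> E X = E Y.
  move=> XY; rewrite /E; congr (_ * _ + _).
    by apply: eq_aJ => j x Sx; rewrite /jlin XY.
  by apply: eq_wip => // x Sx; exact: XY.
pose mid (F G : R * R -> R) x := 2^-1 * F x + 2^-1 * G x.
have T0 F := @test0R_test R k F.
have LT F (tF : test0R k F) : LJ (jetR k F) := test_LJ (T0 _ tF).
have midE F G : test0R k F -> test0R k G ->
    eqJ (jetR k (mid F G)) (jlin 2^-1 (jetR k F) 2^-1 (jetR k G)).
  by move=> tF tG; apply: jetR_jlin; exact: T0.
have par F G : test0R k F -> test0R k G ->
    E (jetR k F) + E (jetR k G) - 2 * E (jetR k (mid F G)) =
    4^-1 * aJ (jlin 1 (jetR k F) (-1) (jetR k G)) (jlin 1 (jetR k F) (-1) (jetR k G)).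
  move=> tF tG; have LF := LT _ tF; have LG := LT _ tG.
  rewrite (eqE _ _ (midE _ _ tF tG)) !EE//; last exact: LJ_lin.
  by rewrite aJ_linr// !aJ_lin2// ipR_linr//; field.
(* Young with parameter 4 costs an eighth of [aJ X X] for each of the two linear terms, by Poincare
   in the case of [f]; the quadratic half covers both. *)
pose m := - (2 * aJ w w + 2 * sqR f).
have Em F : test0R k F -> m <= E (jetR k F).
  move=> tF; have LF := LT _ tF; rewrite EE//.
  have [hF sF] := T0 _ tF.
  have p := poincareR hF sF (fun z => test0R_trace z tF).
  have t4 : 0 < 4 :> R by [].
  have := aJ_young t4 Lw LF; have := ip_young t4 Lf (LF 0%N).
  have p1 : sqR (jetR k F 0%N) <= aJ (jetR k F) (jetR k F).
    by apply: (le_trans p); rewrite aJE -addrA lerDr; exact: sqR_ge0.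
  have w0 := aJ_ge0 w; have F0 := aJ_ge0 (jetR k F); have f0 := sqR_ge0 f.
  rewrite /m !ler_norml => /andP[a1 a2] /andP[b1 b2]; lra.
have [v [tv vmin vcau]] : exists v : nat -> R * R -> R, [/\ forall n, test0R k (v n),
    forall e : R, 0 < e -> exists N, forall n F, (N <= n)%N -> test0R k F ->
      E (jetR k (v n)) <= E (jetR k F) + e &
    forall e : R, 0 < e -> exists N, forall i j, (N <= i)%N -> (N <= j)%N ->
      E (jetR k (v i)) + E (jetR k (v j)) - 2 * E (jetR k (mid (v i) (v j))) <= e].
  apply: (@near_minimizers _ _ mid (fun _ => test0R k) (fun F => E (jetR k F)) m (E (jetR k (fun=> 0)))).
  - by move=> _; exact: Em.
  - move=> _; exists (fun=> 0) => //; split; first exact: CinftyR0.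
    by exists set0; split => //; exact: compact0.
  - by [].
  - by move=> _ F G tF tG; exact: test0R_lin.
have [V LV cV] : exists2 V, LJ V & jcvg (fun n => jetR k (v n)) V.
  apply: jcomplete => [n|e e0]; first exact: LT.
  (* By [par] the midpoint gap is a quarter of the energy of the difference, and by Poincare its
     [sqJ] is at most twice that energy: 8 in all. *)
  have e8 : 0 < e / 8 by rewrite divr_gt0.
  have [N NP] := vcau _ e8; exists N => i j Ni Nj.
  have tij := test0R_lin 1 (-1) (tv i) (tv j).
  have := sqJ_poincare (T0 _ tij) (fun z => test0R_trace z tij).
  have eJ := jetR_jlin 1 (-1) (T0 _ (tv i)) (T0 _ (tv j)).
  rewrite (eq_sqJ eJ) (eq_aJ eJ eJ) => h.
  by have := NP _ _ Ni Nj; rewrite par// => h2; lra.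
pose u := jlin 1 w 1 V.
have Lu : LJ u by exact: LJ_lin.
exists u; split => //.
- exists (fun n x => 1 * bdlift (c n) x + 1 * v n x); split.
  + by move=> n; apply: testR_lin => //; exact: T0.
  + apply: (@eq_jcvg (fun n => jlin 1 (W n) 1 (jetR k (v n))) _ u) => //.
      by move=> n j x Sx; apply/esym/jetR_jlin => //; exact: T0.
    by apply: jcvg_lin => // n; exact: LT.
  + move=> e e0; have [N NP] := cg e e0; exists N => n Nn.
    rewrite (_ : (fun z => _) = (fun z => c n z - g z)); first exact: NP.
    by apply/funext => z; rewrite lift_trace (test0R_trace _ (tv n)); ring.
- have test0 F : test0R k F -> aJ u (jetR k F) + ipR f (jetR k F 0%N) = 0.
    move=> tF; have LX := LT _ tF; set X := jetR k F.
    apply: (@linear_le_quadratic _ (aJ X X)); first exact: aJ_ge0.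
    (* [E] is compared at [v n] and [v n + t F], both test functions, since near-minimality is known
       only there. Replacing [v n] by its limit [V] costs an error that Young splits into [e] and
       [t ^+ 2 * aJ X X]. *)
    move=> t; apply/ler_addgt0Pr => e e0.
    have e2 : 0 < e / 2 by rewrite divr_gt0.
    have [N NP] := vmin _ e2; have [M MP] := cV e e0.
    pose n := maxn N M; have {NP} := NP n _ (leq_maxl _ _) (test0R_lin 1 t (tv n) tF).
    have {MP} := MP n (leq_maxr _ _).
    have eJ := jetR_jlin 1 t (T0 _ (tv n)) (T0 _ tF).
    rewrite (eqE _ _ eJ); set Y := jetR k (v n); have LY : LJ Y := LT _ (tv n).
    rewrite -/X !EE//; last exact: LJ_lin.
    rewrite aJ_linr// aJ_lin2// ipR_linr// /u aJ_lin//.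
    have Ltx := LJ_lin t 0 LX LX; have LD := LJ_lin 1 (-1) LY LV.
    have := aJ_young ltr01 LD Ltx; rewrite (aJ_linr t 0 LX LX LD) (aJ_lin2 t 0 LX LX) (aJ_lin 1 (-1) LY LV LX).
    rewrite ler_norml => /andP[a1 a2] h1 h2; have := aJ_le_sqJ (jlin 1 Y (-1) V).
    move: a1 a2 h1 h2; set a := aJ w X; set b := aJ Y X; set d := aJ V X; set q := ipR f _.
    rewrite invr1 !mul1r !mulr0 !mul0r !expr0n/= !mul0r !addr0 !expr1n !mul1r.
    lra.
  move=> X [LX [phi tphi cphi]].
  apply: (functional_cvg Lu Lf _ LX cphi) => n; first exact: LT.
  exact: test0.
Qed.

End real_weak_solutions.

Local Open Scope complex_scope.

(** * Real and imaginary parts *)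

Section complex_parts.
Context {R : realType}.
Local Notation MR := (measurableTypeR R).
Local Notation mu := (@lebesgue_measure R).
Local Notation S := (strip R : set (MR * MR)).
Local Notation rjet := (nat -> R * R -> R).
Implicit Types (f h phi : R * R -> R[i]) (g : R -> R[i]) (k : nat) (b : bool) (u v : jet R).

(** The boolean lets one argument treat both parts: [false] is the real part, [true] the imaginary
    one. *)
Definition part b (w : R[i]) : R := if b then complex.Im w else complex.Re w.

Lemma partD b w w' : part b (w + w') = part b w + part b w'.
Proof. by case: b; case: w; case: w'. Qed.

Lemma partB b w w' : part b (w - w') = part b w - part b w'.
Proof. by case: b; case: w; case: w'. Qed.

Lemma partZ b (c : R) w : part b (c%:C * w) = c * part b w.
Proof. by case: b; case: w => x y /=; rewrite mul0r ?addr0 ?subr0. Qed.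

Lemma eq_parts (w w' : R[i]) : (forall b, part b w = part b w') -> w = w'.
Proof. by case: w w' => x y [x' y'] h; have := h false; have := h true => /= -> ->. Qed.

Lemma sqnormcE (w : R[i]) : sqnormc w = part false w ^+ 2 + part true w ^+ 2.
Proof. by case: w => x y; rewrite /sqnormc /= sqr_sqrtr// addr_ge0 ?sqr_ge0. Qed.

Lemma sqnormc_ge0 (w : R[i]) : 0 <= sqnormc w.
Proof. exact: sqr_ge0. Qed.

Definition pt b f : R * R -> R := fun x => part b (f x).
Definition of_parts (F : bool -> R * R -> R) : R * R -> R[i] := fun x => F false x +i* F true x.

Lemma pt_of_parts b F : pt b (of_parts F) = F b.
Proof. by case: b. Qed.

Lemma pt_dr b f : pt b (dr f) = drR (pt b f).
Proof. by case: b. Qed.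

Lemma pt_dz b f : pt b (dz f) = dzR (pt b f).
Proof. by case: b. Qed.

Lemma pt_iter_dz b m f : pt b (iter m (@dz R) f) = iter m (@dzR R) (pt b f).
Proof. by elim: m => //= m <-; rewrite pt_dz. Qed.

Lemma pt_calD b j f : pt b (calD j f) = calDR j (pt b f).
Proof. by apply/funext => x; rewrite /calDR -pt_dr /pt /calD partD partZ. Qed.

Lemma pt_calDn b n j f : pt b (calDn n j f) = calDnR n j (pt b f).
Proof. by elim: n => //= n <-; rewrite pt_calD. Qed.

Lemma pt_mixedD b k l i m f : pt b (mixedD k l i m f) = mixedDR k l i m (pt b f).
Proof. by rewrite /mixedD !pt_calDn pt_iter_dz. Qed.

Lemma dr_existsP f : dr_exists f <-> forall b, dr_existsR (pt b f).
Proof.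
split=> [h b x /h[hr hi]|h x x0]; first by case: b; [exact: hi|exact: hr].
by split; [exact: (h false)|exact: (h true)].
Qed.

Lemma dz_existsP f : dz_exists f <-> forall b, dz_existsR (pt b f).
Proof.
split=> [h b x /h[hr hi]|h x x0]; first by case: b; [exact: hi|exact: hr].
by split; [exact: (h false)|exact: (h true)].
Qed.

Lemma cwithin_continuousP A f :
  cwithin_continuous A f <-> forall b, {within A, continuous (pt b f)}.
Proof. by split=> [[h1 h2] []//|h]; split; [exact: (h false)|exact: (h true)]. Qed.

Lemma part_intmul b (n : int) (w : R[i]) : part b (n%:~R * w) = n%:~R * part b w.
Proof.
rewrite -[RHS]partZ; congr (part b (_ * _)).
by rewrite -(rmorph_int (real_complex R)).
Qed.

Lemma CinftyP k f : Cinfty k f <-> forall b, CinftyR k (pt b f).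
Proof.
split=> [[[zf rf] /cwithin_continuousP cf ef] b|h].
  split; first split.
  - by move=> m; rewrite -pt_iter_dz; exact: (dz_existsP _).1 (zf m) b.
  - by move=> l i m; rewrite -pt_mixedD; exact: (dr_existsP _).1 (rf l i m) b.
  - exact: cf.
  - move=> i n p inp; have [E [/cwithin_continuousP cE EE E0]] := ef i n p inp.
    exists (pt b E); split => //.
    + by move=> x x0; rewrite -pt_mixedD /pt EE.
    + by move=> z; rewrite /pt -part_intmul E0; case: b.
split; first split.
- by move=> m; apply/dz_existsP => b; rewrite pt_iter_dz; have [[]] := h b.
- by move=> l i m; apply/dr_existsP => b; rewrite pt_mixedD; have [[]] := h b.
- by apply/cwithin_continuousP => b; have [] := h b.
- move=> i n p inp.
  have ex b : exists E : R * R -> R,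
          [/\ {within half_plane R, continuous E},
              forall x, 0 < x.1 -> E x = mixedDR k (n - i) i (p - n) (pt b f) x &
              forall z : R, (k%:Z + n%:Z - 2 * i%:Z)%:~R * E (0, z) = 0].
    by have [_ _] := h b; apply.
  have [E EP] := choice ex.
  exists (of_parts E); split.
  + by apply/cwithin_continuousP => b; rewrite pt_of_parts; have [] := EP b.
  + move=> x x0; apply: eq_parts => b.
    transitivity (E b x); first by rewrite -[LHS]/(pt b (of_parts E) x) pt_of_parts.
    by have [_ -> // _] := EP b; rewrite -pt_mixedD.
  + move=> z; apply: eq_parts => b; transitivity (0 : R); last by case: b.
    have [_ _ /(_ z) e] := EP b; rewrite part_intmul -[RHS]e; congr (_ * _).
    by rewrite -[LHS]/(pt b (of_parts E) (0, z)) pt_of_parts.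
Qed.

Lemma supportedP A f : compactly_supported_in A f <-> forall b, supported_in A (pt b f).
Proof.
split=> [[K [cK KA hK]] b|h].
  by exists K; split => // x x0 nK; rewrite /pt hK//; case: b.
have [K0 [c0 A0 h0]] := h false; have [K1 [c1 A1 h1]] := h true.
exists (K0 `|` K1); split; [exact: compactU|by move=> x [/A0|/A1]|].
move=> x x0 nK; apply/eqP; rewrite eq_complex; apply/andP; split; apply/eqP.
  by apply: h0 => // Kx; apply: nK; left.
by apply: h1 => // Kx; apply: nK; right.
Qed.

Lemma testP k phi : test k phi -> forall b, exists2 F, testR k F &
  forall x, closed_strip R x -> pt b phi x = F x.
Proof.
move=> [F [/CinftyP hF /supportedP sF pF]] b; exists (pt b F); first by split.
by move=> x cx; rewrite /pt pF.
Qed.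

Lemma test0P k phi : test0 k phi -> forall b, exists2 F, test0R k F &
  forall x, closed_strip R x -> pt b phi x = F x.
Proof.
move=> [F [/CinftyP hF /supportedP sF pF]] b; exists (pt b F); first by split.
by move=> x cx; rewrite /pt pF.
Qed.

Lemma test_of_parts k F : (forall b, testR k (F b)) -> test k (of_parts F).
Proof.
move=> h; exists (of_parts F); split => //.
  by apply/CinftyP => b; rewrite pt_of_parts; have [] := h b.
by apply/supportedP => b; rewrite pt_of_parts; have [] := h b.
Qed.

Lemma test0_of_parts k F : (forall b, test0R k (F b)) -> test0 k (of_parts F).
Proof.
move=> h; exists (of_parts F); split => //.
  by apply/CinftyP => b; rewrite pt_of_parts; have [] := h b.
by apply/supportedP => b; rewrite pt_of_parts; have [] := h b.
Qed.

Lemma test0_test k phi : test0 k phi -> test k phi.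
Proof.
move=> [F [hF [K [cK KA hK]] e]]; exists F; split => //; exists K; split => //.
by move=> x /KA /andP[].
Qed.

Definition ptJ b u : rjet := fun j =>
  match j with
  | 0%N => pt b (jfun u)
  | 1%N => pt b (jz u)
  | 2%N => pt b (jp u)
  | 3%N => pt b (jm u)
  | _ => fun=> 0
  end.

Definition jet_of_parts (V : bool -> rjet) : jet R :=
  Jet (of_parts (fun b => V b 0%N)) (of_parts (fun b => V b 1%N))
      (of_parts (fun b => V b 2%N)) (of_parts (fun b => V b 3%N)).

Lemma ptJ_jet_of b k phi : ptJ b (jet_of k phi) = jetR k (pt b phi).
Proof. by apply/funext => -[|[|[|[|j]]]] //=; rewrite ?pt_dz ?pt_calD. Qed.

Lemma ptJ_jetB b u v : eqJ (ptJ b (jetB u v)) (jlin 1 (ptJ b u) (-1) (ptJ b v)).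
Proof.
by case=> [|[|[|[|j]]]] x _; rewrite /jlin /= ?mulr0 ?addr0// mul1r mulN1r /pt -partB.
Qed.

Lemma test_jet k phi b F : (forall x, closed_strip R x -> pt b phi x = F x) ->
  eqJ (ptJ b (jet_of k phi)) (jetR k F).
Proof. by move=> h j x Sx; rewrite ptJ_jet_of; exact: jetR_closed_strip. Qed.

Lemma test_jet_LJ k phi b : test k phi -> LJ (ptJ b (jet_of k phi)).
Proof.
move=> /testP/(_ b)[F tF e]; apply: LJ_eq (test_LJ tF) => j x Sx.
by rewrite (test_jet k e).
Qed.

Let pi2 : 0 < 2 * pi :> R.
Proof. by rewrite mulr_gt0// pi_gt0. Qed.

Let mS := @measurable_strip R.

Lemma L2sq_ge0 f : (0 <= L2sq f)%E.
Proof.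
apply: mule_ge0; first by rewrite lee_fin ltW.
apply: integral_ge0 => x /strip_gt0 x0.
by rewrite lee_fin mulr_ge0 ?sqnormc_ge0// ltW.
Qed.

Lemma L2sq_parts f : (forall b, measurable_fun S (pt b f)) ->
  L2sq f = ((2 * pi)%:E * (\int[leb2 R]_(x in S) (pt false f x ^+ 2 * x.1)%:E +
                           \int[leb2 R]_(x in S) (pt true f x ^+ 2 * x.1)%:E))%E.
Proof.
move=> mf; congr (_ * _)%E.
have m b : measurable_fun S (fun x => (pt b f x ^+ 2 * x.1)%:E).
  by apply: measurable_weighted; exact: measurable_funX.
have h b x : S x -> (0 <= (pt b f x ^+ 2 * x.1)%:E)%E.
  by move=> /strip_gt0 x0; rewrite lee_fin mulr_ge0 ?sqr_ge0// ltW.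
rewrite -ge0_integralD//; try solve [exact: h|exact: m].
by apply: eq_integral => x _; rewrite -EFinD sqnormcE mulrDl.
Qed.

Lemma L2sqE f : (forall b, L2R (pt b f)) ->
  L2sq f = (2 * pi * (sqR (pt false f) + sqR (pt true f)))%:E.
Proof.
move=> Lf; rewrite L2sq_parts; last by move=> b; have [] := Lf b.
by rewrite (EFinM (2 * pi)) EFinD !sqRE.
Qed.

Lemma sqrte_lty (x : \bar R) : (0 <= x)%E -> (sqrte x < +oo)%E -> (x < +oo)%E.
Proof. by case: x => [r| |]//= _ _; exact: ltry. Qed.

Lemma lty_sqrte (x : \bar R) : (x < +oo)%E -> (sqrte x < +oo)%E.
Proof. by case: x => //= r _; rewrite ltry. Qed.

Lemma in_L2P f : in_L2 f <-> forall b, L2R (pt b f).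
Proof.
split=> [[[mr mi] /(sqrte_lty (L2sq_ge0 f)) foo] b|Lf].
  have mf c : measurable_fun S (pt c f) by case: c; [exact: mi|exact: mr].
  split; first exact: mf.
  have h c : (0 <= \int[leb2 R]_(x in S) (pt c f x ^+ 2 * x.1)%:E)%E.
    by apply: integral_ge0 => x /strip_gt0 x0; rewrite lee_fin mulr_ge0 ?sqr_ge0// ltW.
  rewrite ltNge leye_eq; apply/negP => /eqP e.
  move: foo; rewrite (L2sq_parts mf).
  have -> : (\int[leb2 R]_(x in S) (pt false f x ^+ 2 * x.1)%:E +
    \int[leb2 R]_(x in S) (pt true f x ^+ 2 * x.1)%:E = +oo)%E.
    case: b e => ->; first by rewrite addey// gt_eqF// (lt_le_trans _ (h false))// ltNyr.
    by rewrite addye// gt_eqF// (lt_le_trans _ (h true))// ltNyr.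
  by rewrite gt0_muley ?lte_fin.
split; first by split; [have [] := Lf false|have [] := Lf true].
by apply: lty_sqrte; rewrite L2sqE// ltry.
Qed.

Lemma in_L2_jetP u : (in_L2 u /\ in_L2 (jz u) /\ in_L2 (jp u) /\ in_L2 (jm u)) <->
  forall b, LJ (ptJ b u).
Proof.
split=> [[/in_L2P h0 [/in_L2P h1 [/in_L2P h2 /in_L2P h3]]] b|h].
  by case=> [|[|[|[|j]]]] /=; [exact: h0|exact: h1|exact: h2|exact: h3|exact: wL2_0].
split; first by apply/in_L2P => b; exact: (h b 0%N).
split; first by apply/in_L2P => b; exact: (h b 1%N).
by split; apply/in_L2P => b; [exact: (h b 2%N)|exact: (h b 3%N)].
Qed.

Lemma H1normE u : (forall b, LJ (ptJ b u)) ->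
  H1norm u = sqrte (2 * pi * (sqJ (ptJ false u) + sqJ (ptJ true u)))%:E.
Proof.
move=> Lu; rewrite /H1norm !L2sqE.
- rewrite -!EFinM -!EFinD; congr (sqrte _%:E).
  by rewrite /sqJ !aJE /=; set p := 2 * pi; field.
- by move=> b; exact: (Lu b 3%N).
- by move=> b; exact: (Lu b 2%N).
- by move=> b; exact: (Lu b 1%N).
- by move=> b; exact: (Lu b 0%N).
Qed.

Lemma sqrte_cvg0 (x_ : nat -> \bar R) : (forall n, (0 <= x_ n)%E) ->
  (fun n => sqrte (x_ n)) @ \oo --> 0%E <->
  forall e : R, 0 < e -> exists N, forall n, (N <= n)%N -> (x_ n <= e%:E)%E.
Proof.
move=> x0; split=> [/fine_cvgP[fin /cvgrPdist_le cf] e e0|h].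
  have se0 : 0 < Num.sqrt e by rewrite sqrtr_gt0.
  have [N1 _ P1] := fin; have [N2 _ P2] := cf _ se0.
  exists (maxn N1 N2) => n; rewrite geq_max => /andP[n1 n2].
  have := P1 n n1; have := P2 n n2; rewrite /=; case: (x_ n) (x0 n) => [r| |]//=.
  rewrite !lee_fin sub0r normrN ger0_norm ?sqrtr_ge0// => r0 + _.
  by rewrite ler_sqrt// ltW.
apply/fine_cvgP; split.
  have [N NP] := h 1 ltr01; exists N => // n /= Nn.
  rewrite sqrte_fin_num// ge0_fin_numE//; apply: le_lt_trans (NP n Nn) _; exact: ltry.
apply/cvgrPdist_le => e e0; have e20 : 0 < e ^+ 2 by rewrite exprn_gt0.
have [N NP] := h _ e20; exists N => // n /= Nn.
have := NP n Nn; case: (x_ n) (x0 n) => [r| |]//=; rewrite !lee_fin => r0 re.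
rewrite sub0r normrN ger0_norm ?sqrtr_ge0//.
by rewrite -(ger0_norm (ltW e0)) -sqrtr_sqr ler_sqrt// sqr_ge0.
Qed.

Lemma H1cvgP k (phi : nat -> R * R -> R[i]) u : (forall n, test k (phi n)) ->
  (forall b, LJ (ptJ b u)) ->
  H1cvg k phi u <-> forall b, jcvg (fun n => ptJ b (jet_of k (phi n))) (ptJ b u).
Proof.
move=> tphi Lu; rewrite /H1cvg.
have Lp n b : LJ (ptJ b (jet_of k (phi n))) by exact: test_jet_LJ.
pose q b n := sqJ (jlin 1 (ptJ b (jet_of k (phi n))) (-1) (ptJ b u)).
have q0 b n : 0 <= q b n by exact: sqJ_ge0.
have -> : (fun n => H1norm (jetB (jet_of k (phi n)) u)) =
    (fun n => sqrte (2 * pi * (q false n + q true n))%:E).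
  apply/funext => n; rewrite H1normE.
    by rewrite /q !(eq_sqJ (ptJ_jetB _ _ _)).
  by move=> b; apply: (LJ_eq _ (LJ_lin 1 (-1) (Lp n b) (Lu b))) => j x Sx; rewrite ptJ_jetB.
rewrite sqrte_cvg0; last first.
  by move=> n; rewrite lee_fin; apply: mulr_ge0; [exact: ltW|exact: addr_ge0].
split=> [h b e e0|h e e0].
  have [N NP] := h _ (mulr_gt0 pi2 e0); exists N => n Nn; rewrite -/(q b n).
  have := NP n Nn; rewrite lee_fin ler_pM2l//; apply: le_trans.
  by case: b; [rewrite lerDr|rewrite lerDl].
have d0 : 0 < e / (2 * pi) / 2 by rewrite !divr_gt0.
have [N NP] := h false _ d0; have [M MP] := h true _ d0.
exists (maxn N M) => n; rewrite geq_max => /andP[Nn Mn].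
rewrite lee_fin mulrC -ler_pdivlMr//.
have := NP n Nn; have := MP n Mn; rewrite -/(q false n) -/(q true n).
set y := e / _; lra.
Qed.

Lemma L2ip_parts b f h : (forall c, L2R (pt c f)) -> (forall c, L2R (pt c h)) ->
  part b (L2ip f h) = 2 * pi *
    (if b then ipR (pt true f) (pt false h) - ipR (pt false f) (pt true h)
     else ipR (pt false f) (pt false h) + ipR (pt true f) (pt true h)).
Proof.
move=> Lf Lh.
have i c d := wL2_integrable mS (@measurable_fst_strip R) (@strip_gt0 R) (Lf c) (Lh d).
case: b; rewrite /L2ip /=; congr (_ * _); rewrite /ipR /wip.
- rewrite -RintegralB//.
  apply: eq_Rintegral => x _; rewrite /pt /=.
  by case: (f x) (h x) => a c [a' c'] /=; ring.
- rewrite -RintegralD//.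
  apply: eq_Rintegral => x _; rewrite /pt /=.
  by case: (f x) (h x) => a c [a' c'] /=; ring.
Qed.

Definition formR b c f u v : R := aJ (ptJ b u) (ptJ c v) + ipR (pt b f) (ptJ c v 0%N).

(** The product is conjugate-linear in the second argument, hence the plus sign in the real part and
    the minus sign in the imaginary part. The coefficients being real, only the four real forms
    [formR] occur. *)
Lemma weak_form_parts b f u v : (forall c, L2R (pt c f)) -> (forall c, LJ (ptJ c u)) ->
  (forall c, LJ (ptJ c v)) ->
  part b ((2^-1)%:C * L2ip (jp u) (jp v) + (2^-1)%:C * L2ip (jm u) (jm v)
        + L2ip (jz u) (jz v) + L2ip f v) = 2 * pi *
    (if b then formR true false f u v - formR false true f u v
     else formR false false f u v + formR true true f u v).
Proof.
move=> Lf Lu Lv; rewrite !partD !partZ !L2ip_parts.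
- by rewrite /formR /aJ /=; case: b; ring.
- exact: Lf.
- by move=> c; exact: (Lv c 0%N).
- by move=> c; exact: (Lu c 1%N).
- by move=> c; exact: (Lv c 1%N).
- by move=> c; exact: (Lu c 3%N).
- by move=> c; exact: (Lv c 3%N).
- by move=> c; exact: (Lu c 2%N).
- by move=> c; exact: (Lv c 2%N).
Qed.

Definition ptg b g : R -> R := fun z => part b (g z).

Lemma H12sq_parts g : (forall b, measurable_fun setT (ptg b g : MR -> MR)) ->
  (H12sq g = H12sqR (ptg false g) + H12sqR (ptg true g))%E.
Proof.
move=> mg.
have h1 : (\int[leb R]_x (sqnormc (g x))%:E = N2 (ptg false g) + N2 (ptg true g))%E.
  rewrite /N2 -ge0_integralD//; try solve [exact: measurable_N2|by move=> x _; rewrite lee_fin sqr_ge0].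
  by apply: eq_integral => x _; rewrite -EFinD sqnormcE.
have h2 : (\int[leb2 R]_x (sqnormc (g x.1 - g x.2) / (x.1 - x.2) ^+ 2)%:E =
    \int[leb2 R]_x gagl (ptg false g) x + \int[leb2 R]_x gagl (ptg true g) x)%E.
  rewrite -ge0_integralD//; try solve [exact: measurable_gagl|by move=> x _; exact: gagl_ge0].
  by apply: eq_integral => x _; rewrite -EFinD sqnormcE -mulrDl /ptg !partB.
by rewrite /H12sq h1 h2 addeACA.
Qed.

Lemma H12sq_ge0 g : (0 <= H12sq g)%E.
Proof.
apply: adde_ge0; apply: integral_ge0 => x _; rewrite lee_fin ?sqnormc_ge0//.
by rewrite mulr_ge0 ?sqnormc_ge0// invr_ge0 sqr_ge0.
Qed.

Lemma cmeasurableP g : @cmeasurable _ MR R setT g <-> forall b, measurable_fun setT (ptg b g : MR -> MR).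
Proof. by split=> [[h1 h2] []//|h]; split; [exact: (h false)|exact: (h true)]. Qed.

Lemma in_H12P g : in_H12 g <->
  forall b, measurable_fun setT (ptg b g : MR -> MR) /\ (H12sqR (ptg b g) < +oo)%E.
Proof.
split=> [[/cmeasurableP mg /(sqrte_lty (H12sq_ge0 g)) goo] b|h].
  split; first exact: mg.
  apply: le_lt_trans goo; rewrite H12sq_parts//.
  by case: b; [rewrite leeDr|rewrite leeDl] => //; exact: H12sqR_ge0.
have mg b : measurable_fun setT (ptg b g : MR -> MR) by have [] := h b.
split; first exact/cmeasurableP.
apply: lty_sqrte; rewrite H12sq_parts// lte_add_pinfty//; first by have [] := h false.
by have [] := h true.
Qed.

Lemma test_csmooth k phi b : test k phi -> csmooth (fun z => pt b phi (1, z)).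
Proof.
move=> /testP/(_ b)[F tF e]; have := testR_trace tF; congr csmooth.
by apply/funext => z; rewrite e// /closed_strip/= ler01 lexx.
Qed.

Lemma H12cvgP k (phi : nat -> R * R -> R[i]) g : (forall n, test k (phi n)) ->
  (forall b, measurable_fun setT (ptg b g : MR -> MR)) ->
  (fun n => H12norm ((fun z => phi n (1, z)) \- g)) @ \oo --> 0%E <->
  forall b (e : R), 0 < e -> exists N, forall n, (N <= n)%N ->
    (H12sqR (fun z => pt b (phi n) (1%R, z) - ptg b g z)%R <= e%:E)%E.
Proof.
move=> tphi mg; rewrite /H12norm sqrte_cvg0; last by move=> n; exact: H12sq_ge0.
have mB n b : measurable_fun setT (fun z => pt b (phi n) (1, z) - ptg b g z : MR).
  apply: measurable_funB; last exact: mg.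
  exact: (csmooth_measurable (test_csmooth b (tphi n))).
have E n : H12sq ((fun z => phi n (1, z)) \- g) =
    (H12sqR (fun z => pt false (phi n) (1%R, z) - ptg false g z)%R +
     H12sqR (fun z => pt true (phi n) (1%R, z) - ptg true g z)%R)%E.
  have e b : ptg b ((fun z => phi n (1, z)) \- g) = fun z => pt b (phi n) (1, z) - ptg b g z.
    by apply/funext => z; rewrite /ptg /= partB.
  rewrite H12sq_parts; last by move=> b; rewrite e; exact: mB.
  by rewrite !e.
split=> [h b e e0|h e e0].
  have [N NP] := h e e0; exists N => n Nn; apply: le_trans (NP n Nn); rewrite E.
  by case: b; [rewrite leeDr|rewrite leeDl] => //; exact: H12sqR_ge0.
have e2 : 0 < e / 2 by rewrite divr_gt0.
have [N NP] := h false _ e2; have [M MP] := h true _ e2.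
exists (maxn N M) => n; rewrite geq_max => /andP[Nn Mn].
rewrite E (_ : e = e / 2 + e / 2); last by field.
by rewrite EFinD; apply: leeD; [exact: NP|exact: MP].
Qed.

Lemma in_H10_parts k v : in_H10 k v -> forall b, in_H10R k (ptJ b v).
Proof.
move=> [[h0 h1 h2 h3 _] [phi tphi cphi]].
have Lv : forall b, LJ (ptJ b v) by apply/in_L2_jetP.
move=> b; split => //.
have tphi' n := test0_test (tphi n).
have /(_ b) c := (H1cvgP tphi' Lv).1 cphi.
have ex n : exists F, test0R k F /\ eqJ (ptJ b (jet_of k (phi n))) (jetR k F).
  by have [F tF e] := test0P (tphi n) b; exists F; split => //; exact: test_jet.
have [F FP] := choice ex.
exists F => [n|]; first by have [] := FP n.
by apply: (eq_jcvg _ _ c) => // n; have [] := FP n.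
Qed.

Lemma ptJ_jet_of_parts (V : bool -> rjet) b j : (j < 4)%N -> ptJ b (jet_of_parts V) j = V b j.
Proof. by case: b; case: j => [|[|[|[|j]]]]. Qed.

Lemma jet_of_parts_LJ (V : bool -> rjet) : (forall b, LJ (V b)) ->
  forall b, LJ (ptJ b (jet_of_parts V)).
Proof.
move=> LV b j; have [j4|] := ltnP j 4; first by rewrite ptJ_jet_of_parts//; exact: LV.
by case: j => [|[|[|[|j]]]]// _; exact: wL2_0.
Qed.

Lemma jcvg_of_parts k (V : bool -> rjet) (F : nat -> bool -> R * R -> R) b :
  jcvg (fun n => jetR k (F n b)) (V b) ->
  jcvg (fun n => ptJ b (jet_of k (of_parts (F n)))) (ptJ b (jet_of_parts V)).
Proof.
move=> c e e0; have [N NP] := c e e0; exists N => n Nn; apply: le_trans (NP n Nn).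
rewrite ptJ_jet_of pt_of_parts le_eqVlt; apply/orP; left; apply/eqP.
by rewrite /sqJ /aJ /jlin !ptJ_jet_of_parts.
Qed.

Lemma H1cvg_of_parts k (V : bool -> rjet) (F : nat -> bool -> R * R -> R) :
  (forall n b, testR k (F n b)) -> (forall b, LJ (V b)) ->
  (forall b, jcvg (fun n => jetR k (F n b)) (V b)) ->
  H1cvg k (fun n => of_parts (F n)) (jet_of_parts V).
Proof.
move=> tF LV cF; apply/H1cvgP.
- by move=> n; exact: test_of_parts.
- exact: jet_of_parts_LJ.
- by move=> b; exact: jcvg_of_parts.
Qed.

(** A real test jet [v] is viewed as the complex jet [U] with imaginary part 0. The real part of the
    equation then concerns the real part of [u], and the imaginary part of the equation its
    imaginary part. *)
Lemma weak_solution_parts k f g u : in_L2 f -> in_H12 g -> weak_solution k f g u ->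
  forall b, weakR k (pt b f) (ptg b g) (ptJ b u).
Proof.
move=> /in_L2P Lf /in_H12P hg [[h0 h1 h2 h3 _] [phi [tphi cphi cH]] wk] b.
have Lu : forall b, LJ (ptJ b u) by apply/in_L2_jetP.
have mg c : measurable_fun setT (ptg c g : MR -> MR) by have [] := hg c.
split => //.
  have /(_ b) c := (H1cvgP tphi Lu).1 cphi.
  have /(_ b) cg := (H12cvgP tphi mg).1 cH.
  have ex n : exists F, [/\ testR k F, eqJ (ptJ b (jet_of k (phi n))) (jetR k F) &
      forall z, pt b (phi n) (1, z) = F (1, z)].
    have [F tF e] := testP (tphi n) b; exists F; split => //; first exact: test_jet.
    by move=> z; apply: e; rewrite /closed_strip/= ler01 lexx.
  have [F FP] := choice ex.
  exists F; split => [n||e e0]; first by have [] := FP n.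
    by apply: (eq_jcvg _ _ c) => // n; have [] := FP n.
  have [N NP] := cg e e0; exists N => n Nn; apply: le_trans (NP n Nn).
  have [_ _ eF] := FP n.
  rewrite le_eqVlt; apply/orP; left; apply/eqP; congr H12sqR.
  by apply/funext => z; rewrite eF.
move=> v [Lv [F tF cF]].
pose V c : rjet := if c then (fun _ => fun=> 0) else v.
pose G n c : R * R -> R := if c then fun=> 0 else F n.
have LV c : LJ (V c) by case: c => // j; exact: wL2_0.
pose Z0 : R * R -> R := fun=> 0.
have t0 : test0R k Z0.
  by split; [exact: CinftyR0|exists set0; split => //; exact: compact0].
have tG n c : test0R k (G n c) by case: c; [exact: t0|exact: tF].
have cG c : jcvg (fun n => jetR k (G n c)) (V c).
  case: c => // e e0; exists 0%N => n _.
  (* The jet of the zero function is seen to vanish by linearity, as a combination of itself with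
     coefficients 0. *)
  have E : eqJ (jetR k Z0) (jlin 0 (jetR k Z0) 0 (jetR k Z0)).
    move=> j x Sx; rewrite -(jetR_jlin 0 0 (test0R_test t0) (test0R_test t0) j Sx).
    by congr (jetR k _ j x); apply/funext => y; rewrite /Z0 !mul0r addr0.
  have L0 := test_LJ (test0R_test t0).
  have := sqJ_lin2 0 0 L0 L0; rewrite expr0n/= !mulr0 !mul0r addr0 => h.
  apply: le_trans (ltW e0); apply: le_trans h; rewrite le_eqVlt; apply/orP; left; apply/eqP.
  by apply: eq_sqJ => j x Sx; rewrite /jlin /G /V -/Z0 E// /jlin; ring.
pose U := jet_of_parts V.
have LU := jet_of_parts_LJ LV.
have hU : in_H10 k U.
  have cc : H1cvg k (fun n => of_parts (G n)) U.
    by apply: H1cvg_of_parts => // n c; exact: test0R_test.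
  have [? [? [? ?]]] := (in_L2_jetP U).2 LU.
  split; [split => //|]; exists (fun n => of_parts (G n)) => // n.
    by apply: test_of_parts => c; exact: test0R_test.
  exact: test0_of_parts.
have w := wk _ hU.
have := weak_form_parts false Lf Lu LU; have := weak_form_parts true Lf Lu LU.
rewrite w.
have z c : formR c true f u U = 0.
  have Lc := Lu c; have Lfc := Lf c.
  have E : eqJ (ptJ true U) (jlin 0 v 0 v).
    move=> j x _; rewrite /jlin !mul0r addr0.
    by case: j => [|[|[|[|j]]]].
  rewrite /formR (eq_aJ (fun _ _ _ => erefl) E) aJ_linr//.
  have -> : ipR (pt c f) (ptJ true U 0%N) = ipR (pt c f) (fun x => 0 * v 0%N x + 0 * v 0%N x).
    by apply: eq_wip => // x Sx; rewrite (E 0%N x Sx).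
  by rewrite ipR_linr// !mul0r !addr0.
have ff c : formR c false f u U = aJ (ptJ c u) v + ipR (pt c f) (v 0%N) by [].
have q (x : R) : 0 = 2 * pi * x -> x = 0.
  by move/esym/eqP; rewrite mulf_eq0 (gt_eqF pi2) => /eqP.
have p0 c : part c 0 = 0 by case: c.
by rewrite !z !ff subr0 addr0 !p0 => /q h /q h'; case: b.
Qed.

Lemma weak_solution_of_parts k f g (V : bool -> rjet) : in_L2 f -> in_H12 g ->
  (forall b, weakR k (pt b f) (ptg b g) (V b)) -> weak_solution k f g (jet_of_parts V).
Proof.
move=> /in_L2P Lf /in_H12P hg hV.
have mg c : measurable_fun setT (ptg c g : MR -> MR) by have [] := hg c.
have LV b : LJ (V b) by have [] := hV b.
have ex b : exists phi : nat -> R * R -> R,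
    [/\ forall n, testR k (phi n), jcvg (fun n => jetR k (phi n)) (V b) &
    forall e : R, 0 < e -> exists N, forall n, (N <= n)%N ->
      (H12sqR (fun z => phi n (1, z) - ptg b g z)%R <= e%:E)%E] by have [] := hV b.
have [F FP] := choice ex.
pose G n b := F b n.
have tG n b : testR k (G n b) by have [h _ _] := FP b; exact: h.
have LU := jet_of_parts_LJ LV.
have tG' n : test k (of_parts (G n)) by apply: test_of_parts.
have cc : H1cvg k (fun n => of_parts (G n)) (jet_of_parts V).
  by apply: H1cvg_of_parts => // b; have [] := FP b.
split.
- have [? [? [? ?]]] := (in_L2_jetP (jet_of_parts V)).2 LU.
  by split => //; exists (fun n => of_parts (G n)).
- exists (fun n => of_parts (G n)); split => //.
  apply/(H12cvgP tG' mg) => b e e0; have [_ _ /(_ e e0)[N NP]] := FP b.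
  by exists N => n Nn; rewrite pt_of_parts; exact: NP.
move=> v hv; have hb := in_H10_parts hv.
have Lv b : LJ (ptJ b v) by have [] := hb b.
have z b c : formR b c f (jet_of_parts V) v = 0.
  have [_ _ /(_ _ (hb c)) <-] := hV b.
  by rewrite /formR /aJ !ptJ_jet_of_parts.
apply: eq_parts => b; transitivity (0 : R); last by case: b.
have e b' : part b' ((2^-1)%:C * L2ip (jp (jet_of_parts V)) (jp v) +
    (2^-1)%:C * L2ip (jm (jet_of_parts V)) (jm v)
    + L2ip (jz (jet_of_parts V)) (jz v) + L2ip f v) = 0.
  by rewrite weak_form_parts// !z; case: b'; rewrite ?subr0 ?addr0 mulr0.
exact: e.
Qed.

(** The difference of two weak solutions solves the problem with the differences of the data, so the
    energy estimate applies to each part. The real number [x] is the squared norm, which spares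
    manipulating extended square roots. *)
Lemma difference_estimate k : exists2 C : R, 0 <= C & forall f g u f' g' u',
  in_L2 f -> in_H12 g -> in_L2 f' -> in_H12 g' ->
  weak_solution k f g u -> weak_solution k f' g' u' ->
  exists2 x : R, H1norm (jetB u' u) = sqrte x%:E &
    (x%:E <= C%:E * (L2sq (f' \- f)%R + H12sq (g' \- g)%R))%E.
Proof.
have [C C0 HC] := @energy_estimate R k.
(* The squared norms of the solution and of [f] both carry the factor $2\pi$, the one of [g] does
   not; [1 + 2 * pi] dominates the coefficients 1 and $2\pi$ that result. *)
exists (C * (1 + 2 * pi)) => [|f g u f' g' u' hf hg hf' hg' wu wu'].
  by rewrite mulr_ge0// addr_ge0// ltW.
have pu := weak_solution_parts hf hg wu; have pu' := weak_solution_parts hf' hg' wu'.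
move/in_L2P : hf => hf; move/in_L2P : hf' => hf'; move/in_H12P : hg => hg; move/in_H12P : hg' => hg'.
have Lu b : LJ (ptJ b u) by have [] := pu b.
have Lu' b : LJ (ptJ b u') by have [] := pu' b.
have mg b : measurable_fun setT (ptg b g : MR -> MR) by have [] := hg b.
have mg' b : measurable_fun setT (ptg b g' : MR -> MR) by have [] := hg' b.
pose D b := jlin 1 (ptJ b u') (-1) (ptJ b u).
pose df b := fun x => 1 * pt b f' x + -1 * pt b f x.
pose dg b := fun z => ptg b g' z - ptg b g z.
have Ldf b : L2R (df b).
  have L x : L2R (pt b f') /\ L2R (pt b f) -> L2R (fun y => 1 * pt b f' y + x * pt b f y).
    move=> [L1 L2]; have h := @measurable_fst_strip R; have p := @strip_gt0 R.
    exact: (wL2D mS h p (wL2Z mS h p 1 L1) (wL2Z mS h p x L2)).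
  exact: L.
have mdg b : measurable_fun setT (dg b : MR -> MR).
  by apply: measurable_funB; [exact: mg'|exact: mg].
have est b : ((sqJ (D b))%:E <= C%:E * ((sqR (df b))%:E + H12sqR (dg b)))%E.
  by apply: HC => //; exact: weakR_sub.
have ef b : pt b (f' \- f) = fun x => pt b f' x - pt b f x.
  by apply/funext => x; rewrite /pt /= partB.
have edf b : df b = pt b (f' \- f).
  by rewrite ef; apply/funext => x; rewrite /df; ring.
have edg b : ptg b (g' \- g) = dg b by apply/funext => z; rewrite /ptg /= partB.
have LB b : LJ (ptJ b (jetB u' u)).
  by apply: LJ_eq (LJ_lin 1 (-1) (Lu' b) (Lu b)) => j x Sx; rewrite ptJ_jetB.
exists (2 * pi * (sqJ (D false) + sqJ (D true))).
  by rewrite H1normE// !(eq_sqJ (ptJ_jetB _ _ _)).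
rewrite L2sqE => [|b]; last by rewrite -edf.
rewrite H12sq_parts => [|b]; last by rewrite edg.
rewrite !edg -!edf.
have [H0 H1] := (H12sqR_ge0 (dg false), H12sqR_ge0 (dg true)).
have s0 := sqR_ge0 (df false); have s1 := sqR_ge0 (df true).
apply: (@le_trans _ _ ((2 * pi)%:E * (C%:E * (((sqR (df false))%:E + H12sqR (dg false)) +
    ((sqR (df true))%:E + H12sqR (dg true)))))%E).
  rewrite EFinM; apply: lee_wpmul2l; first by rewrite lee_fin ltW.
  rewrite EFinD ge0_muleDr; last 2 first.
    by rewrite adde_ge0 ?lee_fin.
    by rewrite adde_ge0 ?lee_fin.
  exact: leeD.
rewrite muleCA (EFinM C) -muleA; apply: lee_wpmul2l; first by rewrite lee_fin.
rewrite addeACA -EFinD; set s := sqR _ + sqR _; set H := (H12sqR (dg false) + H12sqR (dg true))%E.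
have s_ge0 : 0 <= s by rewrite addr_ge0.
have H_ge0 : (0 <= H)%E by exact: adde_ge0.
have s2 : (0 <= s%:E)%E by rewrite lee_fin.
have ps : (0 <= (2 * pi * s)%:E)%E by rewrite lee_fin; apply: mulr_ge0 => //; exact: ltW.
rewrite (ge0_muleDr _ s2 H_ge0) (ge0_muleDr _ ps H_ge0).
rewrite -!EFinM; apply: leeD.
  have p0 : 0 <= 2 * pi * s by rewrite -lee_fin.
  by rewrite lee_fin; apply: ler_peMl => //; rewrite lerDl ltW.
by apply: lee_wpmul2r => //; rewrite lee_fin lerDr.
Qed.

Lemma L2sq0 f : (forall x, f x = 0) -> L2sq f = 0%E.
Proof.
move=> f0; rewrite /L2sq integral0_eq ?mule0// => x _.
by rewrite f0 sqnormcE expr0n/= addr0 mul0r.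
Qed.

Lemma H12sq0 g : (forall x, g x = 0) -> H12sq g = 0%E.
Proof.
move=> g0; rewrite /H12sq !integral0_eq ?adde0// => x _.
  by rewrite !g0 subr0 sqnormcE expr0n/= addr0 mul0r.
by rewrite g0 sqnormcE expr0n/= addr0.
Qed.

Lemma weak_solution_exists k f g : in_L2 f -> in_H12 g -> exists u, weak_solution k f g u.
Proof.
move=> hf hg.
have ex b : exists V, weakR k (pt b f) (ptg b g) V.
  have [mg goo] := (in_H12P g).1 hg b.
  by apply: exists_weakR => //; exact: (in_L2P f).1.
have [V VP] := choice ex.
by exists (jet_of_parts V); exact: weak_solution_of_parts.
Qed.

Lemma weak_solution_unique k f g u v : in_L2 f -> in_H12 g ->
  weak_solution k f g u -> weak_solution k f g v -> H1norm (jetB v u) = 0%E.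
Proof.
move=> hf hg wu wv; have [C C0 HC] := difference_estimate k.
have [x -> ] := HC _ _ _ _ _ _ hf hg hf hg wu wv.
rewrite L2sq0 => [|y]; last by rewrite /= subrr.
rewrite H12sq0 => [|y]; last by rewrite /= subrr.
rewrite adde0 mule0 lee_fin => x0.
(* The estimate gives [x <= 0], and the real square root is 0 there. *)
by congr EFin; exact: ler0_sqrtr.
Qed.

Lemma sqrte_lt (x : \bar R) (d : R) : 0 < d -> (0 <= x)%E -> (sqrte x < d%:E)%E -> (x < (d ^+ 2)%:E)%E.
Proof.
case: x => [r| |]//= d0; rewrite !lee_fin !lte_fin => r0 h.
by rewrite -(sqr_sqrtr r0) ltrXn2r// ?nnegrE ?sqrtr_ge0// ltW.
Qed.

Lemma weak_solution_continuous k f g u : in_L2 f -> in_H12 g -> weak_solution k f g u ->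
  forall eps : R, 0 < eps -> exists2 delta : R, 0 < delta &
    forall f' g' u', in_L2 f' -> in_H12 g' -> weak_solution k f' g' u' ->
      (L2norm (f' \- f)%R < delta%:E)%E -> (H12norm (g' \- g)%R < delta%:E)%E ->
      (H1norm (jetB u' u) < eps%:E)%E.
Proof.
move=> hf hg wu eps e0; have [C C0 HC] := difference_estimate k.
have C1 : 0 < 1 + 2 * C by rewrite ltr_pwDl// mulr_ge0.
(* With both data within [d] the squared norm is at most [2 * C * d ^+ 2], strictly below
   [((1 + 2 * C) * d) ^+ 2 = eps ^+ 2]; this covers [C = 0] too. *)
exists (eps / (1 + 2 * C)); first exact: divr_gt0.
set d := eps / _; have d0 : 0 < d by exact: divr_gt0.
move=> f' g' u' hf' hg' wu' /(sqrte_lt d0 (L2sq_ge0 _)) Ld /(sqrte_lt d0 (H12sq_ge0 _)) Hd.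
have [x -> xle] := HC _ _ _ _ _ _ hf hg hf' hg' wu wu'.
have {xle} xle : x <= 2 * C * d ^+ 2.
  rewrite -lee_fin (_ : 2 * C * d ^+ 2 = C * (d ^+ 2 + d ^+ 2)); last by ring.
  apply: le_trans xle _; rewrite (EFinM C) EFinD.
  by apply: lee_wpmul2l; [rewrite lee_fin|apply: leeD; exact: ltW].
have xlt : x < eps ^+ 2.
  have eE : eps = (1 + 2 * C) * d by rewrite mulrCA mulfV ?mulr1// gt_eqF.
  rewrite eE; clearbody d.
  have d20 : 0 < d ^+ 2 by rewrite exprn_gt0.
  apply: le_lt_trans xle _; rewrite exprMn ltr_pM2r//.
  by rewrite expr2; nra.
rewrite lte_fin -(ger0_norm (ltW e0)) -sqrtr_sqr.
by rewrite ltr_sqrt// exprn_gt0.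
Qed.

End complex_parts.

Theorem lemma4p3 (R : realType) (k : nat) :
  (forall (f : R * R -> R[i]) (g : R -> R[i]), in_L2 f -> in_H12 g ->
     exists u : jet R,
       weak_solution k f g u /\
       (forall v : jet R, weak_solution k f g v -> H1norm (jetB v u) = 0%E)) /\
  (forall (f : R * R -> R[i]) (g : R -> R[i]) (u : jet R),
     in_L2 f -> in_H12 g -> weak_solution k f g u ->
     forall eps : R, 0 < eps ->
       exists2 delta : R, 0 < delta &
         forall (f' : R * R -> R[i]) (g' : R -> R[i]) (u' : jet R),
           in_L2 f' -> in_H12 g' -> weak_solution k f' g' u' ->
           (L2norm (f' \- f)%R < delta%:E)%E ->
           (H12norm (g' \- g)%R < delta%:E)%E ->
           (H1norm (jetB u' u) < eps%:E)%E).
Proof.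
split=> [f g hf hg|f g u hf hg wu].
  have [u wu] := weak_solution_exists k hf hg.
  by exists u; split => // v wv; exact: weak_solution_unique hf hg wu wv.
exact: weak_solution_continuous hf hg wu.
Qed.
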